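(* Fix an index $i\in\{1,\dots,n\}$. With respect to the symmetric measure, the edgelength $|e_i|$ has the following probability density functions. For $n\ge2$, on $\mathrm{Arm}_3(n)$ and $\mathrm{Arm}_2(n)$ respectively (densities on $[0,2]$), $$\phi_3^{\mathrm{Arm}}(y)=\frac{(2n-2)(2n-1)}{2^{2n-1}}\,y(2-y)^{2n-3},\qquad \phi_2^{\mathrm{Arm}}(y)=\frac{n-1}{2^{n-1}}(2-y)^{n-2},$$ and for $n\ge3$, on $\mathrm{Pol}_3(n)$ and $\mathrm{Pol}_2(n)$ respectively (densities on $[0,1]$), $$\phi_3^{\mathrm{Pol}}(y)=(n-2)(n-1)\,y(1-y)^{n-3},\qquad \phi_2^{\mathrm{Pol}}(y)=\left(\tfrac n2-1\right)(1-y)^{\frac n2-2}.$$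
   Context: Polygons. For $d\in\{2,3\}$, $\mathrm{Arm}_d(n)$ is the space of lists $(e_1,\dots,e_n)$ of edge vectors in $\mathbb{R}^d$ with $\sum|e_i|=2$, and $\mathrm{Pol}_d(n)\subset\mathrm{Arm}_d(n)$ is the subspace of closed polygons, $\sum e_i=0$. Hopf map. Let $\mathbb{H}$ be the quaternions with units $\mathbf i,\mathbf j,\mathbf k$. Identify $\mathbb{R}^3$ with the imaginary quaternions and $\mathbb{R}^2$ with the plane $\mathbf i\mathbb{R}\oplus\mathbf k\mathbb{R}$. Let $\mathrm{Hopf}(q)=\bar q\,\mathbf i\,q$, extended coordinatewise to $\mathbb{H}^n$, so that $q=(q_1,\dots,q_n)$ maps to the edge list $e_m=\bar q_m\mathbf i q_m$, with $|e_m|=|q_m|^2$. Identify $\mathbb{C}^n\times\mathbb{C}^n$ with $\mathbb{H}^n$ by $(a,b)\mapsto a+b\,\mathbf j$, where $\mathbb{C}=\mathbb{R}\oplus\mathbf i\mathbb{R}$. Symmetric measure. $\mathrm{Hopf}$ maps the following model spaces onto the polygon spaces: the sphere $S^{4n-1}\subset\mathbb{H}^n$ of radius $\sqrt2$ onto $\mathrm{Arm}_3(n)$; the disjoint union $S^{2n-1}\sqcup S^{2n-1}$ of the spheres of radius $\sqrt2$ in $(\mathbb{R}\oplus\mathbf j\mathbb{R})^n$ and $(\mathbf i\mathbb{R}\oplus\mathbf k\mathbb{R})^n$ onto $\mathrm{Arm}_2(n)$; the Stiefel manifold $V_2(\mathbb{C}^n)$ of Hermitian-orthonormal pairs $(a,b)$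 in $\mathbb{C}^n$ onto $\mathrm{Pol}_3(n)$; and $V_2(\mathbb{R}^n)\sqcup\mathbf i V_2(\mathbb{R}^n)$, where $V_2(\mathbb{R}^n)$ is the set of orthonormal pairs in $\mathbb{R}^n$, onto $\mathrm{Pol}_2(n)$. The symmetric measure on each polygon space is the pushforward under $\mathrm{Hopf}$ of the Riemannian volume measure (as a submanifold of $\mathbb{H}^n$) of its model space, normalized to total mass $1$. *)

(* Defs.v *)
From mathcomp Require Export all_boot all_order all_algebra.
From mathcomp Require Export all_classical all_reals all_analysis.
From mathcomp Require Export complex.

Set Implicit Arguments.
Unset Strict Implicit.
Unset Printing Implicit Defensive.
Import Order.TTheory GRing.Theory Num.Theory.
Import numFieldNormedType.Exports.

Local Open Scope classical_set_scope.
Local Open Scope ring_scope.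

Notation borel T := (g_sigma_algebraType (@open T)).

(* [quat R] is the real quaternions in the basis 1, i, j, k; [quatn R n] is
   H^n, row [m] being the [m]-th quaternionic coordinate.  As matrices, these
   types carry their usual topology and differential calculus. *)
Notation quat R := 'rV[R]_4.
Notation quatn R n := 'M[R]_(n, 4).

Definition mkquat (R : realType) (s x y z : R) : quat R :=
  \row_(c < 4) [:: s; x; y; z]`_c.

Definition quat_i (R : realType) : quat R := mkquat 0 1 0 0.

Definition mulq (R : realType) (p q : quat R) : quat R :=
  mkquat
    (p 0 0 * q 0 0 - p 0 1 * q 0 1 - p 0 2 * q 0 2 - p 0 3 * q 0 3)
    (p 0 0 * q 0 1 + p 0 1 * q 0 0 + p 0 2 * q 0 3 - p 0 3 * q 0 2)
    (p 0 0 * q 0 2 - p 0 1 * q 0 3 + p 0 2 * q 0 0 + p 0 3 * q 0 1)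
    (p 0 0 * q 0 3 + p 0 1 * q 0 2 - p 0 2 * q 0 1 + p 0 3 * q 0 0).

Definition conjq (R : realType) (q : quat R) : quat R :=
  mkquat (q 0 0) (- q 0 1) (- q 0 2) (- q 0 3).

Definition Hopf1 (R : realType) (q : quat R) : quat R :=
  mulq (mulq (conjq q) (quat_i R)) q.

Definition Hopf (R : realType) (n : nat) (q : quatn R n) : quatn R n :=
  \matrix_(m < n) Hopf1 (row m q).

(* (a, b) |-> a + b j, with j = 0 + 0 i + 1 j and (u + v i) j = u j + v k *)
Definition quatn_of_pair (R : realType) (n : nat) (a b : 'rV[R[i]]_n) :
    quatn R n :=
  \matrix_(m < n) mkquat (complex.Re (a 0 m)) (complex.Im (a 0 m))
                         (complex.Re (b 0 m)) (complex.Im (b 0 m)).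

Definition edge_length (R : realType) (n d : nat) (e : 'M[R]_(n, d))
    (m : 'I_n) : R :=
  Num.sqrt (\sum_(c < d) e m c ^+ 2).

Definition Arm (R : realType) (d n : nat) : set 'M[R]_(n, d) :=
  [set e | \sum_(m < n) edge_length e m = 2].

Definition Pol (R : realType) (d n : nat) : set 'M[R]_(n, d) :=
  [set e | Arm e /\ \sum_(m < n) row m e = 0].

(* R^3 as the imaginary quaternions, R^2 as the plane iR + kR *)
Definition embed3 (R : realType) (n : nat) (e : 'M[R]_(n, 3)) : quatn R n :=
  \matrix_(m < n) mkquat 0 (e m 0) (e m 1) (e m 2).

Definition embed2 (R : realType) (n : nat) (e : 'M[R]_(n, 2)) : quatn R n :=
  \matrix_(m < n) mkquat 0 (e m 0) 0 (e m 1).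

Definition dotq (R : realType) (n : nat) (p q : quatn R n) : R :=
  \sum_(m < n) \sum_(c < 4) p m c * q m c.

Definition model_Arm3 (R : realType) (n : nat) : set (quatn R n) :=
  [set q | dotq q q = 2].

Definition model_Arm2 (R : realType) (n : nat) : set (quatn R n) :=
  [set q | dotq q q = 2 /\ forall m, q m 1 = 0 /\ q m 3 = 0] `|`
  [set q | dotq q q = 2 /\ forall m, q m 0 = 0 /\ q m 2 = 0].

Definition herm (R : realType) (n : nat) (a b : 'rV[R[i]]_n) : R[i] :=
  \sum_(m < n) a 0 m * conjc (b 0 m).

Definition V2C (R : realType) (n : nat) : set ('rV[R[i]]_n * 'rV[R[i]]_n) :=
  [set ab : 'rV[R[i]]_n * 'rV[R[i]]_n |
           [/\ herm ab.1 ab.1 = 1, herm ab.2 ab.2 = 1 & herm ab.1 ab.2 = 0]].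

Definition V2R (R : realType) (n : nat) : set ('rV[R]_n * 'rV[R]_n) :=
  [set ab : 'rV[R]_n * 'rV[R]_n |
           [/\ \sum_(m < n) ab.1 0 m * ab.1 0 m = 1,
                \sum_(m < n) ab.2 0 m * ab.2 0 m = 1 &
                \sum_(m < n) ab.1 0 m * ab.2 0 m = 0]].

Definition model_Pol3 (R : realType) (n : nat) : set (quatn R n) :=
  [set quatn_of_pair ab.1 ab.2 | ab in @V2C R n].

Definition V2R_quatn (R : realType) (n : nat) : set (quatn R n) :=
  [set quatn_of_pair (map_mx (real_complex R) ab.1)
                     (map_mx (real_complex R) ab.2) | ab in @V2R R n].

Definition model_Pol2 (R : realType) (n : nat) : set (quatn R n) :=
  @V2R_quatn R n `|`
  [set \matrix_(m < n) mulq (quat_i R) (row m q) | q in @V2R_quatn R n].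

(* Integral over R^d of a nonnegative Borel function against d-dimensional
   Lebesgue measure, as the iterated integral (Tonelli). *)
Fixpoint integral_rV (R : realType) (d : nat) : ('rV[R]_d -> \bar R) -> \bar R :=
  match d with
  | 0 => fun f => f 0
  | d'.+1 => fun f =>
      (\int[@lebesgue_measure R]_t
         @integral_rV R d' (fun v => f (row_mx (t%:M : 'M[R]_1) v)))%E
  end.

(* An injective C^1 immersion of the open set [U] of R^d into [M].  When [M] is
   a [d]-dimensional submanifold this is a local parametrization of [M]. *)
Definition local_param (R : realType) (n d : nat) (M : set (quatn R n))
    (U : set 'rV[R]_d) (phi : 'rV[R]_d -> quatn R n) : Prop :=
  [/\ open U,
      phi @` U `<=` M,
      {in U &, injective phi},
      (forall x, U x -> differentiable phi x /\
         forall v, {for x, continuous (fun y => 'D_v phi y)}) &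
      (forall x, U x -> injective (fun v => 'D_v phi x))].

Definition metric_tensor (R : realType) (n d : nat)
    (phi : 'rV[R]_d -> quatn R n) (x : 'rV[R]_d) : 'M[R]_d :=
  \matrix_(a, b) dotq ('D_(delta_mx 0 a) phi x) ('D_(delta_mx 0 b) phi x).

(* d(mu) = sqrt (det g) dx in every local parametrization of [M], for the metric
   g induced by [dotq].  Since the parametrized pieces cover [M], this
   determines the Borel measure [mu] on H^n carried by [M]. *)
Definition is_riemannian_volume (R : realType) (n d : nat)
    (M : set (quatn R n))
    (mu : {measure set (borel (quatn R n)) -> \bar R}) : Prop :=
  mu (~` M) = 0%E /\
  forall (U : set 'rV[R]_d) (phi : 'rV[R]_d -> quatn R n)
         (A : set (borel (quatn R n))),
    local_param M U phi -> measurable A -> A `<=` phi @` U ->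
    mu A = integral_rV (fun x =>
      (\1_(U `&` phi @^-1` A) x * Num.sqrt (\det (metric_tensor phi x)))%:E).

(* [P] is the pushforward under [Hopf] of the Riemannian volume of the
   [dim]-dimensional model space [M], normalized to total mass 1 and read on
   edge lists in R^d through [embed].  The Dirac mass is only the default value
   which [mnormalize] takes when the total mass is 0 or infinite. *)
Definition is_symmetric_measure (R : realType) (n d dim : nat)
    (M : set (quatn R n)) (embed : 'M[R]_(n, d) -> quatn R n)
    (P : set 'M[R]_(n, d) -> \bar R) : Prop :=
  exists2 mu : {measure set (borel (quatn R n)) -> \bar R},
    is_riemannian_volume dim M mu &
    forall A : set 'M[R]_(n, d),
      P A = pushforward (mnormalize mu (\d_(0 : borel (quatn R n))))
              (@Hopf R n : borel (quatn R n) -> borel (quatn R n))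
              (embed @` A).

Definition symmetric_Arm3 (R : realType) (n : nat)
    (P : set 'M[R]_(n, 3) -> \bar R) : Prop :=
  is_symmetric_measure (4 * n - 1) (@model_Arm3 R n) (@embed3 R n) P.

Definition symmetric_Arm2 (R : realType) (n : nat)
    (P : set 'M[R]_(n, 2) -> \bar R) : Prop :=
  is_symmetric_measure (2 * n - 1) (@model_Arm2 R n) (@embed2 R n) P.

(* V_2(C^n) is cut out by 4 real equations in real dimension 4 n *)
Definition symmetric_Pol3 (R : realType) (n : nat)
    (P : set 'M[R]_(n, 3) -> \bar R) : Prop :=
  is_symmetric_measure (4 * n - 4) (@model_Pol3 R n) (@embed3 R n) P.

(* V_2(R^n) is cut out by 3 equations in dimension 2 n *)
Definition symmetric_Pol2 (R : realType) (n : nat)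
    (P : set 'M[R]_(n, 2) -> \bar R) : Prop :=
  is_symmetric_measure (2 * n - 3) (@model_Pol2 R n) (@embed2 R n) P.

(* [f] is a probability density, on the set [D], of the random variable [X] on
   the sample space [S] with law [P]. *)
Definition has_density (R : realType) (T : Type) (P : set T -> \bar R)
    (S : set T) (X : T -> R) (D : set R) (f : R -> R) : Prop :=
  [/\ measurable_fun D f,
      (forall y, D y -> 0 <= f y) &
      forall B : set R, measurable B ->
        P (S `&` X @^-1` B) =
        (\int[@lebesgue_measure R]_(y in D `&` B) (f y)%:E)%E].

(* Main.v *)
(* |e_i| is the squared norm of the i-th quaternionic coordinate of a point q of
   the model space M.  Up to a null set, M is a disjoint union of isometric copies
   of one chart, the graph of the last one (arms), three or four (planar or spatial
   polygons) real coordinates over the others.  If the gradients of the equations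
   of M are orthogonal with squared norms b_l (up to a factor), and L is their minor
   at the dependent coordinates, then det(metric) det(L)^2 = prod_l b_l.  So the
   volume density is explicit: a power of 2 - |x|^2 for the spheres, and for the
   Stiefel manifolds a product of inverse square roots of Gram determinants.
   Integrating out all the rows but the first leaves a power of 2 - |q_1|^2 or of
   1 - |q_1|^2, whose image under |q_1|^2 is computed in R^2 or R^4; the total mass
   fixes the constant.  All indices i are equivalent by symmetry.  The set missed
   by the copies of the chart is null since infinitely many reflections preserving
   M map it to sets of equal measure which are almost disjoint. *)

(* [is_riemannian_volume] speaks only of subsets of the image of one parametrization: that the total
   mass is finite and that isometries of M preserve the measure is not given and has to be proved.
   Both are obtained together, by cutting a set along finitely many isometric copies of one chart
   that cover M ([measure_moves_cover]). Only then can the part missed by the disjoint copies be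
   shown null; no theory of dimension enters, only finiteness, invariance and reflections. No
   constant of integration is evaluated: every integration yields some positive factor, and the
   constants in the densities are justified by showing that each density has integral 1. The
   exponents are bookkeeping: every real integration of a power of a quadratic raises the exponent
   by 1/2, and for determinants the factors produced by completing squares take part of this gain
   back. Powers cut off at 0 ([pos_powR]) carry the domains of the charts inside the integrands, so
   that the iterated integrals run over the whole space. *)
From HB Require Import structures.
Require Import Defs.
From mathcomp Require Import perm measurable_realfun ring lra zify.
Set Implicit Arguments.
Unset Strict Implicit.
Unset Printing Implicit Defensive.
Import Order.TTheory GRing.Theory Num.Theory.
Import numFieldNormedType.Exports.
Local Open Scope classical_set_scope.
Local Open Scope ring_scope.

(** * Beta-type integrals *)

Definition image_measure d d' (T1 : measurableType d) (T2 : measurableType d')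
    (R : realFieldType) (m : {measure set T1 -> \bar R}) (f : T1 -> T2)
    (mf : measurable_fun setT f) : {measure set T2 -> \bar R}.
Proof. refine (pushforward m f); exact: mf. Defined.

Section line_integrals.
Context {R : realType}.
Local Notation leb := (@lebesgue_measure R).

(** The cutoff gives 0 at every nonpositive base, also when the exponent is 0 or negative;
    [pos_powR 0] is the indicator of the positive half-line. Domain conditions of charts thereby
    become part of the integrands. *)
Definition pos_powR (s x : R) : R := if 0 < x then x `^ s else 0.

Lemma pos_powR_ge0 s x : 0 <= pos_powR s x.
Proof. by rewrite /pos_powR; case: ifP => // _; exact: powR_ge0. Qed.

Lemma pos_powR_le0 s x : x <= 0 -> pos_powR s x = 0.
Proof. by rewrite /pos_powR ltNge => ->. Qed.

Lemma pos_powR_gt0 s x : 0 < x -> pos_powR s x = x `^ s.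
Proof. by rewrite /pos_powR => ->. Qed.

Lemma measurable_pos_powR s : measurable_fun setT (pos_powR s).
Proof.
apply: measurable_fun_ifT.
- by apply: measurable_fun_ltr.
- exact: measurable_powR.
- exact: measurable_cst.
Qed.

Lemma pos_powRM s x y : 0 < x -> pos_powR s (x * y) = x `^ s * pos_powR s y.
Proof.
move=> x0; rewrite /pos_powR pmulr_rgt0//.
by case: ifP => y0; rewrite ?mulr0// powRM// ltW.
Qed.

(** Uniqueness of Lebesgue measure: [a] times its image under the affine map gives each half-open
    interval its length. *)
Lemma integral_affine (a b : R) (f : R -> \bar R) : 0 < a ->
  measurable_fun setT f -> (forall x, 0 <= f x)%E ->
  (\int[leb]_x f (a * x + b)%R = (a^-1)%:E * \int[leb]_x f x)%E.
Proof.
move=> a0 mf f0.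
pose phi : R -> measurableTypeR R := fun x => a * x + b.
have mphi : measurable_fun setT phi.
  by apply: measurable_funD => //; exact: measurable_funM.
pose nu : {measure set (measurableTypeR R) -> \bar R} :=
  mscale (NngNum (ltW a0)) (image_measure leb mphi).
have nuE A : measurable A -> leb A = nu A.
  apply: lebesgue_measure_unique => _ [[c d]] _ <-.
  rewrite /nu /= /mscale /= /pushforward /=.
  have -> : phi @^-1` `]c, d] = `](c - b) / a, (d - b) / a]%classic.
    apply/seteqP; split => x /=; rewrite !in_itv/= /phi ltr_pdivrMr// ler_pdivlMr//;
      rewrite (mulrC x a); lra.
  rewrite !lebesgue_measure_itv/= !lte_fin ltr_pM2r ?invr_gt0// ltrD2r.
  case: ifP => cd; last by rewrite mule0.
  by rewrite -!EFinD -EFinM; congr (_ %:E); field; rewrite gt_eqF.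
have -> : (\int[leb]_x f x = \int[nu]_x f x)%E.
  by apply: eq_measure_integral => A mA _; exact: nuE.
rewrite /nu ge0_integral_mscale//= ge0_integral_pushforward//=; last first.
by rewrite muleA -EFinM mulVf ?gt_eqF// mul1e.
Qed.

Lemma integral_oppr (f : R -> \bar R) :
  measurable_fun setT f -> (forall x, 0 <= f x)%E ->
  (\int[leb]_x f (- x)%R = \int[leb]_x f x)%E.
Proof.
move=> mf f0.
have mN : measurable_fun setT (-%R : _ -> measurableTypeR R) by exact: oppr_measurable.
have -> : (\int[leb]_x f x = \int[image_measure leb mN]_x f x)%E.
  by apply: eq_measure_integral => A mA _; exact/esym/lebesgue_measureN.
by rewrite ge0_integral_pushforward.
Qed.

(** For p < 1 the integrand is singular at 0. The fundamental theorem is therefore applied on closed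
    intervals away from 0, which increase to the whole interval, and monotone convergence does the
    rest. *)
Lemma integral_powR (p : R) : 0 < p ->
  (\int[leb]_(x in `]0%R, 1%R]) (x `^ (p - 1))%:E = (p^-1)%:E)%E.
Proof.
move=> p0.
(* k.+2 keeps the left end strictly below 1, so that no interval degenerates to a point. *)
pose F (k : nat) : set R := `[(k.+2%:R)^-1, 1]%classic.
have k0 (k : nat) : (0 : R) < (k.+2%:R)^-1 by rewrite invr_gt0.
have k1 (k : nat) : (k.+2%:R)^-1 < (1 : R) by rewrite invf_lt1// ltr1n.
have FE : \bigcup_k F k = `]0%R, 1%R]%classic.
  apply/seteqP; split => x.
    case=> k _; rewrite /F /= !in_itv/= => /andP[kx ->]; rewrite andbT.
    by rewrite (lt_le_trans _ kx).
  rewrite /= in_itv/= => /andP[x0 x1]; exists (Num.trunc x^-1) => //.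
  rewrite /F /= in_itv/= x1 andbT invf_ple ?posrE//.
  by rewrite ltW// (lt_trans (truncnS_gt _))// ltr_nat.
pose G (x : R) := p^-1 * x `^ p.
have int_F k : (\int[leb]_(x in F k) (x `^ (p - 1))%:E =
    (p^-1 - p^-1 * (k.+2%:R)^-1 `^ p)%:E)%E.
  have cpow (q x : R) : 0 < x -> {for x, continuous (fun x : R => x `^ q)}.
    move=> x0; apply/differentiable_continuous/derivable1_diffP.
    by apply: derivable_powR; rewrite in_itv/= x0.
  have cG (x : R) : 0 < x -> {for x, continuous G}.
    by move=> x0; apply: continuousM; [exact: cvg_cst|exact: cpow].
  have dG x : 0 < x -> derivable G x 1.
    move=> x0; apply: derivableM; first exact: derivable_cst.
    by apply: derivable_powR; rewrite in_itv/= x0.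
  rewrite (@continuous_FTC2 _ _ G)//.
  - by rewrite /G powR1 mulr1.
  - apply: continuous_in_subspaceT => x; rewrite inE/= in_itv/= => /andP[kx _].
    by apply: cpow; rewrite (lt_le_trans (k0 k)).
  - split.
    + by move=> x; rewrite in_itv/= => /andP[kx _]; apply: dG; rewrite (lt_trans (k0 k)).
    + by apply: cvg_at_right_filter; apply: cG.
    + by apply: cvg_at_left_filter; apply: cG.
  - move=> x; rewrite in_itv/= => /andP[kx _].
    have x0 : 0 < x by rewrite (lt_trans (k0 k)).
    rewrite derive1Ml; last by apply: derivable_powR; rewrite in_itv/= x0.
    by rewrite powR_derive1 ?in_itv/= ?x0// mulrA mulVf ?gt_eqF// mul1r.
have := @ge0_nondecreasing_set_cvg_integral _ (measurableTypeR R) R F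
  (fun x => (x `^ (p - 1))%:E) leb.
rewrite FE => /(_ _ _ _ _) cv.
have {}cv : (\int[leb]_(x in F k) (x `^ (p - 1))%:E @[k --> \oo] -->
    \int[leb]_(x in `]0%R, 1%R]) (x `^ (p - 1))%:E)%E.
  apply: cv.
  - apply/nondecreasing_seqP => k; rewrite subsetEset => x; rewrite /F/= !in_itv/=.
    move=> /andP[kx ->]; rewrite andbT (le_trans _ kx)// lef_pV2 ?posrE//.
    by rewrite ler_nat.
  - by move=> k; exact: measurable_itv.
  - move=> k; apply/measurable_EFinP; apply: measurable_funTS.
    exact: measurable_powR.
  - by move=> k x _; rewrite lee_fin powR_ge0.
apply/esym; apply: cvg_unique cv => //.
rewrite (_ : (fun k => _) = (fun k : nat => (p^-1 - p^-1 * (k.+2%:R)^-1 `^ p)%:E)); last first.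
  by apply/funext => k; exact: int_F.
apply: cvg_EFin; first by near=> n.
rewrite /comp /= -[X in _ --> X]subr0 -(mulr0 p^-1).
apply: cvgB; first exact: cvg_cst.
apply: cvgMr.
have : a `^ p @[a --> 0^'+] --> (0 : R) by exact: powR_cvg0.
move=> /cvg_at_rightP; apply; split => //.
have := @cvg_harmonic R; rewrite -(cvg_shiftn 1); 
apply: cvg_trans.
have -> : [sequence (harmonic (n + 1)%N : R)]_n = (fun n : nat => (n.+2%:R)^-1).
  by apply/funext => n; rewrite /= /harmonic addn1.
by [].
Unshelve. all: by end_near. Qed.

(** The Beta integral B(1/2, s + 1). It is never evaluated; what is established is that it is finite
    and positive for s >= -1/2. *)
Definition beta_const (s : R) : R :=
  fine (\int[leb]_u (pos_powR s (1 - u ^+ 2))%:E)%E.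

Lemma measurable_pos_powR_comp s (f : R -> R) : measurable_fun setT f ->
  measurable_fun setT (fun x => (pos_powR s (f x))%:E).
Proof.
by move=> mf; apply/measurable_EFinP; apply: measurableT_comp => //; exact: measurable_pos_powR.
Qed.

Lemma measurable_1Bsqr : measurable_fun setT (fun u : R => 1 - u ^+ 2).
Proof. by apply: measurable_funB => //; exact: measurable_funX. Qed.

(** On the support 1 - |u| <= 1 - u^2 <= 1, so the integrand is at most (1 - |u|)^(-1/2), which is
    dominated by two mirrored translates of x^(-1/2) on (0, 1], each of integral 2. *)
Lemma integral_beta_lty s : - 2^-1 <= s ->
  (\int[leb]_u (pos_powR s (1 - u ^+ 2))%:E < +oo)%E.
Proof.
move=> s2.
pose h (x : R) : \bar R := ((\1_(`]0, 1]%classic) x * x `^ (- 2^-1))%:E).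
have mh : measurable_fun setT h.
  apply/measurable_EFinP; apply: measurable_funM; first exact: measurable_indic.
  exact: measurable_powR.
have h0 x : (0 <= h x)%E by rewrite lee_fin mulr_ge0// powR_ge0.
have ih : (\int[leb]_x h x = 2%:E)%E.
  rewrite -[in RHS](invrK 2) -(@integral_powR 2^-1)// [in RHS]integral_mkcond/=.
  apply: eq_integral => x _; rewrite /h patchE/= indicE.
  case: ifPn => _; rewrite ?mul0r// mul1r; congr ((_ `^ _)%:E); lra.
have ihD : (\int[leb]_x h (1 + x)%R = 2%:E)%E.
  have := @integral_affine 1 1 h ltr01 mh h0; rewrite invr1 mul1e ih => <-.
  by apply: eq_integral => x _; rewrite mul1r addrC.
have mhD : measurable_fun setT (fun x : R => h (1 + x)).
  by apply: measurableT_comp => //; exact: measurable_funD.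
have ihB : (\int[leb]_x h (1 - x)%R = 2%:E)%E.
  by rewrite -ihD -[RHS]integral_oppr.
have mhB : measurable_fun setT (fun x : R => h (1 - x)).
  by apply: measurableT_comp => //; exact: measurable_funB.
apply: (@le_lt_trans _ _ (\int[leb]_x (h (1 + x)%R + h (1 - x)%R))%E); last first.
  by rewrite ge0_integralD// ihD ihB -EFinD ltry.
apply: ge0_le_integral => //.
- by move=> x _; rewrite lee_fin pos_powR_ge0.
- by apply: measurable_pos_powR_comp; exact: measurable_1Bsqr.
- exact: emeasurable_funD.
move=> u _; have [u1|u1] := leP (1 - u ^+ 2) 0.
  by rewrite pos_powR_le0// adde_ge0.
rewrite pos_powR_gt0//.
have le1 (x : R) : 0 < x -> x <= 1 - u ^+ 2 -> ((1 - u ^+ 2) `^ s <= x `^ (- 2^-1)).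
  move=> x0 xu; apply: (@le_trans _ _ ((1 - u ^+ 2) `^ (- 2^-1))).
    apply: ger_powR => //; nra.
  rewrite !powRN lef_pV2 ?posrE ?powR_gt0// ge0_ler_powR// nnegrE; lra.
have [u0|u0] := leP 0 u.
  have ? : u < 1 by nra.
  apply: (@le_trans _ _ (h (1 - u))); last by rewrite leeDr.
  rewrite /h lee_fin indicE mem_set ?mul1r; first by apply: le1; nra.
  by rewrite /= in_itv/=; lra.
have ? : -1 < u by nra.
apply: (@le_trans _ _ (h (1 + u))); last by rewrite leeDl.
rewrite /h lee_fin indicE mem_set ?mul1r; first by apply: le1; nra.
by rewrite /= in_itv/=; lra.
Qed.

Lemma beta_constE s : - 2^-1 <= s ->
  (\int[leb]_u (pos_powR s (1 - u ^+ 2))%:E = (beta_const s)%:E)%E.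
Proof.
move=> s2; rewrite /beta_const fineK// ge0_fin_numE ?integral_beta_lty//.
by apply: integral_ge0 => u _; rewrite lee_fin pos_powR_ge0.
Qed.

Lemma beta_const_gt0 s : - 2^-1 <= s -> 0 < beta_const s.
Proof.
move=> s2; rewrite -lte_fin -beta_constE//.
(* On [-1/2, 1/2] one has 3/4 <= 1 - u^2 <= 1, so m bounds the integrand from below whatever the
   sign of s. *)
pose m : R := Num.min 1 ((3 / 4) `^ s).
have m0 : 0 < m by rewrite /m lt_min ltr01/= powR_gt0//; lra.
apply: (@lt_le_trans _ _ (\int[leb]_(u in `[(- 2^-1)%R, 2^-1%R]) m%:E)%E).
  rewrite integral_cst//= lebesgue_measure_itv/= lte_fin ifT; last by lra.
  by rewrite -EFinD -EFinM lte_fin; lra.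
apply: (@le_trans _ _ (\int[leb]_(u in `[(- 2^-1)%R, 2^-1%R]) (pos_powR s (1 - u ^+ 2))%:E)%E).
  apply: ge0_le_integral => //.
  - by move=> x _; rewrite lee_fin ltW.
  - by apply: measurable_funTS; apply: measurable_pos_powR_comp; exact: measurable_1Bsqr.
  move=> u; rewrite /= in_itv/= => /andP[u1 u2].
  have u4 : u ^+ 2 <= 1 / 4 by nra.
  rewrite lee_fin pos_powR_gt0; last lra.
  have [s0|s0] := leP 0 s.
    rewrite (@le_trans _ _ ((3 / 4) `^ s))// ?ge_min ?lexx ?orbT//.
    by rewrite ge0_ler_powR// ?nnegrE; lra.
  rewrite (@le_trans _ _ 1)// ?ge_min ?lexx//.
  rewrite -[s]opprK powRN -[leLHS]invr1 lef_pV2 ?posrE ?powR_gt0//; try lra.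
  rewrite -[leRHS](powRr0 (1 - u ^+ 2)); apply: ger_powR; nra.
apply: ge0_subset_integral => //.
- by apply: measurable_pos_powR_comp; exact: measurable_1Bsqr.
- by move=> x _; rewrite lee_fin pos_powR_ge0.
Qed.

(** The substitution u = sqrt(l / T) (y - b) extracts T^s, and its Jacobian contributes sqrt(T / l):
    this is where the exponent grows by one half. For T <= 0 both sides vanish. *)
Lemma integral_pos_powR_quad (s l b T : R) : - 2^-1 <= s -> 0 < l ->
  (\int[leb]_y (pos_powR s (T - l * (y - b) ^+ 2))%:E =
   (beta_const s / Num.sqrt l * pos_powR (s + 2^-1) T)%:E)%E.
Proof.
move=> s2 l0; have [T0|T0] := leP T 0.
  rewrite [in RHS]pos_powR_le0// mulr0 integral0_eq// => y _.
  by rewrite pos_powR_le0//; have := mulr_ge0 (ltW l0) (sqr_ge0 (y - b)); lra.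
pose a := Num.sqrt (l / T).
have a0 : 0 < a by rewrite sqrtr_gt0 divr_gt0.
have a2 : a ^+ 2 = l / T by rewrite sqr_sqrtr// ltW// divr_gt0.
pose f (u : R) := (pos_powR s (1 - u ^+ 2))%:E.
have mf : measurable_fun setT f.
  by apply: measurable_pos_powR_comp; exact: measurable_1Bsqr.
have f0 u : (0 <= f u)%E by rewrite lee_fin pos_powR_ge0.
have mfa : measurable_fun setT (fun y : R => f (a * y + - (a * b))).
  have mg : measurable_fun setT (fun y : R => a * y + - (a * b)).
    by apply: measurable_funD => //; exact: measurable_funM.
  exact: (measurableT_comp mf mg).
transitivity (\int[leb]_y ((T `^ s)%:E * f (a * y + - (a * b))%R))%E.
  apply: eq_integral => y _; rewrite /f -EFinM -pos_powRM//; congr (pos_powR _ _)%:E.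
  have -> : a * y + - (a * b) = a * (y - b) by ring.
  by rewrite exprMn a2; field; rewrite gt_eqF.
rewrite ge0_integralZl_EFin// ?powR_ge0// integral_affine// beta_constE//.
rewrite -!EFinM; congr (_%:E).
have -> : pos_powR (s + 2^-1) T = T `^ s * Num.sqrt T.
  by rewrite pos_powR_gt0// -powR12_sqrt ?ltW// powRD// (gt_eqF T0) implybT.
rewrite /a sqrtrM ?ltW// sqrtrV ?ltW// invfM invrK.
by ring.
Qed.

End line_integrals.

(** * Iterated integrals of powers of quadratic forms and Gram determinants *)

Section iterated_integrals.
Context {R : realType}.
Local Notation leb := (@lebesgue_measure R).

(** [integral_rV] transported to integrands on sequences, where coordinates are reached by plain
    numbers and blocks of variables by concatenation, without matrices of dependent size. *)
Fixpoint iter_integral (d : nat) (F : seq R -> \bar R) : \bar R :=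
  if d is d'.+1
  then (\int[leb]_t iter_integral d' (fun l => F (t :: l)))%E
  else F [::].

Definition seq_of_row d (x : 'rV[R]_d) : seq R := [seq x 0 j | j <- enum 'I_d].

Lemma size_seq_of_row d (x : 'rV[R]_d) : size (seq_of_row x) = d.
Proof. by rewrite size_map size_enum_ord. Qed.

Lemma nth_seq_of_row d (x : 'rV[R]_d) (j : 'I_d) : (seq_of_row x)`_j = x 0 j.
Proof. by rewrite (nth_map j) ?size_enum_ord// nth_ord_enum. Qed.

Lemma seq_of_row_cons d (t : R) (v : 'rV[R]_d) :
  seq_of_row (row_mx (t%:M : 'M[R]_1) v : 'rV[R]_d.+1) = t :: seq_of_row v.
Proof.
rewrite /seq_of_row enum_ordSl/= -map_comp; congr (_ :: _).
  transitivity (row_mx (t%:M : 'M[R]_1) v 0 (lshift d 0)).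
    by congr (row_mx _ _ _ _); apply: val_inj.
  by rewrite row_mxEl mxE mulr1n.
apply: eq_map => j /=; rewrite -(row_mxEr (t%:M : 'M[R]_1) v 0 j).
by congr (row_mx _ _ _ _); apply: val_inj.
Qed.

Lemma integral_rV_seq d (F : seq R -> \bar R) :
  integral_rV (fun x : 'rV[R]_d => F (seq_of_row x)) = iter_integral d F.
Proof.
elim: d F => [|d IH] F /=.
  by rewrite (size0nil (size_seq_of_row 0)).
apply: eq_integral => t _; rewrite -IH; congr integral_rV.
by apply/funext => v; rewrite seq_of_row_cons.
Qed.

Lemma eq_iter_integral d (F G : seq R -> \bar R) :
  (forall l, size l = d -> F l = G l) -> iter_integral d F = iter_integral d G.
Proof.
elim: d F G => [|d IH] F G FG /=; first exact: FG.
by apply: eq_integral => t _; apply: IH => l ls; apply: FG; rewrite /= ls.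
Qed.

Lemma iter_integral_cat m n (F : seq R -> \bar R) :
  iter_integral (m + n) F =
  iter_integral m (fun l => iter_integral n (fun l' => F (l ++ l'))).
Proof.
by elim: m F => [//|m IH] F /=; apply: eq_integral => t _; rewrite IH.
Qed.

Lemma iter_integral0 d : iter_integral d (fun=> 0%E) = 0%E.
Proof. by elim: d => [//|d IH] /=; rewrite IH integral0. Qed.

Lemma integral_cpos_powR_quad (s l b T c : R) : - 2^-1 <= s -> 0 < l -> 0 <= c ->
  (\int[leb]_y (c * pos_powR s (T - l * (y - b) ^+ 2))%:E =
   (c * (beta_const s / Num.sqrt l * pos_powR (s + 2^-1) T))%:E)%E.
Proof.
move=> s2 l0 c0; under eq_integral do rewrite EFinM.
rewrite ge0_integralZl_EFin//.
- by rewrite integral_pos_powR_quad// -EFinM.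
- by move=> y _; rewrite lee_fin pos_powR_ge0.
- apply: measurable_pos_powR_comp; apply: measurable_funB => //.
  apply: measurable_funM => //; apply: measurable_funX.
  exact: measurable_funB.
Qed.

(** Each variable raises the exponent by 1/2. The free factor [c] lets the induction hypothesis be
    rewritten under the outer integral, so the inner integral is always in closed form and its
    measurability is never in question. *)
Lemma iter_integral_ball (m : nat) (s : R) : - 2^-1 <= s ->
  exists2 C : R, 0 < C & forall T c, 0 <= c ->
    iter_integral m (fun l => (c * pos_powR s (T - \sum_(y <- l) y ^+ 2))%:E) =
    (c * (C * pos_powR (s + m%:R / 2) T))%:E.
Proof.
move=> s2; elim: m => [|m [C C0 IH]].
  by exists 1 => // T c c0 /=; rewrite big_nil subr0 mul0r addr0 mul1r.
have sm2 : - 2^-1 <= s + m%:R / 2 by rewrite (le_trans s2)// lerDl divr_ge0.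
exists (C * beta_const (s + m%:R / 2)).
  by rewrite mulr_gt0// beta_const_gt0.
move=> T c c0 /=.
transitivity (\int[leb]_t (c * C * pos_powR (s + m%:R / 2) (T - 1 * (t - 0) ^+ 2))%:E)%E.
  apply: eq_integral => t _; rewrite subr0 mul1r -mulrA -IH//.
  by apply: eq_iter_integral => l _; rewrite big_cons opprD addrA.
rewrite integral_cpos_powR_quad ?(mulr_ge0 c0 (ltW C0))// sqrtr1 divr1.
have -> : s + m%:R / 2 + 2^-1 = s + m.+1%:R / 2 by rewrite -natr1; lra.
by rewrite !mulrA.
Qed.

(** A power of the determinant of the symmetric matrix with diagonal al, be and off-diagonal entry
    ga, cut off to the positive definite matrices (Sylvester's criterion). *)
Definition pos_det2 (s al be ga : R) : R :=
  if 0 < al then pos_powR s (al * be - ga ^+ 2) else 0.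

(* Completing the square: for a rank-one update,
   det (A - v v^T) = D (1 - x^2 / al) - al (y - ga x / al)^2 with D = det A. *)
Lemma integral_pos_det2 (s al be ga c : R) : - 2^-1 <= s -> 0 <= c ->
  (\int[leb]_x \int[leb]_y
     (c * pos_det2 s (al - x ^+ 2) (be - y ^+ 2) (ga - x * y))%:E =
   (c * (beta_const s * beta_const (s + 2^-1) * pos_det2 (s + 2^-1) al be ga))%:E)%E.
Proof.
move=> s2 c0.
have s2' : - 2^-1 <= s + 2^-1 by lra.
have [al0|al0] := leP al 0.
  rewrite {2}/pos_det2 ltNge al0/= !mulr0 integral0_eq// => x _.
  apply: integral0_eq => y _; rewrite /pos_det2 ifF ?mulr0//.
  by apply/negbTE; rewrite -leNgt; have := sqr_ge0 x; lra.
set D := al * be - ga ^+ 2.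
have inner x : (\int[leb]_y
     (c * pos_det2 s (al - x ^+ 2) (be - y ^+ 2) (ga - x * y))%:E =
   (c * (beta_const s / Num.sqrt al) *
     (if 0 < D then pos_powR (s + 2^-1) (D - D / al * (x - 0) ^+ 2) else 0))%:E)%E.
  have DE : D - D / al * (x - 0) ^+ 2 = D * ((al - x ^+ 2) / al).
    by field; rewrite gt_eqF.
  have [xal|xal] := leP al (x ^+ 2).
    rewrite integral0_eq; last first.
      move=> y _; rewrite /pos_det2 ifF ?mulr0//.
      by apply/negbTE; rewrite -leNgt subr_le0.
    case: ifP => D0; last by rewrite mulr0.
    rewrite pos_powR_le0 ?mulr0// DE pmulr_rle0// pmulr_lle0 ?invr_gt0//.
    by rewrite subr_le0.
  transitivity (\int[leb]_y (c * pos_powR s (D * ((al - x ^+ 2) / al) -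
      al * (y - ga * x / al) ^+ 2))%:E)%E.
    apply: eq_integral => y _; rewrite /pos_det2 subr_gt0 xal.
    congr ((_ * pos_powR _ _)%:E); rewrite /D; field.
    by rewrite gt_eqF.
  rewrite integral_cpos_powR_quad// -DE mulrA; congr ((_ * _)%:E).
  case: ifP => D0//; rewrite pos_powR_le0// DE pmulr_lle0 ?divr_gt0 ?subr_gt0//.
  by rewrite leNgt D0.
under eq_integral do rewrite inner.
rewrite /pos_det2 al0 -/D; have [D0|D0] := ltP 0 D; last first.
  rewrite [in RHS]pos_powR_le0// !mulr0 integral0_eq//.
rewrite integral_cpos_powR_quad ?divr_gt0//; last first.
  by rewrite mulr_ge0// divr_ge0 ?sqrtr_ge0// ltW// beta_const_gt0.
congr (_%:E); rewrite sqrtrM ?ltW// sqrtrV ?ltW//.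
(* The two integrations raise the exponent by 1, but their Jacobians 1 / sqrt(al) and 1 / sqrt(D /
   al) multiply to 1 / sqrt(D): the net gain is only 1/2. *)
have -> : pos_powR (s + 2^-1 + 2^-1) D = Num.sqrt D * pos_powR (s + 2^-1) D.
  rewrite !pos_powR_gt0// powRD ?powR12_sqrt ?ltW//; last by rewrite (gt_eqF D0) implybT.
  by rewrite mulrC.
have ? : Num.sqrt D != 0 by rewrite gt_eqF// sqrtr_gt0.
have ? : Num.sqrt al != 0 by rewrite gt_eqF// sqrtr_gt0.
by field; apply/andP.
Qed.

(** The entries at 2 m and 2 m + 1 form one row (x, y), whose outer product is subtracted from the
    Gram matrix. The rank-one computation of [integral_pos_det2] is repeated row by row, each row
    adding 1/2 to the exponent. *)
Lemma iter_integral_det2 (k : nat) (s : R) : - 2^-1 <= s ->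
  exists2 C : R, 0 < C & forall al be ga c, 0 <= c ->
    iter_integral (2 * k) (fun l => (c * pos_det2 s
      (al - \sum_(m < k) l`_(2 * m) ^+ 2)
      (be - \sum_(m < k) l`_(2 * m + 1) ^+ 2)
      (ga - \sum_(m < k) l`_(2 * m) * l`_(2 * m + 1)))%:E) =
    (c * (C * pos_det2 (s + k%:R / 2) al be ga))%:E.
Proof.
move=> s2; elim: k => [|k [C C0 IH]].
  by exists 1 => // al be ga c c0 /=; rewrite !big_ord0 !subr0 mul0r addr0 mul1r.
have sm2 : - 2^-1 <= s + k%:R / 2 by rewrite (le_trans s2)// lerDl divr_ge0.
have sm2' : - 2^-1 <= s + k%:R / 2 + 2^-1 by lra.
exists (C * (beta_const (s + k%:R / 2) * beta_const (s + k%:R / 2 + 2^-1))).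
  by rewrite !mulr_gt0// beta_const_gt0.
move=> al be ga c c0; rewrite mulnS.
transitivity (\int[leb]_x \int[leb]_y (c * C * pos_det2 (s + k%:R / 2)
    (al - x ^+ 2) (be - y ^+ 2) (ga - x * y))%:E)%E.
  rewrite [LHS]/=; apply: eq_integral => x _; apply: eq_integral => y _.
  rewrite -[c * C * _]mulrA -IH//; apply: eq_iter_integral => l _.
  have e (m : 'I_k) : (2 * lift ord0 m = (2 * m).+2)%N by rewrite /= /bump leq0n add1n mulnS.
  by congr ((_ * pos_det2 _ _ _ _)%:E); rewrite big_ord_recl opprD addrA; congr (_ - _);
    apply: eq_bigr => m _; rewrite e ?addSn.
rewrite integral_pos_det2 ?(mulr_ge0 c0 (ltW C0))//.
have -> : s + k%:R / 2 + 2^-1 = s + k.+1%:R / 2 by rewrite -natr1; lra.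
by rewrite !mulrA.
Qed.

(** The Hermitian analogue of [pos_det2], with off-diagonal entry ga1 + i ga2. *)
Definition pos_det2C (s al be ga1 ga2 : R) : R :=
  if 0 < al then pos_powR s (al * be - ga1 ^+ 2 - ga2 ^+ 2) else 0.

(** A complex row (x, y) subtracts x conj(y) from the off-diagonal entry. The squares are completed
    in y1 and y2, then in x1 and x2: the exponent gains 4 halves, and the Jacobians multiply to 1 /
    D, leaving a net gain of 1. *)
Lemma integral_pos_det2C (s al be ga1 ga2 c : R) : - 2^-1 <= s -> 0 <= c ->
  (\int[leb]_x1 \int[leb]_x2 \int[leb]_y1 \int[leb]_y2
     (c * pos_det2C s (al - x1 ^+ 2 - x2 ^+ 2) (be - y1 ^+ 2 - y2 ^+ 2)
       (ga1 - (x1 * y1 + x2 * y2)) (ga2 - (x2 * y1 - x1 * y2)))%:E =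
   (c * (beta_const s * beta_const (s + 2^-1) * beta_const (s + 1) *
      beta_const (s + 1 + 2^-1) * pos_det2C (s + 1) al be ga1 ga2))%:E)%E.
Proof.
move=> s2 c0.
have s2' : - 2^-1 <= s + 2^-1 by lra.
have s3 : - 2^-1 <= s + 1 by lra.
have s3' : - 2^-1 <= s + 1 + 2^-1 by lra.
have [al0|al0] := leP al 0.
  rewrite {2}/pos_det2C ltNge al0/= !mulr0 integral0_eq// => x1 _.
  apply: integral0_eq => x2 _; apply: integral0_eq => y1 _; apply: integral0_eq => y2 _.
  rewrite /pos_det2C ifF ?mulr0//; apply/negbTE; rewrite -leNgt.
  by have := sqr_ge0 x1; have := sqr_ge0 x2; lra.
set D := al * be - ga1 ^+ 2 - ga2 ^+ 2.
pose c1 := c * (beta_const s / Num.sqrt al).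
pose c2 := c1 * (beta_const (s + 2^-1) / Num.sqrt al).
have c1_ge0 : 0 <= c1.
  by rewrite /c1 mulr_ge0// divr_ge0 ?sqrtr_ge0// ltW// beta_const_gt0.
have c2_ge0 : 0 <= c2.
  by rewrite /c2 mulr_ge0// divr_ge0 ?sqrtr_ge0// ltW// beta_const_gt0.
have half2 (t : R) : t + 2^-1 + 2^-1 = t + 1 by lra.
have inner x1 x2 : (\int[leb]_y1 \int[leb]_y2
     (c * pos_det2C s (al - x1 ^+ 2 - x2 ^+ 2) (be - y1 ^+ 2 - y2 ^+ 2)
       (ga1 - (x1 * y1 + x2 * y2)) (ga2 - (x2 * y1 - x1 * y2)))%:E =
   (c2 * (if 0 < D then pos_powR (s + 1)
      (D - D / al * (x1 - 0) ^+ 2 - D / al * (x2 - 0) ^+ 2) else 0))%:E)%E.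
  have DE : D - D / al * (x1 - 0) ^+ 2 - D / al * (x2 - 0) ^+ 2 =
      D * ((al - x1 ^+ 2 - x2 ^+ 2) / al).
    by field; rewrite gt_eqF.
  have [xal|xal] := leP (al - x1 ^+ 2 - x2 ^+ 2) 0.
    rewrite integral0_eq; last first.
      move=> y1 _; apply: integral0_eq => y2 _.
      by rewrite /pos_det2C ifF ?mulr0//; apply/negbTE; rewrite -leNgt.
    case: ifP => D0; last by rewrite mulr0.
    by rewrite pos_powR_le0 ?mulr0// DE pmulr_rle0// pmulr_lle0 ?invr_gt0.
  set T := D * ((al - x1 ^+ 2 - x2 ^+ 2) / al) in DE *.
  (* b1 + i b2 = conj(ga) x / al, the centre of the completed square in y. *)
  pose b1 := (ga1 * x1 + ga2 * x2) / al.
  pose b2 := (ga1 * x2 - ga2 * x1) / al.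
  transitivity (\int[leb]_y1 (c1 * pos_powR (s + 2^-1) (T - al * (y1 - b1) ^+ 2))%:E)%E.
    apply: eq_integral => y1 _.
    transitivity (\int[leb]_y2
        (c * pos_powR s (T - al * (y1 - b1) ^+ 2 - al * (y2 - b2) ^+ 2))%:E)%E.
      apply: eq_integral => y2 _; rewrite /pos_det2C xal.
      congr ((_ * pos_powR _ _)%:E); rewrite /T /D /b1 /b2; field.
      by rewrite gt_eqF.
    by rewrite integral_cpos_powR_quad// mulrA.
  rewrite integral_cpos_powR_quad// half2 DE mulrA; congr ((_ * _)%:E).
  case: ifP => D0//; rewrite pos_powR_le0// /T pmulr_lle0 ?divr_gt0//.
  by rewrite leNgt D0.
under eq_integral => x1 _ do under eq_integral => x2 _ do rewrite inner.
rewrite /pos_det2C al0 -/D; have [D0|D0] := ltP 0 D; last first.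
  rewrite [in RHS]pos_powR_le0// !mulr0 integral0_eq// => x1 _.
  by apply: integral0_eq => x2 _.
have Dal0 : 0 < D / al by rewrite divr_gt0.
pose c3 := c2 * (beta_const (s + 1) / Num.sqrt (D / al)).
have c3_ge0 : 0 <= c3.
  by rewrite /c3 mulr_ge0// divr_ge0 ?sqrtr_ge0// ltW// beta_const_gt0.
transitivity (\int[leb]_x1
    (c3 * pos_powR (s + 1 + 2^-1) (D - D / al * (x1 - 0) ^+ 2))%:E)%E.
  by apply: eq_integral => x1 _; rewrite integral_cpos_powR_quad// mulrA.
rewrite integral_cpos_powR_quad// half2.
congr (_%:E); rewrite /c3 /c2 /c1.
have -> : pos_powR (s + 1 + 1) D = D * pos_powR (s + 1) D.
  rewrite !pos_powR_gt0// powRD ?powRr1 ?ltW//; last by rewrite (gt_eqF D0) implybT.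
  by rewrite mulrC.
have al2 : Num.sqrt al ^+ 2 = al by rewrite sqr_sqrtr// ltW.
have D2 : Num.sqrt (D / al) ^+ 2 = D / al by rewrite sqr_sqrtr// ltW.
have sD0 : Num.sqrt (D / al) != 0 by rewrite gt_eqF// sqrtr_gt0.
have sa0 : Num.sqrt al != 0 by rewrite gt_eqF// sqrtr_gt0.
have -> : D * pos_powR (s + 1) D =
    Num.sqrt al ^+ 2 * Num.sqrt (D / al) ^+ 2 * pos_powR (s + 1) D.
  by rewrite al2 D2; congr (_ * _); field; rewrite gt_eqF.
move: (Num.sqrt (D / al)) sD0 (Num.sqrt al) sa0 (beta_const s) (beta_const (s + 2^-1))
  (beta_const (s + 1)) (beta_const (s + 1 + 2^-1)) (pos_powR _ _).
by move=> x x0 y y0 b1 b2 b3 b4 p; field; apply/andP.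
Qed.

Lemma iter_integral_det2C (k : nat) (s : R) : - 2^-1 <= s ->
  exists2 C : R, 0 < C & forall al be ga1 ga2 c, 0 <= c ->
    iter_integral (4 * k) (fun l => (c * pos_det2C s
      (al - \sum_(m < k) (l`_(4 * m) ^+ 2 + l`_(4 * m + 1) ^+ 2))
      (be - \sum_(m < k) (l`_(4 * m + 2) ^+ 2 + l`_(4 * m + 3) ^+ 2))
      (ga1 - \sum_(m < k) (l`_(4 * m) * l`_(4 * m + 2) + l`_(4 * m + 1) * l`_(4 * m + 3)))
      (ga2 - \sum_(m < k) (l`_(4 * m + 1) * l`_(4 * m + 2) - l`_(4 * m) * l`_(4 * m + 3))))%:E) =
    (c * (C * pos_det2C (s + k%:R) al be ga1 ga2))%:E.
Proof.
move=> s2; elim: k => [|k [C C0 IH]].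
  by exists 1 => // al be ga1 ga2 c c0 /=; rewrite !big_ord0 !subr0 addr0 mul1r.
have sm2 : - 2^-1 <= s + k%:R by rewrite (le_trans s2)// lerDl.
exists (C * (beta_const (s + k%:R) * beta_const (s + k%:R + 2^-1) *
    beta_const (s + k%:R + 1) * beta_const (s + k%:R + 1 + 2^-1))).
  by rewrite !mulr_gt0// beta_const_gt0//; lra.
move=> al be ga1 ga2 c c0; rewrite mulnS.
transitivity (\int[leb]_x1 \int[leb]_x2 \int[leb]_y1 \int[leb]_y2
     (c * C * pos_det2C (s + k%:R) (al - x1 ^+ 2 - x2 ^+ 2) (be - y1 ^+ 2 - y2 ^+ 2)
       (ga1 - (x1 * y1 + x2 * y2)) (ga2 - (x2 * y1 - x1 * y2)))%:E)%E.
  rewrite [LHS]/=; do 4! apply: eq_integral => ? _.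
  rewrite -[c * C * _]mulrA -IH//; apply: eq_iter_integral => l _.
  have e (m : 'I_k) : (4 * lift ord0 m = (4 * m).+4)%N by rewrite /= /bump leq0n add1n mulnS.
  by congr ((_ * pos_det2C _ _ _ _ _)%:E); rewrite big_ord_recl !opprD !addrA; congr (_ + _);
    congr (- _); apply: eq_bigr => m _; rewrite e ?addSn.
rewrite integral_pos_det2C ?(mulr_ge0 c0 (ltW C0))//.
have -> : s + k%:R + 1 = s + k.+1%:R by rewrite -natr1; lra.
by rewrite !mulrA.
Qed.

End iterated_integrals.

(** * Laws of the squared norm in the plane and in four dimensions *)

Section radial_integrals.
Context {R : realType}.
Local Notation leb := (@lebesgue_measure R).
Local Notation T := (measurableTypeR R).
Local Notation ray0 := (`[0%R, +oo[%classic : set R).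

Lemma measurable_sqr_norm2 :
  measurable_fun setT (fun z : T * T => (z.1 ^+ 2 + z.2 ^+ 2 : T)).
Proof. by apply: measurable_funD; apply: measurable_funX. Qed.

(* The area of a disc is proportional to the square of its radius, so the image
   of plane Lebesgue measure under the squared norm is a multiple of Lebesgue
   measure on the half-line. *)
Lemma measure_sqr_norm2 : exists2 C : R, 0 < C &
  forall A, measurable A -> image_measure (leb \x leb)%E measurable_sqr_norm2 A =
    (C%:E * leb (A `&` ray0))%E.
Proof.
(* Exponent 0 turns the integrand of [iter_integral_ball] into the indicator of a disc, so CE is a
   formula for its area. *)
have h0 : - 2^-1 <= 0 :> R by lra.
have [C C0 CE] := @iter_integral_ball R 2 0 h0.
exists C => // A mA.
have mD : measurable (ray0 : set T) by exact: measurable_itv.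
pose nu : {measure set T -> \bar R} := mscale (NngNum (ltW C0)) (mrestr leb mD).
have sE s : image_measure (leb \x leb)%E measurable_sqr_norm2 (`]-oo, s[%classic : set R) =
    (C * pos_powR 1 s)%:E.
  rewrite /= /pushforward.
  have mI : measurable [set z : T * T | z.1 ^+ 2 + z.2 ^+ 2 < s].
    have := measurable_sqr_norm2 measurableT (measurable_itv `]-oo, s[).
    by rewrite setTI; congr measurable; apply/seteqP; split => z /=; rewrite in_itv.
  rewrite (_ : _ @^-1` _ = [set z : T * T | z.1 ^+ 2 + z.2 ^+ 2 < s]); last first.
    by apply/seteqP; split => z /=; rewrite in_itv.
  transitivity (\int[leb \x leb]_z
      (\1_[set z : T * T | (z.1 ^+ 2 + z.2 ^+ 2 < s)%R] z)%:E)%E.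
    by rewrite integral_indic// setIT.
  rewrite indic_fubini_tonelli1//.
  have := CE s 1 ler01; rewrite !mul1r add0r mulfV ?pnatr_eq0// => <- /=.
  apply: eq_integral => x _; apply: eq_integral => y _.
  rewrite !big_cons big_nil addr0 mul1r /= indicE /pos_powR powRr0 subr_gt0.
  case: ifP => xy; first by rewrite mem_set.
  by rewrite memNset//= xy.
have nuE s : nu (`]-oo, s[%classic : set R) = (C * pos_powR 1 s)%:E.
  rewrite /nu /= /mscale /= /mrestr EFinM; congr (_ * _)%E.
  have [s0|s0] := leP s 0.
    rewrite pos_powR_le0//.
    suff -> : `]-oo, s[%classic `&` ray0 = set0 by rewrite measure0.
    rewrite -subset0 => x [] /=; rewrite !in_itv/= andbT => xs x0; lra.
  rewrite pos_powR_gt0// powRr1 ?ltW//.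
  rewrite (_ : _ `&` _ = `[0, s[%classic); last first.
    apply/seteqP; split => x /=; rewrite !in_itv/= andbT; first by case=> -> ->.
    by move=> /andP[-> ->].
  by rewrite lebesgue_measure_itv/= lte_fin s0 sube0.
suff -> : image_measure (leb \x leb)%E measurable_sqr_norm2 A = nu A by [].
apply: (@measure_unique _ R T (@RGenInftyO.G R) (fun n : nat => `]-oo, n%:R[%classic)) => //.
- exact: RGenInftyO.measurableE.
- move=> _ _ [x ->] [y ->]; exists (Num.min x y).
  by apply/seteqP; split => z /=; rewrite !in_itv/= lt_min => /andP.
- by move=> n; exists n%:R.
- apply/seteqP; split => // x _; exists (Num.trunc x).+1 => //=.
  by rewrite in_itv/= truncnS_gt.
- by move=> _ [x ->]; rewrite sE nuE.
- by move=> n; rewrite sE ltry.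
Qed.

Lemma integral_sqr_norm2 : exists2 C : R, 0 < C &
  forall g : R -> \bar R, measurable_fun setT g -> (forall t, 0 <= g t)%E ->
    (\int[leb]_x \int[leb]_y g (x ^+ 2 + y ^+ 2)%R =
     C%:E * \int[leb]_(t in ray0) g t)%E.
Proof.
have [C C0 CE] := measure_sqr_norm2; exists C => // g mg g0.
have mD : measurable (ray0 : set T) by exact: measurable_itv.
transitivity (\int[leb \x leb]_z g (z.1 ^+ 2 + z.2 ^+ 2)%R)%E.
  rewrite fubini_tonelli1//.
  exact: (measurableT_comp mg measurable_sqr_norm2).
transitivity (\int[image_measure (leb \x leb) measurable_sqr_norm2]_(t in ray0) g t)%E.
  rewrite (ge0_integral_pushforward measurable_sqr_norm2)//; last exact: measurable_funTS.
  suff -> : (fun z : T * T => z.1 ^+ 2 + z.2 ^+ 2) @^-1` ray0 = setT by [].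
  apply/seteqP; split => // z _ /=.
  by rewrite in_itv/= andbT addr_ge0// sqr_ge0.
transitivity (\int[mscale (NngNum (ltW C0)) leb]_(t in ray0) g t)%E.
  apply: eq_measure_integral => A mA AD.
  rewrite [LHS]CE//; congr (_ * leb _)%E.
  exact: setIidl.
by rewrite ge0_integral_mscale//; exact: measurable_funTS.
Qed.

(** Split the four variables into two planes. By the planar case each squared norm carries a
    multiple of Lebesgue measure on the half-line, and the pairs of nonnegative numbers with sum t
    form a segment parametrized by [0, t], whence the weight t. *)
Lemma integral_sqr_norm4 : exists2 C : R, 0 < C &
  forall g : R -> R, measurable_fun setT g -> (forall t, 0 <= g t) ->
    (\int[leb]_x1 \int[leb]_x2 \int[leb]_y1 \int[leb]_y2
       (g (x1 ^+ 2 + x2 ^+ 2 + (y1 ^+ 2 + y2 ^+ 2))%R)%:E =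
     C%:E * \int[leb]_(t in ray0) (t * g t)%:E)%E.
Proof.
have [C C0 CE] := integral_sqr_norm2; exists (C * C); first by rewrite mulr_gt0.
move=> g mg g0.
have mD : measurable (ray0 : set T) by exact: measurable_itv.
have mshift t : measurable_fun setT (fun s : R => (g (t + s)%R)%:E).
  apply/measurable_EFinP; apply: (measurableT_comp mg).
  exact: measurable_funD.
(* z.1 is the first squared norm and z.2 the sum of both. In these coordinates the order of
   integration is exchanged by Tonelli. *)
pose F (z : T * T) : \bar R := (\1_ray0 z.1 * \1_ray0 (z.2 - z.1) * g z.2)%:E.
have mray (f : T * T -> T) : measurable_fun setT f ->
    measurable_fun setT (fun z => \1_ray0 (f z) : R).
  by move=> mf; apply: (measurableT_comp _ mf); exact: measurable_indic.
have mF : measurable_fun setT F.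
  apply/measurable_EFinP; apply: measurable_funM; last exact: measurableT_comp.
  apply: measurable_funM; first exact: mray.
  by apply: mray; exact: measurable_funB.
have F0 z : (0 <= F z)%E by rewrite lee_fin !mulr_ge0.
pose h t := (\int[leb]_(s in ray0) (g (t + s)%R)%:E)%E.
have hE t : (0 <= t)%R -> h t = fubini_F leb F t.
  move=> t0; rewrite /fubini_F /h [LHS]integral_mkcond/=.
  pose f (r : R) : \bar R := (\1_ray0 (r - t) * g r)%:E.
  have mf : measurable_fun setT f.
    apply/measurable_EFinP; apply: measurable_funM => //.
    have mi : measurable_fun setT (\1_ray0 : T -> R) by exact: measurable_indic.
    have mb : measurable_fun setT (fun r : T => r - t : T) by exact: measurable_funB.
    exact: (measurableT_comp mi mb).
  have f0 r : (0 <= f r)%E by rewrite lee_fin mulr_ge0.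
  have := @integral_affine R 1 t f ltr01 mf f0; rewrite invr1 mul1e => fE.
  transitivity (\int[leb]_r f r)%E.
    rewrite -fE; apply: eq_integral => s _; rewrite /f mul1r addrK patchE/= indicE.
    rewrite [in RHS](addrC s t).
    by case: ifPn => _; rewrite ?mul1r ?mul0r.
  apply: eq_integral => r _; rewrite /F /f/= [\1_ray0 t]indicE mem_set ?mul1r//=.
  by rewrite in_itv/= t0.
have hge0 t : (0 <= h t)%E by apply: integral_ge0 => s _; rewrite lee_fin.
have hN t : (t < 0)%R -> fubini_F leb F t = 0%E.
  move=> t0; apply: integral0_eq => r _; rewrite /F /= indicE memNset ?mul0r//=.
  by rewrite in_itv/= andbT leNgt t0.
have mh : measurable_fun setT (fubini_F leb F) by exact: measurable_fun_fubini_tonelli_F.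
transitivity (\int[leb]_x1 \int[leb]_x2 (C%:E * fubini_F leb F (x1 ^+ 2 + x2 ^+ 2)%R))%E.
  apply: eq_integral => x1 _; apply: eq_integral => x2 _.
  rewrite -hE ?addr_ge0 ?sqr_ge0// /h -(CE (fun s => (g (x1 ^+ 2 + x2 ^+ 2 + s)%R)%:E))//.
  by move=> s; rewrite lee_fin.
have Fge0 t : (0 <= fubini_F leb F t)%E by exact: integral_ge0.
rewrite (CE (fun t => C%:E * fubini_F leb F t)%E)//; last 2 first.
- exact: measurable_funeM.
- by move=> t; rewrite mule_ge0// lee_fin ltW.
rewrite ge0_integralZl_EFin// ?ltW//; last exact: measurable_funTS.
rewrite EFinM muleA; congr (_ * _)%E.
transitivity (\int[leb]_t fubini_F leb F t)%E.
  rewrite [LHS]integral_mkcond; apply: eq_integral => t _; rewrite patchE.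
  case: ifPn => //; rewrite notin_setE/= in_itv/= andbT => /negP; rewrite -ltNge => t0.
  by rewrite hN.
rewrite /fubini_F (@fubini_tonelli _ _ T T R leb leb F)// [RHS]integral_mkcond.
apply: eq_integral => r _; rewrite patchE.
case: ifPn; last first.
  rewrite notin_setE/= in_itv/= andbT => /negP; rewrite -ltNge => r0.
  apply: integral0_eq => t _; rewrite /F /= [\1_ray0 t]indicE.
  case: (boolP (t \in _)); last by rewrite !mul0r.
  rewrite inE/= in_itv/= andbT => t0; rewrite indicE memNset ?mulr0 ?mul0r//=.
  rewrite in_itv/= andbT; lra.
rewrite inE/= in_itv/= andbT => r0.
transitivity (\int[leb]_t ((g r)%:E * (\1_(`[0%R, r]%classic : set R) t)%:E))%E.
  apply: eq_integral => t _; rewrite /F/= -EFinM (mulrC (g r)); congr (_ * _)%:E.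
  rewrite !indicE -natrM mulnb; congr (_%:R); congr nat_of_bool.
  apply/andP/idP; rewrite !inE/= !in_itv/= !andbT subr_ge0.
    by move=> [-> ->].
  by move=> /andP.
rewrite ge0_integralZl_EFin//.
- by rewrite integral_indic// setIT/= lebesgue_measure_itv/= lte_fin;
    case: ltP => rr; rewrite ?sube0 -?EFinM ?(mulrC r)//;
    rewrite (@le_anti _ _ r 0) ?rr// mul0r mule0.
- by apply/measurable_EFinP; exact: measurable_indic.
Qed.
End radial_integrals.

(** * Volume density of a graph *)

Section C1_functions.
Context {R : realType} {d : nat}.
Local Notation V := 'rV[R]_d.
Implicit Types (U : set V) (f g : V -> R).

(** The smoothness clause of [local_param] for one scalar entry. The charts are built from
    coordinates by the operations under which it is shown to be stable. *)
Definition C1_on U f := forall x, U x ->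
  differentiable f x /\ forall v, {for x, continuous (fun y => 'D_v f y)}.

Lemma continuous_at_eq_on U (f g : V -> R) x : open U -> U x ->
  (forall y, U y -> f y = g y) -> {for x, continuous g} -> {for x, continuous f}.
Proof.
move=> oU Ux fg cg; rewrite /prop_for /continuous_at (fg x Ux).
apply: cvg_trans cg; apply: (@near_eq_cvg _ _ (nbhs x)).
by apply: filterS (open_nbhs_nbhs (conj oU Ux)) => y /fg.
Qed.

Lemma C1_cst U c : C1_on U (fun=> c).
Proof.
move=> x _; split=> [|v]; first exact: differentiable_cst.
rewrite (_ : (fun y => 'D_v (fun=> c) y) = cst 0); first exact: cst_continuous.
by apply/funext => y; exact: derive_cst.
Qed.

Lemma derive_coord (x v : V) j : 'D_v (fun x : V => x 0 j) x = v 0 j.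
Proof.
have dv : derivable (id : V -> V) x v by exact: derivable_id.
by have := derive_mx dv; rewrite derive_id => {2}->; rewrite mxE.
Qed.

Lemma C1_coord U j : C1_on U (fun x => x 0 j).
Proof.
move=> x _; split=> [|v]; first exact: differentiable_coord.
rewrite (_ : (fun y => 'D_v (fun x : V => x 0 j) y) = cst (v 0 j)); first exact: cst_continuous.
by apply/funext => y; rewrite derive_coord.
Qed.

Lemma C1_add U f g : open U -> C1_on U f -> C1_on U g -> C1_on U (fun x => f x + g x).
Proof.
move=> oU cf cg x Ux; have [df cdf] := cf x Ux; have [dg cdg] := cg x Ux.
split=> [|v]; first exact: differentiableD.
apply: (@continuous_at_eq_on U _ (fun y => 'D_v f y + 'D_v g y)) => //.
  move=> y Uy; have [dfy _] := cf y Uy; have [dgy _] := cg y Uy.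
  by rewrite -deriveD//; exact: diff_derivable.
exact: (continuousD (cdf v) (cdg v)).
Qed.

Lemma C1_mul U f g : open U -> C1_on U f -> C1_on U g -> C1_on U (fun x => f x * g x).
Proof.
move=> oU cf cg x Ux; have [df cdf] := cf x Ux; have [dg cdg] := cg x Ux.
split=> [|v]; first exact: differentiableM.
apply: (@continuous_at_eq_on U _ (fun y => f y * 'D_v g y + g y * 'D_v f y)) => //.
  move=> y Uy; have [dfy _] := cf y Uy; have [dgy _] := cg y Uy.
  by rewrite -[RHS]deriveM//; exact: diff_derivable.
apply: continuousD; apply: continuousM => //; exact: differentiable_continuous.
Qed.

Lemma C1_comp U (h h' : R -> R) f : open U ->
  (forall x, U x -> is_derive (f x) 1 h (h' (f x)) /\ {for f x, continuous h'}) ->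
  C1_on U f -> C1_on U (fun x => h (f x)).
Proof.
move=> oU dh cf x Ux; have [df cdf] := cf x Ux.
have dhd y : U y -> differentiable h (f y).
  by move=> Uy; apply/derivable1_diffP; have [[]] := dh y Uy.
split=> [|v]; first by apply: differentiable_comp => //; exact: dhd.
apply: (@continuous_at_eq_on U _ (fun y => h' (f y) * 'D_v f y)) => //.
  move=> y Uy; have [dfy _] := cf y Uy; have [dhy _] := dh y Uy.
  rewrite deriveE; last by apply: differentiable_comp => //; exact: dhd.
  rewrite (diff_comp dfy (dhd y Uy)) /= (diff1E (dhd y Uy)) (deriveE v dfy).
  by rewrite derive1E derive_val mulrC.
apply: continuousM => //; apply: continuous_comp; last by have [] := dh x Ux.
exact: differentiable_continuous.
Qed.

Lemma C1_opp U f : open U -> C1_on U f -> C1_on U (fun x => - f x).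
Proof.
move=> oU cf.
have := C1_mul oU (C1_cst (U := U) (-1)) cf.
by under eq_fun do rewrite mulN1r.
Qed.

Lemma C1_sub U f g : open U -> C1_on U f -> C1_on U g -> C1_on U (fun x => f x - g x).
Proof. by move=> oU cf cg; exact: (C1_add oU cf (C1_opp oU cg)). Qed.

Lemma C1_sqr U f : open U -> C1_on U f -> C1_on U (fun x => f x ^+ 2).
Proof. by move=> oU cf; have := C1_mul oU cf cf; under eq_fun do rewrite -expr2. Qed.

Lemma C1_sum U k (F : 'I_k -> V -> R) : open U ->
  (forall i, C1_on U (F i)) -> C1_on U (fun x => \sum_(i < k) F i x).
Proof.
move=> oU; elim: k F => [|k IH] F cF.
  by under eq_fun do rewrite big_ord0; exact: C1_cst.
under eq_fun do rewrite big_ord_recl.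
by apply: C1_add => //; apply: IH.
Qed.

Lemma C1_sqrt U f : open U -> (forall x, U x -> 0 < f x) -> C1_on U f ->
  C1_on U (fun x => Num.sqrt (f x)).
Proof.
move=> oU f0; apply: (@C1_comp _ _ (fun r => (2 * Num.sqrt r)^-1)) => // x Ux.
split; first by apply: is_derive1_sqrt; exact: f0.
apply: continuousV.
  by rewrite mulf_neq0// gt_eqF// sqrtr_gt0 f0.
by apply: continuousM; [exact: cvg_cst|exact: sqrt_continuous].
Qed.

Lemma C1_inv U f : open U -> (forall x, U x -> f x != 0) -> C1_on U f ->
  C1_on U (fun x => (f x)^-1).
Proof.
move=> oU f0; apply: (@C1_comp _ _ (fun r => - r ^- 2)) => // x Ux.
split.
  apply: is_derive_eq; first by apply: is_deriveV; exact: f0.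
  by rewrite /GRing.scale/= mulr1.
apply: continuousN; apply: continuousV; first by rewrite expf_neq0// f0.
exact: exprn_continuous.
Qed.

Lemma C1_continuous U f x : C1_on U f -> U x -> {for x, continuous f}.
Proof. by move=> cf Ux; apply: differentiable_continuous; have [] := cf x Ux. Qed.

End C1_functions.

Lemma cvg_sum_ord (R : realType) (V : normedModType R) (T : Type)
    (F : set_system T) k (f : 'I_k -> T -> V) (a : 'I_k -> V) : Filter F ->
  (forall i, f i x @[x --> F] --> a i) ->
  \sum_(i < k) f i x @[x --> F] --> \sum_(i < k) a i.
Proof.
move=> FF; elim: k f a => [|k IH] f a fa.
  by rewrite big_ord0; under eq_cvg do rewrite big_ord0; exact: cvg_cst.
rewrite big_ord_recl; under eq_cvg do rewrite big_ord_recl.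
by apply: cvgD => //; exact: IH.
Qed.

Section matrix_valued.
Context {R : realType} {V : normedModType R} {m n : nat}.
Implicit Types (phi : V -> 'M[R]_(m, n)).

Lemma differentiable_entries phi x :
  (forall i j, differentiable (fun y => phi y i j) x) -> differentiable phi x.
Proof.
move=> dphi.
have -> : phi = \sum_(i < m) \sum_(j < n) (fun x => phi x i j *: (delta_mx i j : 'M[R]_(m, n))).
  apply/funext => y; rewrite [LHS]matrix_sum_delta fct_sumE.
  by apply: eq_bigr => i _; rewrite fct_sumE.
by do 2 (apply: differentiable_sum => ?); exact: differentiableZl.
Qed.

Lemma derive_entry phi x v i j :
  (forall i j, differentiable (fun y => phi y i j) x) ->
  ('D_v phi x) i j = 'D_v (fun y => phi y i j) x.
Proof.
move=> dphi; rewrite derive_mx ?mxE//.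
by apply: diff_derivable; exact: differentiable_entries.
Qed.

End matrix_valued.

Lemma C1_entries (R : realType) (d m n : nat) (U : set 'rV[R]_d)
    (phi : 'rV[R]_d -> 'M[R]_(m, n)) :
  open U -> (forall i j, C1_on U (fun x => phi x i j)) ->
  forall x, U x -> differentiable phi x /\
    forall v, {for x, continuous (fun y => 'D_v phi y)}.
Proof.
move=> oU cphi x Ux; split=> [|v].
  by apply: differentiable_entries => i j; have [] := cphi i j x Ux.
pose psi y := \sum_(i < m) \sum_(j < n) 'D_v (fun y => phi y i j) y *: (delta_mx i j : 'M[R]_(m, n)).
have psiE y : U y -> 'D_v phi y = psi y.
  move=> Uy; rewrite [LHS]matrix_sum_delta; apply: eq_bigr => i _; apply: eq_bigr => j _.
  by rewrite derive_entry// => i' j'; have [] := cphi i' j' y Uy.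
rewrite /prop_for /continuous_at psiE//.
apply: (@cvg_trans _ (psi y @[y --> x])).
  apply: (@near_eq_cvg _ _ (nbhs x)).
  by apply: filterS (open_nbhs_nbhs (conj oU Ux)) => y /psiE.
rewrite /psi; apply: (@cvg_sum_ord R _ _ (nbhs x)) => i; apply: (@cvg_sum_ord R _ _ (nbhs x)) => j; apply: cvgZl.
by have [_] := cphi i j x Ux; apply.
Qed.

(** Sylvester's determinant identity: the same two block matrices are multiplied in both orders. *)
Lemma det_1D_mulmxC (R : comNzRingType) (d k : nat) (A : 'M[R]_(d, k)) (B : 'M[R]_(k, d)) :
  \det (1%:M + A *m B) = \det (1%:M + B *m A).
Proof.
have e1 : block_mx 1%:M A 0 1%:M *m block_mx 1%:M (- A) B 1%:M =
    block_mx (1%:M + A *m B) 0 B 1%:M.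
  by rewrite mulmx_block !mul1mx !mul0mx !mulmx1 !add0r addNr.
have e2 : block_mx 1%:M (- A) B 1%:M *m block_mx 1%:M A 0 1%:M =
    block_mx 1%:M 0 B (1%:M + B *m A).
  by rewrite mulmx_block !mul1mx !mulmx0 !mulmx1 !addr0 subrr addrC.
have := congr1 determinant e1; have := congr1 determinant e2.
by rewrite !det_mulmx !det_ublock !det_lblock !det1 !mulr1 !mul1r => -> <-.
Qed.

Section derive_sums.
Context {R : realType} {V : normedModType R}.

Lemma sum_fctE k (f : 'I_k -> V -> R) :
  (fun x => \sum_(i < k) f i x) = \sum_(i < k) f i.
Proof. by apply/funext => x; rewrite fct_sumE. Qed.

Lemma differentiable_sum_ord k (f : 'I_k -> V -> R) x :
  (forall i, differentiable (f i) x) -> differentiable (fun x => \sum_(i < k) f i x) x.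
Proof. by move=> df; rewrite sum_fctE; exact: differentiable_sum. Qed.

Lemma derive_sum_ord k (f : 'I_k -> V -> R) x v :
  (forall i, differentiable (f i) x) ->
  'D_v (fun x => \sum_(i < k) f i x) x = \sum_(i < k) 'D_v (f i) x.
Proof.
by move=> df; rewrite sum_fctE derive_sum// => i; exact: diff_derivable.
Qed.

Lemma derive_mulE (f g : V -> R) x v : differentiable f x -> differentiable g x ->
  'D_v (fun x => f x * g x) x = f x * 'D_v g x + g x * 'D_v f x.
Proof. by move=> df dg; exact: (deriveM (diff_derivable df) (diff_derivable dg)). Qed.

End derive_sums.

Section dotq.
Context {R : realType} {n : nat}.
Implicit Types p q : quatn R n.

Lemma dotqC p q : dotq p q = dotq q p.
Proof. by apply: eq_bigr => m _; apply: eq_bigr => c _; rewrite mulrC. Qed.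

Lemma dotqE p q : dotq p q = \tr (p *m q^T).
Proof.
by apply: eq_bigr => m _; rewrite mxE; apply: eq_bigr => c _; rewrite mxE.
Qed.

Lemma dotq_mulmxr (A : 'M[R]_4) p q : dotq (p *m A) q = dotq p (q *m A^T).
Proof. by rewrite !dotqE trmx_mul trmxK mulmxA. Qed.

Lemma dotq_mulmxl (A : 'M[R]_n) p q : dotq (A *m p) q = dotq p (A^T *m q).
Proof. by rewrite !dotqE trmx_mul trmxK -mulmxA mxtrace_mulC mulmxA. Qed.

End dotq.

Section graph_chart.
Context {R : realType} {n d k : nat}.
Variables (free : 'I_d -> 'I_n * 'I_4) (dep : 'I_k -> 'I_n * 'I_4).
Variables (null : 'I_n -> 'I_4 -> Prop) (S : 'I_k -> 'M[R]_4) (a b : 'I_k -> R).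
Variables (U : set 'rV[R]_d) (phi : 'rV[R]_d -> quatn R n).
Hypothesis splitE : forall F : 'I_n -> 'I_4 -> R,
  (forall m c, null m c -> F m c = 0) ->
  \sum_m \sum_c F m c =
  \sum_j F (free j).1 (free j).2 + \sum_l F (dep l).1 (dep l).2.
Hypothesis symS : forall l, (S l)^T = S l.
Hypothesis openU : open U.
Hypothesis C1phi : forall m c, C1_on U (fun x => phi x m c).
Hypothesis freeE : forall x j, phi x (free j).1 (free j).2 = x 0 j.
Hypothesis nullE : forall x m c, null m c -> phi x m c = 0.
Hypothesis nullSE : forall x l m c, null m c -> (phi x *m S l) m c = 0.
Hypothesis constraint : forall l x, U x -> dotq (phi x *m S l) (phi x) = a l.
Hypothesis gram_constraints : forall l l' x, U x ->
  dotq (phi x *m S l) (phi x *m S l') = if l == l' then b l else 0.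

(** As [S l] is symmetric, [phi x *m S l] is half the gradient of the l-th quadratic constraint;
    only its entries at the dependent coordinates are kept. *)
Definition dep_minor (x : 'rV[R]_d) : 'M[R]_k :=
  \matrix_(l, l') (phi x *m S l) (dep l').1 (dep l').2.

Let dphi x m c : U x -> differentiable (fun x => phi x m c) x.
Proof. by move=> Ux; have [] := @C1phi m c x Ux. Qed.

Let Dphi x v m c : U x -> ('D_v phi x) m c = 'D_v (fun x => phi x m c) x.
Proof. by move=> Ux; rewrite derive_entry// => i j; exact: dphi. Qed.

Let Dphi_free x v j : U x -> ('D_v phi x) (free j).1 (free j).2 = v 0 j.
Proof.
move=> Ux; rewrite Dphi// (_ : (fun x => phi x (free j).1 (free j).2) = (fun x => x 0 j)) ?derive_coord//.
by apply/funext => y; exact: freeE.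
Qed.

Let Dphi_null x v m c : U x -> null m c -> ('D_v phi x) m c = 0.
Proof.
move=> Ux mc; rewrite Dphi// (_ : (fun x => phi x m c) = cst 0) ?derive_cst//.
by apply/funext => y; exact: nullE.
Qed.

(** The free coordinates of [phi x] give back x, and those of the derivative along v give back v;
    both injectivity conditions follow. *)
Lemma graph_local_param M : phi @` U `<=` M -> local_param M U phi.
Proof.
move=> phiM; split.
- exact: openU.
- exact: phiM.
- move=> x y Ux Uy xy; apply/rowP => j.
  by rewrite -!freeE xy.
- by move=> x Ux; exact: (C1_entries openU).
- by move=> x Ux v w vw; apply/rowP => j; rewrite -!(Dphi_free _ _ Ux) vw.
Qed.

Lemma tangent_constraint l x v : U x -> dotq (phi x *m S l) ('D_v phi x) = 0.
Proof.
move=> Ux.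
have dS m c : differentiable (fun x => (phi x *m S l) m c) x.
  under eq_fun do rewrite mxE.
  by apply: differentiable_sum_ord => c'; apply: differentiableM => //; exact: dphi.
have DS m c : 'D_v (fun x => (phi x *m S l) m c) x = ('D_v phi x *m S l) m c.
  under eq_fun do rewrite mxE.
  rewrite derive_sum_ord; last first.
    by move=> c'; apply: differentiableM => //; exact: dphi.
  rewrite mxE; apply: eq_bigr => c' _.
  rewrite derive_mulE//; last exact: dphi.
  by rewrite derive_cst mulr0 add0r Dphi// mulrC.
have dterm m c : differentiable (fun x => (phi x *m S l) m c * phi x m c) x.
  by apply: differentiableM => //; exact: dphi.
have : 'D_v (fun x => dotq (phi x *m S l) (phi x)) x = 0.
  rewrite (@near_eq_derive _ _ _ _ (cst (a l)))// ?derive_cst//.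
  by apply: filterS (open_nbhs_nbhs (conj openU Ux)) => y /constraint.
rewrite /dotq derive_sum_ord => [|m]; last exact: differentiable_sum_ord.
under eq_bigr => m _.
  rewrite derive_sum_ord//; under eq_bigr => c _.
    rewrite derive_mulE//; last exact: dphi.
    rewrite DS -Dphi//.
    over.
  rewrite big_split/=.
  over.
rewrite big_split/= -!/(dotq _ _) (dotqC (phi x)) (dotq_mulmxr (S l) ('D_v phi x)) symS (dotqC ('D_v phi x)).
lra.
Qed.

(** Let H hold the derivatives of the dependent coordinates, and Lf, L the free and dependent parts
    of the gradients. The metric is 1 + H H^T; tangency says Lf = - L H^T; orthogonality says Lf
    Lf^T + L L^T = diag b. Hence L (1 + H^T H) L^T = diag b, and Sylvester's identity exchanges the
    order in the middle factor. *)
Lemma det_metric_tensor x : U x ->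
  \det (metric_tensor phi x) * \det (dep_minor x) ^+ 2 = \prod_l b l.
Proof.
move=> Ux.
pose H : 'M[R]_(d, k) := \matrix_(j, l) ('D_(delta_mx 0 j) phi x) (dep l).1 (dep l).2.
pose L := dep_minor x.
pose Lf : 'M[R]_(k, d) := \matrix_(l, j) (phi x *m S l) (free j).1 (free j).2.
have gE : metric_tensor phi x = 1%:M + H *m H^T.
  apply/matrixP => i j; rewrite !mxE /dotq splitE; last first.
    by move=> m c mc; rewrite Dphi_null ?mul0r.
  congr (_ + _); last by apply: eq_bigr => l _; rewrite !mxE.
  under eq_bigr do rewrite !Dphi_free// !mxE eqxx/= -natrM mulnb.
  rewrite (bigD1 i)//= eqxx/= big1 ?addr0// => j' /negPf ->.
  by [].
have LfE : Lf = - (L *m H^T).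
  apply/matrixP => l j; rewrite [LHS]mxE [RHS]mxE [X in - X]mxE.
  have := tangent_constraint l (delta_mx 0 j) Ux.
  rewrite /dotq splitE; last by move=> m c mc; rewrite Dphi_null ?mulr0.
  rewrite (bigD1 j)//= Dphi_free// [delta_mx _ _ _ _]mxE !eqxx mulr1 big1 ?addr0; last first.
    by move=> j' /negPf jj'; rewrite Dphi_free// [delta_mx _ _ _ _]mxE eqxx jj' mulr0.
  move=> /eqP; rewrite addr_eq0 => /eqP ->; congr (- _).
  by apply: eq_bigr => l' _; rewrite !mxE.
have LE : Lf *m Lf^T + L *m L^T = diag_mx (\row_l b l).
  apply/matrixP => l l'; rewrite !mxE.
  rewrite -[RHS](_ : (if l == l' then b l else 0) = _); last by case: eqP.
  rewrite -(gram_constraints l l' Ux) /dotq splitE; last first.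
    by move=> m c mc; rewrite nullSE ?mul0r.
  by congr (_ + _); apply: eq_bigr => j _; rewrite !mxE.
rewrite gE det_1D_mulmxC.
have := congr1 determinant LE; rewrite LfE.
rewrite linearN/= mulNmx mulmxN opprK trmx_mul trmxK mulmxA -(mulmxA L) -[X in _ + X *m _]mulmx1.
rewrite -mulmxDl -mulmxDr !det_mulmx det_tr det_diag addrC => e.
rewrite (eq_bigr (fun l => (\row_l b l) 0 l)) => [|l _]; last by rewrite mxE.
by rewrite -e -/L addrC; ring.
Qed.

End graph_chart.

(** * Isometries and invariance of the volume *)

Section isometries.
Context {R : realType} {n : nat}.

(* The isometry q |-> Q q E of H^n, with Q mixing the quaternionic coordinates
   and E acting on the basis 1, i, j, k. *)
Record isometry := Isometry {
  row_part : 'M[R]_n;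
  col_part : 'M[R]_4;
  row_partP : row_part *m row_part^T = 1%:M;
  col_partP : col_part *m col_part^T = 1%:M }.

Definition act (s : isometry) (q : quatn R n) : quatn R n :=
  row_part s *m q *m col_part s.

Definition inv_isometry (s : isometry) : isometry.
Proof.
exists (row_part s)^T (col_part s)^T; rewrite trmxK; apply: mulmx1C.
- exact: row_partP.
- exact: col_partP.
Defined.

Definition comp_isometry (s t : isometry) : isometry.
Proof.
exists (row_part s *m row_part t) (col_part t *m col_part s).
- by rewrite trmx_mul mulmxA -(mulmxA _ _ (row_part t)^T) row_partP mulmx1 row_partP.
- by rewrite trmx_mul mulmxA -(mulmxA _ _ (col_part s)^T) col_partP mulmx1 col_partP.
Defined.

Definition row_isometry (Q : 'M[R]_n) (hQ : Q *m Q^T = 1%:M) : isometry.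
Proof. by exists Q 1%:M => //; rewrite trmx1 mulmx1. Defined.

Definition col_isometry (E : 'M[R]_4) (hE : E *m E^T = 1%:M) : isometry.
Proof. by exists 1%:M E => //; rewrite trmx1 mulmx1. Defined.

Lemma act_row Q (hQ : Q *m Q^T = 1%:M) q : act (row_isometry hQ) q = Q *m q.
Proof. by rewrite /act /= mulmx1. Qed.

Lemma act_col E (hE : E *m E^T = 1%:M) q : act (col_isometry hE) q = q *m E.
Proof. by rewrite /act /= mul1mx. Qed.

Lemma act_comp s t q : act (comp_isometry s t) q = act s (act t q).
Proof. by rewrite /act /= !mulmxA. Qed.

Lemma actK s : cancel (act s) (act (inv_isometry s)).
Proof.
move=> q; rewrite /act /= !mulmxA (mulmx1C (row_partP s)) mul1mx.
by rewrite -mulmxA col_partP mulmx1.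
Qed.

Lemma actKV s : cancel (act (inv_isometry s)) (act s).
Proof.
move=> q; rewrite /act /= !mulmxA row_partP mul1mx.
by rewrite -mulmxA (mulmx1C (col_partP s)) mulmx1.
Qed.

Lemma dotq_act s p q : dotq (act s p) (act s q) = dotq p q.
Proof.
rewrite /act dotq_mulmxr -mulmxA col_partP mulmx1 dotq_mulmxl mulmxA.
by rewrite (mulmx1C (row_partP s)) mul1mx.
Qed.

Lemma differentiable_act s q : differentiable (act s) q.
Proof.
apply: differentiable_entries => i j; rewrite /act.
under eq_fun do rewrite mxE.
apply: differentiable_sum_ord => k; apply: differentiableM => //.
under eq_fun do rewrite mxE.
by apply: differentiable_sum_ord => l; apply: differentiableM => //;
  exact: differentiable_coord.
Qed.

Lemma continuous_act s : continuous (act s).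
Proof. by move=> q; apply: differentiable_continuous; exact: differentiable_act. Qed.

Lemma derive_act (V : normedModType R) s (phi : V -> quatn R n) x v :
  derivable phi x v -> 'D_v (fun y => act s (phi y)) x = act s ('D_v phi x).
Proof.
move=> dphi; apply: cvg_lim => //.
have e : (fun h : R => h^-1 *: (((fun y => act s (phi y)) \o shift x) (h *: v) - act s (phi x))) =
    act s \o (fun h => h^-1 *: ((phi \o shift x) (h *: v) - phi x)).
  apply/funext => h /=.
  by rewrite /act -scalemxAr -scalemxAl mulmxBr mulmxBl.
have l : h^-1 *: ((phi \o shift x) (h *: v) - phi x) @[h --> 0^'] --> 'D_v phi x.
  exact: dphi.
rewrite [X in X @ _]e; apply: (cvg_comp _ _ l).
exact: continuous_act.
Qed.

Lemma local_param_act d s (M : set (quatn R n)) (U : set 'rV[R]_d) phi :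
  (forall q, M q -> M (act s q)) ->
  local_param M U phi -> local_param M U (fun x => act s (phi x)).
Proof.
move=> sM [oU phiM inj_phi C1phi imm]; split.
- exact: oU.
- by move=> _ [x Ux <-]; apply: sM; apply: phiM; exists x.
- by move=> x y Ux Uy /(can_inj (actK s)); exact: inj_phi.
- move=> x Ux; have [dphi cphi] := C1phi x Ux.
  split=> [|v]; first by apply: differentiable_comp => //; exact: differentiable_act.
  have dE y : U y -> 'D_v (fun y => act s (phi y)) y = act s ('D_v phi y).
    by move=> Uy; apply: derive_act; apply: diff_derivable; have [] := C1phi y Uy.
  rewrite /prop_for /continuous_at dE//.
  have := continuous_comp (cphi v) (continuous_act (s := s) (x := 'D_v phi x)).
  apply: cvg_trans; apply: (@near_eq_cvg _ _ (nbhs x)).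
  by apply: filterS (open_nbhs_nbhs (conj oU Ux)) => y /dE.
- move=> x Ux v w; have [dphi _] := C1phi x Ux.
  by rewrite !derive_act; try exact: diff_derivable; move=> /(can_inj (actK s)) /(imm x Ux).
Qed.

Lemma metric_tensor_act d s (phi : 'rV[R]_d -> quatn R n) x :
  differentiable phi x ->
  metric_tensor (fun y => act s (phi y)) x = metric_tensor phi x.
Proof.
move=> dphi; apply/matrixP => i j; rewrite !mxE !derive_act ?dotq_act//;
  exact: diff_derivable.
Qed.

(** The image of A under s, written as a preimage under the inverse so that measurability follows
    from continuity. *)
Definition moves (s : isometry) (A : set (quatn R n)) : set (quatn R n) :=
  act (inv_isometry s) @^-1` A.

Lemma moves_comp s t A : moves (comp_isometry s t) A = moves s (moves t A).
Proof.
apply/seteqP; split => q; rewrite /moves /= /act /=.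
  by rewrite !trmx_mul !mulmxA.
by rewrite !trmx_mul !mulmxA.
Qed.

Lemma movesKV s A : moves s (moves (inv_isometry s) A) = A.
Proof.
apply/seteqP; split => q; rewrite /moves /=.
  by rewrite actK.
by rewrite actK.
Qed.

End isometries.
Arguments isometry : clear implicits.

(** * Borel sets given by continuous functions *)

Section borel_sets.
Context {T : ptopologicalType}.

Lemma borel_open (A : set (borel T)) : open (A : set T) -> measurable A.
Proof. by move=> oA; exact: sub_sigma_algebra. Qed.

Lemma borel_closed (A : set (borel T)) : closed (A : set T) -> measurable A.
Proof.
move=> cA; rewrite -(setCK A); apply: measurableC; apply: borel_open.
exact: closed_openC.
Qed.

End borel_sets.

Lemma borel_preimage (S T : ptopologicalType) (f : S -> T) (A : set (borel T)) :
  continuous f -> measurable A -> measurable (f @^-1` A : set (borel S)).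
Proof.
move=> cf mA.
have : measurable_fun setT (f : borel S -> borel T).
  apply: (@measurability _ _ (borel S) (borel T) setT f (@open T) erefl).
  move=> _ [B oB <-]; rewrite setTI; apply: borel_open.
  by move/continuousP : cf; apply.
by move=> /(_ measurableT A mA); rewrite setTI.
Qed.

Section continuous_conditions.
Context {R : realType} {T : ptopologicalType}.
Implicit Types f g : T -> R.

Lemma borel_gt0 f : continuous f -> measurable [set x : borel T | 0 < f x].
Proof.
move=> cf; apply: borel_open; rewrite (_ : [set x | _] = f @^-1` [set r | 0 < r]) //.
by move/continuousP : cf; apply; exact: open_gt.
Qed.

Lemma borel_eq f (a : R) : continuous f -> measurable [set x : borel T | f x = a].
Proof.
move=> cf; apply: borel_closed; rewrite (_ : [set x | _] = f @^-1` [set a]) //.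
by move/continuous_closedP : cf; apply; exact: closed_eq.
Qed.

Lemma borel_preimage_real f (B : set R) : continuous f -> measurable B ->
  measurable (f @^-1` B : set (borel T)).
Proof.
move=> cf mB.
have : measurable_fun setT (f : borel T -> R).
  apply: (@measurability _ _ (borel T) R setT f (@RGenOpens.G R)).
    exact: RGenOpens.measurableE.
  move=> _ [_ [x [y ->]] <-]; rewrite setTI; apply: borel_open.
  by move/continuousP : cf; apply; exact: itv_open.
by move=> /(_ measurableT B mB); rewrite setTI.
Qed.

Lemma continuous_mul f g : continuous f -> continuous g -> continuous (fun x => f x * g x).
Proof. by move=> cf cg x; apply: continuousM; [exact: cf|exact: cg]. Qed.

Lemma continuous_sqr f : continuous f -> continuous (fun x => f x ^+ 2).
Proof. by move=> cf; under eq_fun do rewrite expr2; exact: continuous_mul. Qed.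

Lemma continuous_add f g : continuous f -> continuous g -> continuous (fun x => f x + g x).
Proof. by move=> cf cg x; apply: continuousD; [exact: cf|exact: cg]. Qed.

Lemma continuous_opp f : continuous f -> continuous (fun x => - f x).
Proof. by move=> cf x; apply: continuousN; exact: cf. Qed.

Lemma continuous_sum k (F : 'I_k -> T -> R) : (forall i, continuous (F i)) ->
  continuous (fun x => \sum_(i < k) F i x).
Proof. by move=> cF x; apply: (@cvg_sum_ord R _ _ (nbhs x)) => i; exact: cF. Qed.

End continuous_conditions.

Lemma continuous_entry (R : realType) m n (i : 'I_m) (j : 'I_n) :
  continuous (fun q : 'M[R]_(m, n) => q i j).
Proof. by move=> q; apply: differentiable_continuous; exact: differentiable_coord. Qed.

(** * Finiteness of the volume and its invariance under symmetries *)

Section invariance.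
Context {R : realType} {n d : nat}.
Variables (M : set (quatn R n)) (mu : {measure set (borel (quatn R n)) -> \bar R}).
Hypothesis mu_vol : is_riemannian_volume d M mu.
Variables (U : set 'rV[R]_d) (phi : 'rV[R]_d -> quatn R n).
Hypothesis phi_param : local_param M U phi.
Local Notation V := (phi @` U).
Local Notation Q := (borel (quatn R n)).
Hypothesis mV : measurable (V : set Q).
Hypothesis V_lty : (mu V < +oo)%E.

Definition symmetry_of (A : set (quatn R n)) (s : isometry R n) :=
  forall q, A q <-> A (act s q).

Lemma symmetry_inv A s : symmetry_of A s -> symmetry_of A (inv_isometry s).
Proof. by move=> sA q; rewrite [A (act _ q)]sA actKV. Qed.

Lemma symmetry_comp A s t : symmetry_of A s -> symmetry_of A t ->
  symmetry_of A (comp_isometry s t).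
Proof. by move=> sA tA q; rewrite act_comp -sA. Qed.

Lemma measurable_moves s A : measurable (A : set Q) -> measurable (moves s A : set Q).
Proof. by move=> mA; apply: borel_preimage => //; exact: continuous_act. Qed.

Lemma moves_symmetry A s : symmetry_of A s -> moves s A = A.
Proof.
move=> sA; have isA := symmetry_inv sA.
by apply/seteqP; split => q; rewrite /moves /= -isA.
Qed.

Lemma movesI s (A B : set (quatn R n)) : moves s (A `&` B) = moves s A `&` moves s B.
Proof. by []. Qed.

Lemma moves_subset s (A B : set (quatn R n)) : A `<=` B -> moves s A `<=` moves s B.
Proof. by move=> AB q; exact: AB. Qed.

(** Following [phi] by [act s] gives another parametrization of M with the same domain and the same
    metric, and the preimage of the moved set is the preimage of A. *)
Lemma measure_moves_chart s A : symmetry_of M s -> measurable (A : set Q) ->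
  A `<=` V -> mu (moves s A) = mu A.
Proof.
move=> sM mA AV; have [_ vol] := mu_vol.
have sMf q : M q -> M (act s q) by rewrite sM.
rewrite (vol _ _ _ phi_param mA AV).
have AV' : moves s A `<=` (fun x => act s (phi x)) @` U.
  by move=> q /AV [x Ux xq]; exists x => //; rewrite xq actKV.
rewrite (vol _ _ _ (local_param_act sMf phi_param) (measurable_moves s mA) AV').
apply: (congr1 (@integral_rV R d)); apply/funext => x; apply: (congr1 (@EFin R)).
have -> : (fun x => act s (phi x)) @^-1` moves s A = phi @^-1` A.
  by apply/seteqP; split => y; rewrite /moves /= actK.
have [Ux|nUx] := pselect (U x).
  have [_ _ _ /(_ x Ux)[dphi _] _] := phi_param.
  by rewrite (metric_tensor_act s dphi).
have -> : \1_(U `&` phi @^-1` A) x = 0 :> R by rewrite indicE memNset// => -[].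
by rewrite [LHS]mul0r [RHS]mul0r.
Qed.

(** Induction on the list of copies: A is cut into the part inside [moves h V] and the rest. The
    first part can be brought back to V, where the volume formula applies; the rest is covered by
    the shorter list. Finiteness rides along the same induction. *)
Lemma measure_moves_cover (L : seq (isometry R n)) A :
  (forall h, List.In h L -> symmetry_of M h) -> measurable (A : set Q) ->
  (forall q, A q -> exists2 h, List.In h L & moves h V q) ->
  (mu A < +oo)%E /\ forall s, symmetry_of M s -> mu (moves s A) = mu A.
Proof.
elim: L A => [|h L IH] A symL mA cA.
  have -> : A = set0 by rewrite -subset0 => q /cA[].
  by rewrite measure0; split=> // s _; rewrite /moves preimage_set0 measure0.
have mhV : measurable (moves h V : set Q) by exact: measurable_moves.
pose B := A `&` moves h V; pose C := A `\` moves h V.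
have mB : measurable (B : set Q) by exact: measurableI.
have mC : measurable (C : set Q) by exact: measurableD.
have symh : symmetry_of M h by apply: symL; left.
have ABC : A = B `|` C by rewrite /B /C setUIDK.
have disj : B `&` C = set0.
  by rewrite -subset0 => q [[_ hq] [_ /(_ hq)]].
have [Coo Cinv] : (mu C < +oo)%E /\ forall s, symmetry_of M s -> mu (moves s C) = mu C.
  apply: IH => //; first by move=> g gL; apply: symL; right.
  by move=> q [/cA[g [<-|gL] gq] nq]; [case: (nq gq)|exists g].
(* The piece B brought back into the chart. Moving B by s is moving B' by s composed with h, again a
   symmetry of M, so both B and its image have the measure of B'. *)
pose B' := moves (inv_isometry h) B.
have mB' : measurable (B' : set Q) by exact: measurable_moves.
have B'V : B' `<=` V.
  have -> : V = moves (inv_isometry h) (moves h V).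
    by apply/seteqP; split => q; rewrite /moves /= actKV.
  by apply: moves_subset => q [].
have BE : B = moves h B' by rewrite /B' movesKV.
have Binv s : symmetry_of M s -> mu (moves s B) = mu B.
  move=> sM; rewrite BE -moves_comp.
  by rewrite (measure_moves_chart (symmetry_comp sM symh) mB' B'V)
    (measure_moves_chart symh mB' B'V).
have Boo : (mu B < +oo)%E.
  rewrite BE (measure_moves_chart symh mB' B'V); apply: le_lt_trans V_lty.
  by apply: le_measure => //; rewrite inE.
split.
  by rewrite ABC measureU// lte_add_pinfty.
move=> s sM; have -> : moves s A = moves s B `|` moves s C by rewrite {1}ABC.
transitivity (mu B + mu C)%E; last by rewrite [in RHS]ABC measureU.
have disj' : moves s B `&` moves s C = set0 by rewrite -movesI disj.
have := measureU mu (measurable_moves s mB) (measurable_moves s mC) disj' => ->.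
by congr (_ + _)%E; [exact: Binv|exact: Cinv].
Qed.

End invariance.

(** * Null sets from infinitely many reflections *)

Section null_sets.
Context {R : realType} {n : nat}.
Variables (M : set (quatn R n)) (mu : {measure set (borel (quatn R n)) -> \bar R}).
Local Notation Q := (borel (quatn R n)).
Hypothesis mM : measurable (M : set Q).
Hypothesis M_lty : (mu M < +oo)%E.
Hypothesis mu_inv : forall s A, symmetry_of M s -> measurable (A : set Q) ->
  A `<=` M -> mu (moves s A) = mu A.

(* Infinitely many almost disjoint sets of the same measure do not fit into a
   set of finite measure. *)
Lemma null_of_almost_disjoint_moves (g : nat -> isometry R n) (A C : set Q) :
  measurable A -> A `<=` M -> measurable C -> mu C = 0%E ->
  (forall t, symmetry_of M (g t)) ->
  (forall t t' q, t != t' -> moves (g t) A q -> moves (g t') A q -> C q) ->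
  mu A = 0%E.
Proof.
move=> mA AM mC C0 gM gC.
pose B t : set Q := moves (g t) A `\` C.
have mgA t : measurable (moves (g t) A : set Q).
  by apply: borel_preimage => //; exact: continuous_act.
have mB t : measurable (B t) by exact: measurableD.
have BE t : mu (B t) = mu A.
  rewrite -(mu_inv (gM t) mA AM).
  have <- : mu (B t `|` (moves (g t) A `&` C)) = mu (B t).
    apply: measureU0 => //; first exact: measurableI.
    by apply: (subset_measure0 _ mC) => //; exact: measurableI.
  by rewrite setUC setUIDK.
have disj : trivIset setT B.
  apply/trivIsetP => t t' _ _ tt'; rewrite -subset0 => q [[tq nq] [t'q _]].
  by apply: nq; exact: gC tt' tq t'q.
have BM t : B t `<=` M.
  by move=> q [/AM + _]; rewrite -(symmetry_inv (gM t) q).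
have sum_le N : (\sum_(t < N) mu A <= mu M)%E.
  rewrite (eq_bigr (fun t : 'I_N => mu (B t))) => [|t _]; last by rewrite BE.
  rewrite -(@measure_bigsetU_ord _ _ _ mu N xpredT (fun t => B t))//; last first.
    by move=> i j _ _ ij; apply: val_inj; exact: (disj i j I I ij).
  apply: le_measure; rewrite ?inE//; first exact: bigsetU_measurable.
  by elim/big_ind: _ => [//|A1 A2 sA1 sA2|t _]; [rewrite subUset|exact: BM].
have muA0 : (0 <= mu A)%E by exact: measure_ge0.
have : (mu A < +oo)%E.
  by apply: le_lt_trans M_lty; apply: le_measure; rewrite ?inE.
move: muA0 sum_le; case: (mu A) => // a; rewrite lee_fin le_eqVlt => /predU1P[<-//|a0].
move=> sum_le _; exfalso.
have fM : mu M \is a fin_num by rewrite ge0_fin_numE// measure_ge0.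
have [m mE] : exists m, mu M = m%:E by exists (fine (mu M)); rewrite fineK.
(* More than m / a disjoint sets of measure a would exceed the total mass m. *)
have := sum_le (Num.trunc (m / a)).+1; rewrite mE.
rewrite sumEFin lee_fin sumr_const card_ord leNgt -mulr_natr mulrC -ltr_pdivrMr//.
by rewrite truncnS_gt.
Qed.

(** The Householder reflection in the hyperplane orthogonal to [u]. *)
Definition reflection_mx (k : nat) (u : 'rV[R]_k) : 'M[R]_k :=
  1%:M - (2 / (u *m u^T) 0 0) *: (u^T *m u).

Lemma reflection_mx_sym k (u : 'rV[R]_k) : (reflection_mx u)^T = reflection_mx u.
Proof. by rewrite /reflection_mx linearB/= linearZ/= trmx1 trmx_mul trmxK. Qed.

Lemma reflection_mxP k (u : 'rV[R]_k) : (u *m u^T) 0 0 != 0 ->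
  reflection_mx u *m (reflection_mx u)^T = 1%:M.
Proof.
move=> u0; rewrite reflection_mx_sym /reflection_mx.
set a := (u *m u^T) 0 0; set P := u^T *m u.
have PP : P *m P = a *: P.
  rewrite /P -mulmxA [u *m _]mulmxA [u *m u^T]mx11_scalar -/a.
  by rewrite mul_scalar_mx scalemxAr.
set c := 2 / a.
have cc : c * (c * a) = c + c by rewrite /c; field.
rewrite mulmxBl mul1mx mulmxBr mulmx1 -scalemxAl -scalemxAr PP !scalerA -mulrA cc.
have -> : c *: P - (c + c) *: P = - (c *: P) by rewrite scalerDl opprD addrA subrr sub0r.
by rewrite opprK subrK.
Qed.

(* Infinitely many reflections mix the rows p and r of [X q]. *)
Lemma null_chain (k w : nat) (X : quatn R n -> 'M[R]_(k, w))
    (g : 'rV[R]_k -> isometry R n) (T : pred 'I_k) (Y : set (quatn R n)) :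
  measurable (Y : set Q) -> Y `<=` M ->
  (forall i j, continuous (fun q => X q i j)) ->
  (forall p r (t : nat), T p -> T r -> p != r ->
    let u := delta_mx 0 p + t%:R *: delta_mx 0 r in
    [/\ symmetry_of M (g u), symmetry_of Y (g u) &
        forall q, X (act (inv_isometry (g u)) q) = reflection_mx u *m X q]) ->
  mu (Y `&` [set q | forall p, T p -> row p (X q) = 0]) = 0%E ->
  forall p, T p -> mu (Y `&` [set q | row p (X q) = 0]) = 0%E.
Proof.
move=> mY YM cX gX null_all p Tp.
pose Z (s : seq 'I_k) : set Q := Y `&` [set q | forall i, i \in s -> row i (X q) = 0].
have mZ s : measurable (Z s).
  (* Finitely many equations are encoded by the vanishing of one continuous function, a sum of
     squares; hence Z is Borel. *)
  have -> : Z s = Y `&` [set q | \sum_i \sum_j (i \in s)%:R * (X q i j * X q i j) = 0].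
    congr (_ `&` _); apply/seteqP; split => q /= Xq.
      apply: big1 => i _; apply: big1 => j _; case: (boolP (i \in s)) => si; last by rewrite mul0r.
      by have /rowP/(_ j) := Xq i si; rewrite !mxE => ->; rewrite !mulr0.
    move=> i si; apply/rowP => j; rewrite !mxE.
    have term0 (i' : 'I_k) (j' : 'I_w) : 0 <= (i' \in s)%:R * (X q i' j' * X q i' j').
      by rewrite mulr_ge0// -expr2 sqr_ge0.
    have /eqP := Xq; rewrite psumr_eq0 => [|i' _]; last by apply: sumr_ge0.
    move=> /allP/(_ i); rewrite mem_index_enum => /(_ isT)/=.
    rewrite psumr_eq0 => [|j' _]; last exact: term0.
    move=> /allP/(_ j); rewrite mem_index_enum => /(_ isT)/=.
    by rewrite si mul1r mulf_eq0 orbb => /eqP.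
  apply: measurableI => //; apply: borel_eq.
  apply: continuous_sum => i; apply: continuous_sum => j.
  by apply: continuous_mul; [exact: cst_continuous|apply: continuous_mul; exact: cX].
have ZM s : Z s `<=` M by move=> q [/YM].
(* Copies of Z s under different reflections mixing rows p and r meet only where row r vanishes too.
   So if that smaller set is null, Z s itself is null. *)
have step (s : seq 'I_k) r : p \in s -> T r -> mu (Z (r :: s)) = 0%E -> mu (Z s) = 0%E.
  move=> ps Tr Zr; have [rs|rs] := boolP (r \in s).
    rewrite -Zr; congr (mu _); apply/seteqP; split => q [Yq Xq]; split => // i.
      by rewrite inE => /predU1P[->|]; exact: Xq.
    by move=> si; apply: Xq; rewrite inE si orbT.
  have pr : p != r by apply: contra rs => /eqP <-.
  pose u (t : nat) : 'rV[R]_k := delta_mx 0 p + t%:R *: delta_mx 0 r.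
  have gu t := gX p r t Tp Tr pr.
  apply: (@null_of_almost_disjoint_moves (fun t => g (u t)) (Z s) (Z (r :: s))) => //.
    by move=> t; have [] := gu t.
  have uX t q : u t *m X q = row p (X q) + t%:R *: row r (X q).
    by rewrite /u mulmxDl -scalemxAl -!rowE.
  have uu t : (u t *m (u t)^T) 0 0 = 1 + t%:R ^+ 2.
    rewrite /u linearD/= linearZ/= !trmx_delta mulmxDl !mulmxDr -!scalemxAl -!scalemxAr.
    rewrite !mul_delta_mx_cond !eqxx (negPf pr) eq_sym (negPf pr) /=.
    rewrite !mulr0n !mulr1n !scaler0 addr0 add0r !mxE eqxx /=.
    by rewrite mulr1 expr2.
  have row_refl t q i : row i (reflection_mx (u t) *m X q) =
      row i (X q) - (2 / (1 + t%:R ^+ 2) * u t 0 i) *: (row p (X q) + t%:R *: row r (X q)).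
    rewrite /reflection_mx mulmxBl mul1mx uu -scalemxAl -mulmxA uX linearB/= linearZ/=.
    rewrite row_mul; congr (_ - _).
    have -> : row i (u t)^T = (u t 0 i)%:M by apply/rowP => j; rewrite ord1 !mxE eqxx mulr1n.
    by rewrite mul_scalar_mx scalerA.
  have x0 t q : moves (g (u t)) (Z s) q -> Y q /\
      (forall i j, i \in s -> X q i j =
        2 / (1 + t%:R ^+ 2) * u t 0 i * (X q p j + t%:R * X q r j)).
    have [_ sY gXE] := gu t; move=> [Yq Xq]; split.
      by move: Yq; rewrite -(symmetry_inv sY q).
    move=> i j si; have := Xq i si; rewrite gXE row_refl => /eqP; rewrite subr_eq0.
    move=> /eqP/rowP/(_ j); rewrite mxE => ->; rewrite mxE; congr (_ * _).
    by rewrite mxE; congr (_ + _); rewrite ?mxE.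
  move=> t t' q tt' /x0[Yq Xt] /x0[_ Xt'].
  have uE t0 i : u t0 0 i = (i == p)%:R + t0%:R * (i == r)%:R.
    by rewrite /u !mxE !eqxx.
  have t1 (t0 : nat) : 0 < 1 + t0%:R ^+ 2 :> R by rewrite ltr_pwDl// sqr_ge0.
  (* A point in the copy for t satisfies (t^2 - 1) x = 2 t y in each column, where x and y are its
     entries in rows p and r. Eliminating y between t and t' gives (t - t') (t t' + 1) x = 0; as t
     and t' are distinct natural numbers, x = 0, and then y = 0. *)
  have xy j : X q p j = 0 /\ X q r j = 0.
    have := Xt p j ps; have := Xt' p j ps.
    rewrite !uE eqxx (negPf pr) !mulr0 !addr0 !mulr1.
    move: (X q p j) (X q r j) => x y e' e.
    have {e}e : (t%:R ^+ 2 - 1) * x = 2 * t%:R * y.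
      have -> : (t%:R ^+ 2 - 1) * x = (1 + t%:R ^+ 2) * x - 2 * x by ring.
      by rewrite {1}e; field; rewrite gt_eqF.
    have {e'}e' : (t'%:R ^+ 2 - 1) * x = 2 * t'%:R * y.
      have -> : (t'%:R ^+ 2 - 1) * x = (1 + t'%:R ^+ 2) * x - 2 * x by ring.
      by rewrite {1}e'; field; rewrite gt_eqF.
    have tt0 : t%:R - t'%:R != 0 :> R by rewrite subr_eq0 eqr_nat.
    have tt1 : t%:R * t'%:R + 1 != 0 :> R by rewrite -natrM natr1 pnatr_eq0.
    have x00 : x = 0.
      apply/eqP; rewrite -(mulrI_eq0 _ (mulfI tt0)) -(mulrI_eq0 _ (mulfI tt1)).
      apply/eqP; transitivity (t'%:R * ((t%:R ^+ 2 - 1) * x) - t%:R * ((t'%:R ^+ 2 - 1) * x)).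
        by ring.
      by rewrite e e'; ring.
    split => //; rewrite x00 !mulr0 in e e'.
    apply/eqP; rewrite -(mulrI_eq0 _ (mulfI tt0)) mulrBl; apply/eqP.
    lra.
  split => // i; rewrite inE => /predU1P[->|si].
    by apply/rowP => j; rewrite !mxE; have [] := xy j.
  apply/rowP => j; rewrite !mxE (Xt i j si).
  by have [-> ->] := xy j; rewrite !mulr0 addr0 mulr0.
(* Starting from the assumption that all rows in T vanish, rows are dropped one at a time until only
   p is left. *)
have chain s2 s1 : (forall i, i \in s2 -> T i) -> p \in s1 ->
    mu (Z (s2 ++ s1)) = 0%E -> mu (Z s1) = 0%E.
  elim: s2 => [//|r s2 IH] Ts2 ps1 Zr; apply: IH => //.
    by move=> i si; apply: Ts2; rewrite inE si orbT.
  apply: (step _ r) => //; first by rewrite mem_cat ps1 orbT.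
  by apply: Ts2; rewrite inE eqxx.
have -> : Y `&` [set q | row p (X q) = 0] = Z [:: p].
  congr (_ `&` _); apply/seteqP; split => q /= Xq.
    by move=> i; rewrite inE => /eqP ->.
  by apply: Xq; rewrite inE.
apply: (chain (enum T)) => [i||]; [by rewrite mem_enum|by rewrite inE|].
rewrite -null_all; congr (mu (_ `&` _)); apply/seteqP; split => q /= Xq i.
  by move=> Ti; apply: Xq; rewrite mem_cat mem_enum; apply/orP; left.
rewrite mem_cat mem_enum => /orP[Ti|]; first exact: Xq.
by rewrite inE => /eqP ->; exact: Xq.
Qed.

(** Up to a null set Y is the disjoint union of A and its image under s, and s preserves both E and
    the measure. *)
Lemma measure_halves (Y A E : set Q) (s : isometry R n) :
  symmetry_of M s -> symmetry_of E s -> Y `<=` M ->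
  measurable Y -> measurable A -> measurable E ->
  A `<=` Y -> moves s A `<=` Y -> A `&` moves s A = set0 ->
  mu (Y `\` (A `|` moves s A)) = 0%E ->
  (mu (Y `&` E) = 2%:E * mu (A `&` E))%E.
Proof.
move=> sM sE YM mY mA mE AY sAY disj Y0.
have msA : measurable (moves s A : set Q).
  by apply: borel_preimage => //; exact: continuous_act.
have mAE : measurable (A `&` E) by exact: measurableI.
have msAE : measurable (moves s A `&` E : set Q) by exact: measurableI.
have mN : measurable (Y `\` (A `|` moves s A) : set Q).
  by apply: measurableD => //; exact: measurableU.
have YE : Y `&` E = ((A `&` E) `|` (moves s A `&` E)) `|` ((Y `\` (A `|` moves s A)) `&` E).
  apply/seteqP; split => q.
    move=> [Yq Eq]; case: (pselect ((A `|` moves s A) q)) => [[Aq|Aq]|Aq].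
    - by left; left.
    - by left; right.
    - by right; split.
  by move=> [[[/AY Yq Eq]|[/sAY Yq Eq]]|[[Yq _] Eq]].
rewrite YE measureU0; last 3 first.
- exact: measurableU.
- exact: measurableI.
- by apply: (subset_measure0 _ mN) => //; exact: measurableI.
have disjE : (A `&` E) `&` (moves s A `&` E) = set0 by rewrite setIACA disj set0I.
have := measureU mu mAE msAE disjE => ->.
have -> : moves s A `&` E = moves s (A `&` E).
  rewrite -[in LHS](_ : moves s E = E) //.
  by apply/seteqP; split => q; rewrite /moves /= -(symmetry_inv sE q).
have AEM : A `&` E `<=` M by move=> q [/AY/YM].
transitivity (mu (A `&` E) + mu (A `&` E))%E.
  by congr (_ + _)%E; exact: (mu_inv sM mAE AEM).
by rewrite mule_natl mule2n.
Qed.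

End null_sets.

(** * Spheres *)

Lemma open_gt0 (R : realType) (T : topologicalType) (f : T -> R) :
  continuous f -> open [set x | 0 < f x].
Proof.
move=> cf; rewrite (_ : [set x | _] = f @^-1` [set r | 0 < r]) //.
by move/continuousP : cf; apply; exact: open_gt.
Qed.

(* The columns of a quaternionic coordinate which a model space uses: all four
   of them (w = 4), or 1 and j only (w = 2). *)
Record columns (w : nat) := Columns {
  cols : nat -> 'I_4;
  colpos : 'I_4 -> option nat;
  colposP : forall c j, colpos c = Some j -> (j < w)%N /\ cols j = c;
  colsK : forall j, (j < w)%N -> colpos (cols j) = Some j }.

Section coordinates.
Context {R : realType} {w n : nat} (C : columns w).
Hypothesis w0 : (0 < w)%N.

Definition crd (j : nat) : 'I_n.+1 * 'I_4 := (inord (j %/ w), cols C (j %% w)).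

Definition of_seq (L : seq R) : quatn R n.+1 :=
  \matrix_(m, c) if colpos C c is Some k then L`_(w * m + k) else 0.

Lemma of_seq_crd (L : seq R) j : (j < w * n.+1)%N ->
  of_seq L (crd j).1 (crd j).2 = L`_j.
Proof.
move=> jw; rewrite mxE colsK ?ltn_mod// inordK; first by rewrite mulnC -divn_eq.
by rewrite ltn_divLR// mulnC.
Qed.

Lemma of_seq_null (L : seq R) m c : colpos C c = None -> of_seq L m c = 0.
Proof. by rewrite mxE => ->. Qed.

Lemma sum_cols (F : 'I_4 -> R) : (forall c, colpos C c = None -> F c = 0) ->
  \sum_c F c = \sum_(j < w) F (cols C j).
Proof.
move=> F0; rewrite (bigID (fun c => colpos C c != None))/= [X in _ + X]big1 ?addr0; last first.
  by move=> c; rewrite negbK => /eqP/F0.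
pose h (c : 'I_4) : 'I_w := if colpos C c is Some k then insubd (Ordinal w0) k else Ordinal w0.
rewrite (reindex_onto (fun j : 'I_w => cols C j) h)/=; last first.
  move=> c; rewrite /h; case E : (colpos C c) => [k|//] _.
  by have [kw kc] := colposP E; rewrite val_insubd kw.
apply: eq_bigl => j; rewrite /h colsK//=; apply/eqP/val_inj => /=.
by rewrite val_insubd ltn_ord.
Qed.

Lemma sum_blocks (G : nat -> R) :
  \sum_(m < n.+1) \sum_(k < w) G (w * m + k)%N = \sum_(j < w * n.+1) G j.
Proof.
rewrite -(big_mkord xpredT G) mulnC big_nat_mul big_mkord; apply: eq_bigr => m _.
rewrite -{1}[(m * w)%N]add0n big_addn -(big_mkord xpredT (fun k => G (w * m + k)%N)).
by rewrite mulSn addnK; apply: eq_bigr => k _; rewrite addnC mulnC.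
Qed.

Lemma sum_crd (F : 'I_n.+1 -> 'I_4 -> R) :
  (forall m c, colpos C c = None -> F m c = 0) ->
  \sum_m \sum_c F m c = \sum_(j < w * n.+1) F (crd j).1 (crd j).2.
Proof.
move=> F0; rewrite -(sum_blocks (fun j => F (crd j).1 (crd j).2)).
apply: eq_bigr => m _; rewrite sum_cols; last by move=> c; exact: F0.
apply: eq_bigr => k _; rewrite /crd /= mulnC divnMDl// divn_small// addn0.
by rewrite modnMDl modn_small// inord_val.
Qed.

Lemma block_lt (m : 'I_n.+1) k : (k < w)%N -> (w * m + k < w * n.+1)%N.
Proof.
move=> kw; apply: (@leq_trans (w * m.+1)); first by rewrite mulnS addnC ltn_add2r.
by rewrite leq_mul2l ltn_ord orbT.
Qed.

Lemma of_seqP (L : seq R) (q : quatn R n.+1) :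
  (forall m c, colpos C c = None -> q m c = 0) ->
  (forall j, (j < w * n.+1)%N -> L`_j = q (crd j).1 (crd j).2) -> of_seq L = q.
Proof.
move=> q0 qL; apply/matrixP => m c; rewrite mxE.
case E : (colpos C c) => [k|]; last by rewrite q0.
have [kw kc] := colposP E.
rewrite qL; last exact: block_lt.
by rewrite /crd/= mulnC divnMDl// divn_small// addn0 modnMDl modn_small// inord_val kc.
Qed.

End coordinates.
Arguments crd {w} n C j.
Arguments of_seq {R w} n C L.

Definition columns4 : columns 4.
Proof.
exists (fun j => inord j) (fun c => Some (c : nat)).
- by move=> c j [<-]; split => //; exact: inord_val.
- by move=> j j4; rewrite inordK.
Defined.

Definition columns2 : columns 2.
Proof.
exists (fun j => inord (2 * j)) (fun c : 'I_4 => if odd c then None else Some (c./2)).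
- move=> c j; case: ifP => // oc [<-]; split; first by have := ltn_ord c; lia.
  by apply: val_inj; rewrite /= inordK; have := ltn_ord c; lia.
- by move=> j j2; rewrite inordK; [rewrite mul2n odd_double doubleK|lia].
Defined.

Definition sphere {R : realType} n w (C : columns w) : set (quatn R n) :=
  [set q | dotq q q = 2 /\ forall m c, colpos C c = None -> q m c = 0].

Section sphere_chart.
Context {R : realType} {w n d : nat} (C : columns w).
Hypothesis w0 : (0 < w)%N.
Hypothesis dE : (d.+1 = w * n.+1)%N.

Definition sphere_rest (l : seq R) : R := 2 - \sum_(y <- l) y ^+ 2.

Definition sphere_chart (x : 'rV[R]_d) : quatn R n.+1 :=
  of_seq n C (rcons (seq_of_row x) (Num.sqrt (sphere_rest (seq_of_row x)))).

Definition sphere_dom : set 'rV[R]_d := [set x | 0 < sphere_rest (seq_of_row x)].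

Definition sphere_last : 'I_n.+1 * 'I_4 := crd n C d.

Definition half_sphere : set (quatn R n.+1) :=
  sphere C `&` [set q | 0 < q sphere_last.1 sphere_last.2].

Lemma sphere_restE (x : 'rV[R]_d) :
  sphere_rest (seq_of_row x) = 2 - \sum_(j < d) x 0 j ^+ 2.
Proof. by rewrite /sphere_rest big_map big_enum. Qed.

Lemma nth_free (x : 'rV[R]_d) (s : seq R) (j : 'I_d) : (seq_of_row x ++ s)`_j = x 0 j.
Proof. by rewrite nth_cat size_seq_of_row ltn_ord nth_seq_of_row. Qed.

Let free_lt (j : 'I_d) : (j < w * n.+1)%N.
Proof. by rewrite -dE ltnS ltnW. Qed.

Let d_lt : (d < w * n.+1)%N.
Proof. by rewrite -dE. Qed.

Lemma sphere_chart_free x (j : 'I_d) : sphere_chart x (crd n C j).1 (crd n C j).2 = x 0 j.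
Proof. by rewrite of_seq_crd// -cats1 nth_free. Qed.

Lemma sphere_chart_last x :
  sphere_chart x sphere_last.1 sphere_last.2 = Num.sqrt (sphere_rest (seq_of_row x)).
Proof. by rewrite of_seq_crd// nth_rcons size_seq_of_row ltnn eqxx. Qed.

Lemma sphere_split (F : 'I_n.+1 -> 'I_4 -> R) :
  (forall m c, colpos C c = None -> F m c = 0) ->
  \sum_m \sum_c F m c = \sum_(j < d) F (crd n C j).1 (crd n C j).2 +
    \sum_(l < 1) F sphere_last.1 sphere_last.2.
Proof.
move=> F0; rewrite (sum_crd w0 F0) big_ord_recl big_ord0 addr0.
by rewrite -(big_mkord xpredT (fun j => F (crd n C j).1 (crd n C j).2)) -dE big_nat_recr//= big_mkord.
Qed.

Lemma dotq_sphere (q : quatn R n.+1) : (forall m c, colpos C c = None -> q m c = 0) ->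
  dotq q q = \sum_(j < d) q (crd n C j).1 (crd n C j).2 ^+ 2 +
    q sphere_last.1 sphere_last.2 ^+ 2.
Proof.
move=> q0; rewrite /dotq sphere_split => [|m c /q0 ->]; last by rewrite mul0r.
by rewrite big_ord_recl big_ord0 addr0; congr (_ + _).
Qed.

Lemma continuous_sphere_rest : continuous (fun x : 'rV[R]_d => sphere_rest (seq_of_row x)).
Proof.
under eq_fun do rewrite sphere_restE.
apply: continuous_add; first exact: cst_continuous.
apply: continuous_opp; apply: continuous_sum => j.
under eq_fun do rewrite expr2.
by apply: continuous_mul; exact: continuous_entry.
Qed.

Lemma sphere_dom_open : open sphere_dom.
Proof. exact: open_gt0 continuous_sphere_rest. Qed.

Lemma sphere_chart_C1 m c : C1_on sphere_dom (fun x => sphere_chart x m c).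
Proof.
under eq_fun do rewrite mxE.
case E : (colpos C c) => [k|]; last exact: C1_cst.
have [kw _] := colposP E.
have jd : (w * m + k <= d)%N.
  by rewrite -ltnS dE; exact: block_lt.
under eq_fun do rewrite nth_rcons size_seq_of_row.
move: jd; rewrite leq_eqVlt => /orP[/eqP ->|jd].
  under eq_fun do rewrite ltnn eqxx.
  apply: C1_sqrt => //; first exact: sphere_dom_open.
  under eq_fun do rewrite sphere_restE.
  apply: C1_sub; [exact: sphere_dom_open|exact: C1_cst|].
  apply: C1_sum; first exact: sphere_dom_open.
  by move=> j; apply: C1_sqr; [exact: sphere_dom_open|exact: C1_coord].
under eq_fun do rewrite jd (nth_seq_of_row _ (Ordinal jd)).
exact: C1_coord.
Qed.

Lemma sphere_chart_null x m c : colpos C c = None -> sphere_chart x m c = 0.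
Proof. exact: of_seq_null. Qed.

Lemma dotq_sphere_chart x : sphere_dom x -> dotq (sphere_chart x) (sphere_chart x) = 2.
Proof.
move=> Ux; rewrite dotq_sphere; last exact: sphere_chart_null.
under eq_bigr do rewrite sphere_chart_free.
by rewrite sphere_chart_last sqr_sqrtr ?ltW// sphere_restE addrC subrK.
Qed.

Lemma image_sphere_chart : sphere_chart @` sphere_dom = half_sphere.
Proof.
apply/seteqP; split => [_ [x Ux <-]|q [[q2 q0] qlast]].
  split; first by split; [exact: dotq_sphere_chart|exact: sphere_chart_null].
  by rewrite /= sphere_chart_last sqrtr_gt0.
pose x : 'rV[R]_d := \row_j q (crd n C j).1 (crd n C j).2.
have rE : sphere_rest (seq_of_row x) = q sphere_last.1 sphere_last.2 ^+ 2.
  rewrite sphere_restE -q2 dotq_sphere//.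
  under [X in _ - X]eq_bigr do rewrite mxE.
  by rewrite addrAC subrr add0r.
exists x; first by rewrite /sphere_dom /= rE exprn_gt0.
apply: of_seqP => // j; rewrite -dE ltnS leq_eqVlt => /orP[/eqP ->|jd].
  by rewrite nth_rcons size_seq_of_row ltnn eqxx rE sqrtr_sqr gtr0_norm.
by rewrite -cats1 (nth_free _ _ (Ordinal jd)) mxE.
Qed.

Lemma sphere_local_param M : half_sphere `<=` M ->
  local_param M sphere_dom sphere_chart.
Proof.
move=> hM; apply: (@graph_local_param R n.+1 d (fun j => crd n C j)) => //.
- exact: sphere_dom_open.
- exact: sphere_chart_C1.
- exact: sphere_chart_free.
- by rewrite image_sphere_chart.
Qed.

(** There is one constraint, with matrix 1: half its gradient is q itself, of squared norm 2, and
    the minor is the last coordinate, whose square is [sphere_rest]. *)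
Lemma sphere_density x : sphere_dom x ->
  Num.sqrt (\det (metric_tensor sphere_chart x)) =
  Num.sqrt 2 * pos_powR (- 2^-1) (sphere_rest (seq_of_row x)).
Proof.
move=> Ux.
have dets : \det (metric_tensor sphere_chart x) * sphere_rest (seq_of_row x) = 2.
  transitivity (\prod_(l < 1) (2 : R)); last by rewrite big_ord_recl big_ord0 mulr1.
  rewrite -(@det_metric_tensor R n.+1 d 1 (fun j => crd n C j) (fun=> sphere_last)
    (fun _ c => colpos C c = None) (fun=> 1%:M) (fun=> 2) (fun=> 2) sphere_dom sphere_chart
    _ _ _ _ _ _ _ _ _ x Ux).
  - by rewrite det_mx11 mxE mulmx1 sphere_chart_last sqr_sqrtr// ltW.
  - exact: sphere_split.
  - by move=> l; exact: trmx1.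
  - exact: sphere_dom_open.
  - exact: sphere_chart_C1.
  - exact: sphere_chart_free.
  - by move=> y m c; exact: sphere_chart_null.
  - by move=> y l m c mc; rewrite mulmx1 sphere_chart_null.
  - by move=> l y Uy; rewrite mulmx1 dotq_sphere_chart.
  - by move=> l l' y Uy; rewrite !ord1 eqxx mulmx1 dotq_sphere_chart.
have r0 : sphere_rest (seq_of_row x) != 0 by rewrite gt_eqF.
rewrite pos_powR_gt0// powRN powR12_sqrt ?ltW// -sqrtrV ?ltW// -sqrtrM//.
by rewrite -dets mulfK.
Qed.

End sphere_chart.

Definition row_sqnorm {R : realType} {n} (q : quatn R n) (i : 'I_n) : R :=
  \sum_c q i c ^+ 2.

Lemma continuous_row_sqnorm (R : realType) n (i : 'I_n) :
  continuous (fun q : quatn R n => row_sqnorm q i).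
Proof.
rewrite /row_sqnorm; apply: continuous_sum => c.
by under eq_fun do rewrite expr2; apply: continuous_mul; exact: continuous_entry.
Qed.

Lemma continuous_dotq (R : realType) n : continuous (fun q : quatn R n => dotq q q).
Proof.
apply: continuous_sum => m; apply: continuous_sum => c.
by apply: continuous_mul; exact: continuous_entry.
Qed.

(** Asking F to vanish off U absorbs the indicator of the domain, so that the result is an integral
    over all parameters. *)
Lemma volume_of_chart (R : realType) n d (M : set (quatn R n))
    (mu : {measure set (borel (quatn R n)) -> \bar R})
    (U : set 'rV[R]_d) phi (E : set (borel (quatn R n))) (F : seq R -> R) :
  is_riemannian_volume d M mu -> local_param M U phi ->
  measurable (phi @` U `&` E : set (borel (quatn R n))) ->
  (forall x, U x -> \1_E (phi x) * Num.sqrt (\det (metric_tensor phi x)) = F (seq_of_row x)) ->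
  (forall x, ~ U x -> F (seq_of_row x) = 0) ->
  mu (phi @` U `&` E) = iter_integral d (fun l => (F l)%:E).
Proof.
move=> [_ vol] pU mE FU F0; rewrite (vol U phi _ pU mE); last by move=> q [].
rewrite -integral_rV_seq; apply: (congr1 (@integral_rV R d)); apply/funext => x.
apply: (congr1 (@EFin R)).
have [Ux|nUx] := pselect (U x); last first.
  by rewrite F0// indicE memNset ?mul0r// => -[].
rewrite -FU//; congr (_ * _); rewrite !indicE; congr (_%:R); congr nat_of_bool.
by apply/idP/idP; rewrite !inE; [case=> _ []|move=> Ex; split=> //; split=> //; exists x].
Qed.

Section sphere_measure.
Context {R : realType} {w n d : nat} (C : columns w).
Hypothesis w0 : (0 < w)%N.
Hypothesis dE : (d.+1 = w * n.+2)%N.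
Local Notation Q := (borel (quatn R n.+2)).
Variables (M : set (quatn R n.+2)) (mu : {measure set Q -> \bar R}).
Hypothesis vol : is_riemannian_volume d M mu.
Hypothesis sphereM : @sphere R n.+2 w C `<=` M.

Let half : set (quatn R n.+2) := @half_sphere R w n.+1 d C.

Let halfM : half `<=` M.
Proof. by move=> q [/sphereM]. Qed.

Lemma measurable_sphere : measurable (@sphere R n.+2 w C : set Q).
Proof.
have -> : @sphere R n.+2 w C = [set q | dotq q q = 2] `&`
    [set q | \sum_m \sum_c (colpos C c == None)%:R * (q m c * q m c) = 0].
  apply/seteqP; split => q [q2 q0]; split => //=.
    apply: big1 => m _; apply: big1 => c _; case: eqP => [/q0 ->|_].
      by rewrite !mulr0.
    by rewrite mul0r.
  move=> m c mc; have term0 m' c' : 0 <= (colpos C c' == None)%:R * (q m' c' * q m' c').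
    by rewrite mulr_ge0// -expr2 sqr_ge0.
  have /eqP := q0; rewrite psumr_eq0 => [|m' _]; last by apply: sumr_ge0.
  move=> /allP/(_ m); rewrite mem_index_enum => /(_ isT)/=.
  rewrite psumr_eq0 => [|c' _]; last exact: term0.
  move=> /allP/(_ c); rewrite mem_index_enum => /(_ isT)/=.
  by rewrite mc eqxx mul1r mulf_eq0 orbb => /eqP.
apply: measurableI; apply: borel_eq; first exact: continuous_dotq.
apply: continuous_sum => m; apply: continuous_sum => c.
apply: continuous_mul; first exact: cst_continuous.
by apply: continuous_mul; exact: continuous_entry.
Qed.

Lemma measurable_half_sphere : measurable (half : set Q).
Proof.
apply: measurableI; first exact: measurable_sphere.
by apply: borel_gt0; exact: continuous_entry.
Qed.

Lemma row_sqnorm_sphere (q : quatn R n.+2) : (forall m c, colpos C c = None -> q m c = 0) ->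
  row_sqnorm q ord0 = \sum_(k < w) q (crd n.+1 C k).1 (crd n.+1 C k).2 ^+ 2.
Proof.
move=> q0; rewrite /row_sqnorm (sum_cols (C := C) w0) => [|c /q0 ->]; last by rewrite expr0n.
apply: eq_bigr => k _; rewrite /crd /= modn_small// divn_small//.
by congr (q _ _ ^+ 2); apply: val_inj; rewrite /= inordK.
Qed.

(** This is where two rows are needed: the first row then lies among the free coordinates, away from
    the dependent last one. *)
Let w_le_d : (w <= d)%N.
Proof. by rewrite -ltnS dE !mulnS; nia. Qed.

Lemma row_sqnorm_sphere_chart (x : 'rV[R]_d) :
  row_sqnorm (sphere_chart (n := n.+1) C x) ord0 = \sum_(y <- take w (seq_of_row x)) y ^+ 2.
Proof.
rewrite row_sqnorm_sphere; last exact: sphere_chart_null.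
rewrite (big_nth 0) size_take size_seq_of_row.
have -> : (if (w < d)%N then w else d) = w.
  by case: ltnP => // dw; apply/eqP; rewrite eqn_leq dw w_le_d.
rewrite big_mkord; apply: eq_bigr => k _; rewrite nth_take//.
have kd := leq_trans (ltn_ord k) w_le_d.
by have := sphere_chart_free C w0 dE x (Ordinal kd) => /= ->; rewrite (nth_seq_of_row _ (Ordinal kd)).
Qed.

(** The first w parameters are the first row and stay outside. The other d - w are integrated by
    [iter_integral_ball], each adding 1/2 to the exponent -1/2 of the density. *)
Lemma half_sphere_measure : exists2 K : R, 0 < K & forall B : set R, measurable B ->
  mu (half `&` [set q | B (row_sqnorm q ord0)]) =
  iter_integral w (fun l => (\1_B (\sum_(y <- l) y ^+ 2) * K *
    pos_powR (- 2^-1 + (d - w)%:R / 2) (2 - \sum_(y <- l) y ^+ 2))%:E).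
Proof.
have [K K0 KE] := @iter_integral_ball R (d - w) (- 2^-1) (lexx _).
exists (Num.sqrt 2 * K); first by rewrite mulr_gt0// sqrtr_gt0.
move=> B mB; pose E : set Q := [set q | B (row_sqnorm q ord0)].
pose F (l : seq R) := \1_B (\sum_(y <- take w l) y ^+ 2) *
  (Num.sqrt 2 * pos_powR (- 2^-1) (sphere_rest l)).
have mE : measurable (@sphere_chart R w n.+1 d C @` sphere_dom `&` E : set Q).
  rewrite image_sphere_chart//; apply: measurableI; first exact: measurable_half_sphere.
  by apply: borel_preimage_real => //; exact: continuous_row_sqnorm.
have FE (x : 'rV[R]_d) : sphere_dom x -> \1_E (sphere_chart (n := n.+1) C x) *
    Num.sqrt (\det (metric_tensor (sphere_chart (n := n.+1) C) x)) = F (seq_of_row x).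
  move=> Ux; rewrite sphere_density//; congr (_ * _).
  by rewrite /E -row_sqnorm_sphere_chart !indicE.
have F0 (x : 'rV[R]_d) : ~ sphere_dom x -> F (seq_of_row x) = 0.
  by move=> /negP; rewrite -leNgt => r0; rewrite /F pos_powR_le0// !mulr0.
have := volume_of_chart vol (sphere_local_param w0 dE halfM) mE FE F0.
rewrite image_sphere_chart// => ->.
rewrite -[in LHS](subnKC w_le_d) iter_integral_cat.
apply: eq_iter_integral => l lw.
transitivity (iter_integral (d - w) (fun l' => (\1_B (\sum_(y <- l) y ^+ 2) * Num.sqrt 2 *
    pos_powR (- 2^-1) (2 - \sum_(y <- l) y ^+ 2 - \sum_(y <- l') y ^+ 2))%:E)).
  apply: eq_iter_integral => l' _; rewrite /F -lw take_size_cat// mulrA.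
  by rewrite /sphere_rest big_cat/= opprD addrA.
by rewrite KE ?mulr_ge0 ?sqrtr_ge0// !mulrA.
Qed.

End sphere_measure.

(** * Coverings by finitely many isometric copies *)

Section coverings.
Context {R : realType} {n : nat}.
Variable M : set (quatn R n).

(** Being a transitive relation, it lets the copies of a chart be found in stages: an entry is made
    nonzero at the right place, then its sign is corrected. *)
Definition covered (A B : set (quatn R n)) := exists L : seq (isometry R n),
  (forall h, List.In h L -> symmetry_of M h) /\
  forall q, A q -> exists2 h, List.In h L & moves h B q.

Lemma covered_trans A B C : covered A B -> covered B C -> covered A C.
Proof.
move=> [L1 [sL1 cL1]] [L2 [sL2 cL2]].
exists (List.flat_map (fun h => List.map (comp_isometry h) L2) L1); split.
  move=> h /List.in_flat_map[h1 [h1L /List.in_map_iff[h2 [<- h2L]]]].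
  by apply: symmetry_comp; [exact: sL1|exact: sL2].
move=> q /cL1[h1 h1L q1]; have [h2 h2L q2] := cL2 _ q1.
exists (comp_isometry h1 h2); last by rewrite moves_comp.
by apply/List.in_flat_map; exists h1; split => //; exact: List.in_map.
Qed.

Lemma covered_fin (T : finType) (h : T -> isometry R n) A B :
  (forall t, symmetry_of M (h t)) -> (forall q, A q -> exists t, moves (h t) B q) ->
  covered A B.
Proof.
move=> sh ch; exists (List.map h (enum T)); split.
  by move=> g /List.in_map_iff[t [<- _]].
move=> q /ch[t qt]; exists (h t) => //; apply: List.in_map.
have : t \in enum T by rewrite mem_enum.
by elim: (enum T) => //= t' s IH; rewrite inE => /predU1P[->|/IH]; [left|right].
Qed.

Lemma one_isometryP : (1%:M : 'M[R]_n) *m (1%:M)^T = 1%:M.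
Proof. by rewrite trmx1 mulmx1. Qed.

Definition one_isometry : isometry R n := row_isometry one_isometryP.

Lemma act1 q : act one_isometry q = q.
Proof. by rewrite act_row mul1mx. Qed.

Lemma symmetry_one A : symmetry_of A one_isometry.
Proof. by move=> q; rewrite act1. Qed.

Lemma covered_bool (h : isometry R n) A B : symmetry_of M h ->
  (forall q, A q -> B q \/ moves h B q) -> covered A B.
Proof.
move=> sh ch; apply: (@covered_fin bool (fun b => if b then h else one_isometry)).
  by case=> //; exact: symmetry_one.
move=> q /ch[Bq|hq]; last by exists true.
by exists false; rewrite /moves /= -[X in B X]act1 actKV.
Qed.

End coverings.

Section special_isometries.
Context {R : realType}.

Lemma tperm_mxP k (i j : 'I_k) : (tperm_mx i j : 'M[R]_k) *m (tperm_mx i j)^T = 1%:M.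
Proof. by rewrite tr_tperm_mx -perm_mxM tperm2 perm_mx1. Qed.

Lemma opp_mxP k : (- 1%:M : 'M[R]_k) *m (- 1%:M)^T = 1%:M.
Proof. by rewrite linearN/= trmx1 mulNmx mulmxN opprK mulmx1. Qed.

Definition row_swap n (i j : 'I_n) : isometry R n := row_isometry (tperm_mxP i j).

Definition col_swap n (c c' : 'I_4) : isometry R n := col_isometry (tperm_mxP c c').

(** Made total by taking the identity when u = 0, because [null_chain] expects an isometry for every
    vector. *)
Definition row_reflection n (u : 'rV[R]_n) : isometry R n :=
  match pselect ((u *m u^T) 0 0 != 0) with
  | left hu => row_isometry (reflection_mxP hu)
  | right _ => one_isometry
  end.

Definition col_reflection n (u : 'rV[R]_4) : isometry R n :=
  match pselect ((u *m u^T) 0 0 != 0) with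
  | left hu => col_isometry (reflection_mxP hu)
  | right _ => one_isometry
  end.

Lemma norm_delta2 k (p r : 'I_k) (t : R) : p != r ->
  let u := delta_mx 0 p + t *: delta_mx 0 r : 'rV[R]_k in (u *m u^T) 0 0 != 0.
Proof.
move=> pr /=; rewrite linearD/= linearZ/= !trmx_delta mulmxDl !mulmxDr -!scalemxAl -!scalemxAr.
have rp : (r == p) = false by rewrite eq_sym (negPf pr).
rewrite !mul_delta_mx_cond !eqxx !(negPf pr) !rp !mulr0n !mulr1n !scaler0 addr0 add0r.
rewrite !mxE eqxx /= mulr1 -expr2.
by rewrite gt_eqF// ltr_pwDl// sqr_ge0.
Qed.

Lemma act_row_reflection n (u : 'rV[R]_n) (q : quatn R n) : (u *m u^T) 0 0 != 0 ->
  act (row_reflection u) q = reflection_mx u *m q.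
Proof. by move=> hu; rewrite /row_reflection; case: pselect => // hu'; rewrite act_row. Qed.

Lemma act_row_reflectionV n (u : 'rV[R]_n) (q : quatn R n) : (u *m u^T) 0 0 != 0 ->
  act (inv_isometry (row_reflection u)) q = reflection_mx u *m q.
Proof.
move=> hu; rewrite /row_reflection; case: pselect => // hu'.
by rewrite /act /= reflection_mx_sym trmx1 mulmx1.
Qed.

Lemma act_col_reflection n (u : 'rV[R]_4) (q : quatn R n) : (u *m u^T) 0 0 != 0 ->
  act (col_reflection n u) q = q *m reflection_mx u.
Proof. by move=> hu; rewrite /col_reflection; case: pselect => // hu'; rewrite act_col. Qed.

Lemma act_col_reflectionV n (u : 'rV[R]_4) (q : quatn R n) : (u *m u^T) 0 0 != 0 ->
  act (inv_isometry (col_reflection n u)) q = q *m reflection_mx u.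
Proof.
move=> hu; rewrite /col_reflection; case: pselect => // hu'.
by rewrite /act /= reflection_mx_sym trmx1 mul1mx.
Qed.

Lemma reflection_mxK k (u : 'rV[R]_k) : (u *m u^T) 0 0 != 0 ->
  reflection_mx u *m reflection_mx u = 1%:M.
Proof. by move=> hu; rewrite -{2}reflection_mx_sym reflection_mxP. Qed.

Definition antipode n : isometry R n := row_isometry (opp_mxP n).

Lemma act_row_swapV n (i j : 'I_n) q m c :
  act (inv_isometry (row_swap i j)) q m c = q (tperm i j m) c.
Proof. by rewrite /act /= tr_tperm_mx trmx1 mulmx1 -xrowE mxE. Qed.

Lemma act_col_swap n (c c' : 'I_4) (q : quatn R n) m d :
  act (col_swap n c c') q m d = q m (tperm c c' d).
Proof. by rewrite act_col -xcolE mxE. Qed.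

Lemma act_col_swapV n (c c' : 'I_4) (q : quatn R n) m d :
  act (inv_isometry (col_swap n c c')) q m d = q m (tperm c c' d).
Proof. by rewrite /act /= tr_tperm_mx trmx1 mul1mx -xcolE mxE. Qed.

Lemma act_antipode n q : act (antipode n) q = - q.
Proof. by rewrite act_row mulNmx mul1mx. Qed.

Lemma act_antipodeV n q : act (inv_isometry (antipode n)) q = - q.
Proof. by rewrite /act /= linearN/= !trmx1 mulNmx mul1mx mulmx1. Qed.

End special_isometries.

Section symmetric_volume.
Context {R : realType} {n d : nat}.
Local Notation Q := (borel (quatn R n)).
Variables (M : set (quatn R n)) (mu : {measure set Q -> \bar R}).
Hypothesis vol : is_riemannian_volume d M mu.
Variables (U : set 'rV[R]_d) (phi : 'rV[R]_d -> quatn R n).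
Hypothesis phi_param : local_param M U phi.
Hypothesis mV : measurable (phi @` U : set Q).
Hypothesis V_lty : (mu (phi @` U) < +oo)%E.
Hypothesis mM : measurable (M : set Q).
Hypothesis MV : covered M M (phi @` U).

Lemma covered_measure_lty : (mu M < +oo)%E.
Proof.
have [L [sL cL]] := MV.
by have [] := measure_moves_cover vol phi_param mV V_lty sL mM cL.
Qed.

Lemma covered_measure_moves s A : symmetry_of M s -> measurable (A : set Q) ->
  A `<=` M -> mu (moves s A) = mu A.
Proof.
move=> sM mA AM; have [L [sL cL]] := MV.
have cA q : A q -> exists2 h, List.In h L & moves h (phi @` U) q by move=> /AM/cL.
by have [_ ->] := measure_moves_cover vol phi_param mV V_lty sL mA cA.
Qed.

Lemma measure_row_swap (i j : 'I_n) (B : set R) : measurable B ->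
  symmetry_of M (row_swap i j) ->
  mu (M `&` [set q | B (row_sqnorm q i)]) = mu (M `&` [set q | B (row_sqnorm q j)]).
Proof.
move=> mB sM; pose E k : set Q := [set q | B (row_sqnorm q k)].
have mE k : measurable (M `&` E k : set Q).
  apply: measurableI => //; apply: borel_preimage_real => //.
  exact: continuous_row_sqnorm.
have <- : moves (row_swap i j) (M `&` E j) = M `&` E i.
  rewrite movesI (moves_symmetry sM); congr (_ `&` _).
  have e q : row_sqnorm (act (inv_isometry (row_swap i j)) q) j = row_sqnorm q i.
    by apply: eq_bigr => c _; rewrite act_row_swapV tpermR.
  by apply/seteqP; split => q; rewrite /moves /E /= e.
by apply: covered_measure_moves => // q [].
Qed.

End symmetric_volume.

Section sphere_symmetry.
Context {R : realType} {w n d : nat} (C : columns w).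
Hypothesis w0 : (0 < w)%N.
Hypothesis dE : (d.+1 = w * n.+2)%N.
Local Notation Q := (borel (quatn R n.+2)).
Variables (M : set (quatn R n.+2)) (mu : {measure set Q -> \bar R}).
Hypothesis vol : is_riemannian_volume d M mu.
Hypothesis mM : measurable (M : set Q).
Local Notation S := (@sphere R n.+2 w C).
Local Notation half := (@half_sphere R w n.+1 d C).
Hypothesis sphereM : S `<=` M.
Hypothesis rowM : forall A (hA : A *m A^T = 1%:M), symmetry_of M (row_isometry hA).
Hypothesis colM : forall c c', colpos C c != None -> colpos C c' != None ->
  symmetry_of M (col_swap n.+2 c c').
Hypothesis reflM : forall (u : 'rV[R]_4), (u *m u^T) 0 0 != 0 ->
  (forall c, colpos C c = None -> u 0 c = 0) -> symmetry_of M (col_reflection n.+2 u).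
Hypothesis coverM : covered M M S.

Let p := (sphere_last (n := n.+1) (d := d) C).1.
Let c0 := (sphere_last (n := n.+1) (d := d) C).2.

Let c0_used : colpos C c0 != None.
Proof. by rewrite /c0 /= colsK// ltn_mod. Qed.

Let halfM : half `<=` M.
Proof. by move=> q [/sphereM]. Qed.

Lemma symmetry_sphere_row A (hA : A *m A^T = 1%:M) : symmetry_of S (row_isometry hA).
Proof.
have sub B (hB : B *m B^T = 1%:M) q : S q -> S (act (row_isometry hB) q).
  move=> [q2 q0]; split; first by rewrite /= dotq_act.
  move=> m c mc; rewrite act_row mxE big1// => k _.
  by rewrite q0// mulr0.
move=> q; split; first exact: sub.
have hB : A^T *m A^T^T = 1%:M by rewrite trmxK; exact: mulmx1C.
by move=> /(sub _ hB); rewrite !act_row mulmxA (mulmx1C hA) mul1mx.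
Qed.

(** A point of the sphere has some nonzero entry in a used column. A row swap and a column swap
    bring it to the last place, and the antipode makes it positive. *)
Lemma covered_half : covered M M half.
Proof.
apply: covered_trans coverM _.
pose N := S `&` [set q | q p c0 != 0].
apply: (@covered_trans _ _ _ _ N).
  apply: (@covered_fin _ _ _ ('I_n.+2 * {c : 'I_4 | colpos C c != None})%type
    (fun t => comp_isometry (row_swap t.1 p) (col_swap n.+2 (val t.2) c0))).
    move=> [m [c cC]]; apply: symmetry_comp; first exact: rowM.
    exact: colM.
  move=> q [q2 q0].
  have [[m c] /= mc0] : exists mc : 'I_n.+2 * 'I_4, q mc.1 mc.2 != 0.
    apply/existsP; apply: contraT; rewrite negb_exists => /forallP qz.
    move: q2; rewrite /= /dotq big1 => [|m _]; last first.
      by apply: big1 => c _; have := qz (m, c); rewrite negbK => /eqP ->; rewrite mul0r.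
    by move/esym/eqP; rewrite pnatr_eq0.
  have cC : colpos C c != None by apply: contra mc0 => /eqP/q0 ->.
  exists (m, exist _ c cC); rewrite moves_comp /moves /=.
  split; last by rewrite /= act_col_swapV act_row_swapV !tpermR.
  split; first by rewrite /= !dotq_act.
  move=> m' c'; rewrite act_col_swapV act_row_swapV => c'N; apply: q0.
  rewrite tpermD//; first by apply: contraNneq cC => ->; apply/eqP.
  by apply: contraNneq c0_used => ->; apply/eqP.
apply: (@covered_bool _ _ _ (antipode n.+2)); first exact: rowM.
move=> q [Sq /=]; rewrite neq_lt => /orP[q0|q0]; last by left.
right; split; last by rewrite /= act_antipodeV mxE oppr_gt0.
by apply/(symmetry_sphere_row (opp_mxP n.+2)); rewrite actKV.
Qed.

Lemma symmetry_sphere_refl (u : 'rV[R]_4) : (u *m u^T) 0 0 != 0 ->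
  (forall c, colpos C c = None -> u 0 c = 0) -> symmetry_of S (col_reflection n.+2 u).
Proof.
move=> hu u0.
have sub q : S q -> S (act (col_reflection n.+2 u) q).
  move=> [q2 q0]; split; first by rewrite /= dotq_act.
  move=> m c mc; rewrite act_col_reflection// /reflection_mx mulmxBr mulmx1 -scalemxAr mulmxA.
  have e : (q *m u^T *m u) m c = 0 by rewrite mxE big1// => j _; rewrite ord1 u0// mulr0.
  by rewrite mxE q0// add0r mxE mxE e mulr0 oppr0.
move=> q; split; first exact: sub.
by move=> /sub; rewrite !act_col_reflection// -mulmxA reflection_mxK// mulmx1.
Qed.

Lemma half_lty : (mu half < +oo)%E.
Proof.
have [K K0 KE] := half_sphere_measure w0 dE vol sphereM.
have := KE setT measurableT; rewrite (_ : half `&` _ = half); last first.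
  by apply/seteqP; split => q // [].
move=> ->.
have e2 : - 2^-1 <= - 2^-1 + (d - w)%:R / 2 :> R by rewrite lerDl divr_ge0.
have [K' K'0 K'E] := @iter_integral_ball R w _ e2.
rewrite (_ : iter_integral _ _ = (K * (K' * pos_powR (- 2^-1 + (d - w)%:R / 2 + w%:R / 2) 2))%:E).
  by rewrite ltry.
rewrite -K'E ?ltW//; apply: eq_iter_integral => l _.
by rewrite indicT mul1r.
Qed.

Let mhalf : measurable (half : set Q).
Proof. exact: measurable_half_sphere. Qed.

Lemma sphere_measure_moves s A : symmetry_of M s -> measurable (A : set Q) -> A `<=` M ->
  mu (moves s A) = mu A.
Proof.
apply: (covered_measure_moves vol (sphere_local_param w0 dE halfM)).
- by rewrite image_sphere_chart.
- by rewrite image_sphere_chart//; exact: half_lty.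
- by rewrite image_sphere_chart//; exact: covered_half.
Qed.

Lemma sphere_model_lty : (mu M < +oo)%E.
Proof.
apply: (covered_measure_lty vol (sphere_local_param w0 dE halfM)) => //.
- by rewrite image_sphere_chart.
- by rewrite image_sphere_chart//; exact: half_lty.
- by rewrite image_sphere_chart//; exact: covered_half.
Qed.

Let mS : measurable (S : set Q).
Proof. exact: measurable_sphere. Qed.

(** [null_chain] is used twice. Not all used columns vanish on the sphere, so reflections of columns
    show that the vanishing of the whole column c0 is a null event; reflections of rows then reduce
    it to the single entry in row p. *)
Lemma sphere_equator_null : mu (S `&` [set q | q p c0 = 0]) = 0%E.
Proof.
have used_col : mu (S `&` [set q | row c0 q^T = 0]) = 0%E.
  apply: (@null_chain R n.+2 M mu mM sphere_model_lty sphere_measure_moves 4 n.+2 (fun q => q^T)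
    (fun u => col_reflection n.+2 u) (fun c => colpos C c != None) S) => //.
  - by move=> i j; under eq_fun do rewrite mxE; exact: continuous_entry.
  - move=> c c' t cC c'C cc' u.
    have u0 : (u *m u^T) 0 0 != 0 by exact: norm_delta2.
    have uC c'' : colpos C c'' = None -> u 0 c'' = 0.
      move=> c''N; rewrite !mxE eqxx /=.
      have -> : (c'' == c) = false by apply: contraNF cC => /eqP <-; apply/eqP.
      have -> : (c'' == c') = false by apply: contraNF c'C => /eqP <-; apply/eqP.
      by rewrite mulr0 addr0.
    split; [exact: reflM|exact: symmetry_sphere_refl|].
    by move=> q; rewrite act_col_reflectionV// trmx_mul reflection_mx_sym.
  - rewrite (_ : _ `&` _ = set0) ?measure0// -subset0 => q [[q2 q0] qz].
    move: q2; rewrite /= /dotq big1 => [/esym/eqP|m _]; first by rewrite pnatr_eq0.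
    apply: big1 => c _; case: (eqVneq (colpos C c) None) => [cN|cC].
      by rewrite q0// mul0r.
    by have /rowP/(_ m) := qz c cC; rewrite !mxE => ->; rewrite mul0r.
have := @null_chain R n.+2 M mu mM sphere_model_lty sphere_measure_moves n.+2 1 (fun q => col c0 q)
    (fun u => row_reflection u) xpredT S mS sphereM.
move=> /(_ _ _ _ p isT) e.
transitivity (mu (S `&` [set q | row p (col c0 q) = 0])).
  congr (mu (_ `&` _)); apply/seteqP; split => q /= => [q0|/rowP/(_ 0)]; last by rewrite !mxE.
  by apply/rowP => j; rewrite !mxE.
apply: e.
- by move=> i j; under eq_fun do rewrite mxE; exact: continuous_entry.
- move=> r r' t _ _ rr' u.
  have u0 : (u *m u^T) 0 0 != 0 by exact: norm_delta2.
  have rowS A : symmetry_of A (row_isometry (reflection_mxP u0)) -> symmetry_of A (row_reflection u).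
    by move=> sA q; rewrite act_row_reflection// (sA q) act_row.
  split; [exact/rowS/rowM|exact/rowS/symmetry_sphere_row|].
  by move=> q; rewrite act_row_reflectionV// !colE mulmxA.
- rewrite -used_col; congr (mu (_ `&` _)); apply/seteqP; split => q /= qz.
    apply/rowP => m; rewrite !mxE.
    by have /rowP/(_ 0) := qz m isT; rewrite !mxE.
  move=> m _; apply/rowP => j; rewrite !mxE.
  by have /rowP/(_ m) := qz; rewrite !mxE.
Qed.

Lemma measure_sphere_half (E : set Q) : measurable E -> symmetry_of E (antipode n.+2) ->
  (mu (S `&` E) = 2%:E * mu (half `&` E))%E.
Proof.
move=> mE sE; apply: (measure_halves sphere_measure_moves (s := antipode n.+2)) => //.
- exact: rowM.
- by move=> q [].
- move=> q [Sq _]; apply/(symmetry_sphere_row (opp_mxP n.+2)).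
  by move: Sq; rewrite /moves /= => Sq; move: (Sq); rewrite -(symmetry_inv (symmetry_sphere_row (opp_mxP n.+2)) q) (symmetry_sphere_row (opp_mxP n.+2) q).
- rewrite -subset0 => q [[_ /= q0] [_ /=]]; rewrite act_antipodeV mxE oppr_gt0 => q1.
  by have := lt_trans q0 q1; rewrite ltxx.
- apply: (subset_measure0 _ _ _ sphere_equator_null).
  + apply: measurableD => //; apply: measurableU => //.
    by apply: borel_preimage => //; exact: continuous_act.
  + by apply: measurableI => //; apply: borel_eq; exact: continuous_entry.
  + move=> q [Sq nq]; split => //=; apply: contrapT => /eqP; rewrite neq_lt => /orP[q0|q0].
      apply: nq; right; split; last by rewrite /= act_antipodeV mxE oppr_gt0.
      by apply/(symmetry_sphere_row (opp_mxP n.+2)); rewrite actKV.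
    by apply: nq; left.
Qed.

End sphere_symmetry.

(** * Densities of the edge lengths *)

Section densities.
Context {R : realType}.
Local Notation leb := (@lebesgue_measure R).
Local Notation ray0 := (`[0%R, +oo[%classic : set R).

Lemma integral_deriv_poly (P : {poly R}) (a b : R) : a < b ->
  (\int[leb]_(x in `[a, b]) ((P^`()).[x])%:E = (P.[b] - P.[a])%:E)%E.
Proof.
move=> ab; rewrite (@continuous_FTC2 _ _ (horner P))// ?EFinB//.
- by apply: continuous_subspaceT => x; exact: continuous_horner.
- split.
  + by move=> x _; exact: derivable_horner.
  + by apply: cvg_at_right_filter; exact: continuous_horner.
  + by apply: cvg_at_left_filter; exact: continuous_horner.
- by move=> x _; rewrite -derivE.
Qed.

Lemma deriv_CsubX_exp (r : R) k :
  ((r%:P - 'X) ^+ k.+1)^`() = - (k.+1%:R *: (r%:P - 'X) ^+ k).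
Proof. by rewrite deriv_exp derivB derivC derivX sub0r mulN1r mulNrn scaler_nat. Qed.

Lemma integral_density_y (r : R) (m : nat) : 0 < r ->
  (\int[leb]_(y in `[0%R, r])
     (m.+1%:R * m.+2%:R / r ^+ m.+2 * y * (r - y) ^+ m)%:E = 1)%E.
Proof.
move=> r0.
(* The antiderivative found by integration by parts, scaled so that P(r) = 0 and P(0) = -1. *)
pose P : {poly R} := (- (r ^+ m.+2)^-1) *:
  (m.+2%:R *: ('X * (r%:P - 'X) ^+ m.+1) + (r%:P - 'X) ^+ m.+2).
have PE y : (P^`()).[y] = m.+1%:R * m.+2%:R / r ^+ m.+2 * y * (r - y) ^+ m.
  rewrite /P derivZ derivD derivZ derivM !deriv_CsubX_exp derivX.
  rewrite !hornerE; set c := (r ^+ m.+2)^-1; rewrite [(r - y) ^+ m.+1]exprS.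
  by move: ((r - y) ^+ m) => s; ring.
under eq_integral do rewrite -PE.
rewrite integral_deriv_poly// /P !hornerE subrr subr0 !expr0n/=.
have rm : r ^+ m.+2 != 0 by rewrite expf_neq0// gt_eqF.
by congr (_%:E); move: (r ^+ m.+2) (r ^+ m.+1) rm => s s' s0; field.
Qed.

Lemma integral_density_1 (r : R) (m : nat) : 0 < r ->
  (\int[leb]_(y in `[0%R, r]) (m.+1%:R / r ^+ m.+1 * (r - y) ^+ m)%:E = 1)%E.
Proof.
move=> r0.
pose P : {poly R} := (- (r ^+ m.+1)^-1) *: (r%:P - 'X) ^+ m.+1.
have PE y : (P^`()).[y] = m.+1%:R / r ^+ m.+1 * (r - y) ^+ m.
  rewrite /P derivZ deriv_CsubX_exp.
  rewrite !hornerE; set c := (r ^+ m.+1)^-1.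
  by move: ((r - y) ^+ m) => s; ring.
under eq_integral do rewrite -PE.
rewrite integral_deriv_poly// /P !hornerE subrr subr0 !expr0n/=.
have rm : r ^+ m.+1 != 0 by rewrite expf_neq0// gt_eqF.
by congr (_%:E); move: (r ^+ m.+1) rm => s s0; field.
Qed.

(** The exponent may be a half-integer, and for triangles it is -1/2, singular at y = 1; so the
    integral is reduced to [integral_powR] by y -> 1 - y. The endpoint 1, where the two integrands
    may differ, is removed first. *)
Lemma integral_density_powR (p : R) : 0 < p ->
  (\int[leb]_(y in `[0%R, 1%R]) (p * (1 - y) `^ (p - 1))%:E = 1)%E.
Proof.
move=> p0.
pose f (x : R) : \bar R := (\1_(`]0, 1]%classic) x * (p * x `^ (p - 1)))%:E.
have mf : measurable_fun setT f.
  apply/measurable_EFinP; apply: measurable_funM; first exact: measurable_indic.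
  by apply: measurable_funM => //; exact: measurable_powR.
have f0 x : (0 <= f x)%E by rewrite lee_fin !mulr_ge0// ?powR_ge0// ltW.
have mfD : measurable_fun setT (fun x : R => f (1 + x)).
  by apply: measurableT_comp => //; exact: measurable_funD.
have fE : (\int[leb]_x f x = 1)%E.
  rewrite -[RHS]/(1%:E) -(mulfV (lt0r_neq0 p0)) EFinM -(integral_powR p0).
  rewrite -ge0_integralZl_EFin// ?ltW//; last 2 first.
  - by move=> x _; rewrite lee_fin powR_ge0.
  - by apply/measurable_EFinP; apply: measurable_funTS; exact: measurable_powR.
  rewrite [RHS]integral_mkcond; apply: eq_integral => x _.
  by rewrite /f patchE indicE; case: ifPn => _; rewrite ?mul1r ?mul0r ?EFinM.
have fD : (\int[leb]_x f (1 + x)%R = 1)%E.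
  have := @integral_affine R 1 1 f ltr01 mf f0; rewrite invr1 mul1e fE => <-.
  by apply: eq_integral => x _; rewrite mul1r addrC.
have fB : (\int[leb]_x f (1 - x)%R = 1)%E by rewrite -[RHS]fD -[RHS]integral_oppr.
have mI : measurable ((`[0%R, 1%R] : set R) `\ (1 : R)).
  by apply: measurableD => //; exact: measurable_itv.
rewrite -(@integral_setD1 R _ 1)//; last first.
  apply/measurable_EFinP; apply: measurable_funTS; apply: measurable_funM => //.
  have mB : measurable_fun setT (fun y : R => 1 - y) by exact: measurable_funB.
  exact: (measurableT_comp (@measurable_powR R _) mB).
rewrite -[RHS]fB integral_mkcond; apply: eq_integral => y _; rewrite patchE /f indicE.
have -> : (y \in (`[0%R, 1%R]%classic : set R) `\ (1 : R)) = (1 - y \in (`]0, 1]%classic : set R)).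
  apply/idP/idP => [/set_mem[]|/set_mem] /=; rewrite in_itv/= => /andP[y0 y1].
    move=> yn1; apply/mem_set; rewrite /= in_itv/= subr_gt0 lt_neqAle y1 andbT.
    by apply/andP; split; [exact/eqP|lra].
  apply/mem_set; split; rewrite /= ?in_itv/=; first by apply/andP; split; lra.
  by move=> ye; rewrite ye subrr ltxx in y0.
by case: ifPn => _; rewrite ?mul1r ?mul0r.
Qed.

(** F vanishes from r on, but h need not vanish at r itself, for instance when it is a zeroth power;
    that single point is discarded. *)
Lemma integral_on_ray (r : R) (B : set R) (h F : R -> R) : measurable B ->
  measurable_fun setT h ->
  (forall t, 0 <= t -> t < r -> F t = \1_B t * h t) ->
  (forall t, r <= t -> F t = 0) ->
  (\int[leb]_(t in ray0) (F t)%:E = \int[leb]_(t in `[0%R, r] `&` B) (h t)%:E)%E.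
Proof.
move=> mB mh Flt Fge.
have mD : measurable ((`[0%R, r] `&` B : set R) `\ r).
  by apply: measurableD => //; apply: measurableI => //; exact: measurable_itv.
rewrite -[RHS](@integral_setD1 R _ r)//; last first.
  by apply/measurable_EFinP; exact: measurable_funTS mh.
rewrite [LHS]integral_mkcond [RHS]integral_mkcond; apply: eq_integral => t _; rewrite !patchE.
have [t0|t0] := leP 0 t; last first.
  rewrite ifF; last by apply/memNset; rewrite /= in_itv/= andbT leNgt t0.
  by rewrite ifF//; apply/memNset => -[[/= + _] _]; rewrite in_itv/= leNgt t0.
rewrite ifT; last by apply/mem_set; rewrite /= in_itv/= t0.
have [tr|rt] := ltP t r.
  rewrite Flt// indicE; case: (boolP (t \in B)) => tB.
    rewrite ifT ?mul1r//; apply/mem_set; split; last by move=> te; rewrite te ltxx in tr.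
    by split; [rewrite /= in_itv/= t0 ltW|exact: set_mem].
  by rewrite ifF ?mul0r//; apply/memNset => -[[_ /mem_set]]; rewrite (negPf tB).
rewrite Fge// ifF//; apply/memNset => -[[/= + _] +]; rewrite in_itv/= => /andP[_ tr].
by apply; apply/eqP; rewrite eq_le tr rt.
Qed.

Lemma integral_sqr_norm4_density (s : R) : exists2 C : R, 0 < C &
  forall (B : set R) K r, measurable B -> 0 < K ->
  iter_integral 4 (fun l => (\1_B (\sum_(y <- l) y ^+ 2) * K *
    pos_powR s (r - \sum_(y <- l) y ^+ 2))%:E) =
  (\int[leb]_(t in `[0%R, r] `&` B) (C * K * (t * (r - t) `^ s))%:E)%E.
Proof.
have [C C0 CE] := @integral_sqr_norm4 R; exists C => // B K r mB K0.
pose g t := \1_B t * K * pos_powR s (r - t).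
have mBr : measurable_fun setT (fun t : R => r - t) by exact: measurable_funB.
have mg : measurable_fun setT g.
  apply: measurable_funM; last exact: (measurableT_comp (measurable_pos_powR s) mBr).
  by apply: measurable_funM => //; exact: measurable_indic.
have g0 t : 0 <= g t by rewrite !mulr_ge0 ?pos_powR_ge0// ltW.
transitivity (\int[leb]_x1 \int[leb]_x2 \int[leb]_y1 \int[leb]_y2
       (g (x1 ^+ 2 + x2 ^+ 2 + (y1 ^+ 2 + y2 ^+ 2))%R)%:E)%E.
  rewrite /=; do 4! apply: eq_integral => ? _.
  by rewrite /g !big_cons big_nil addr0 !addrA.
rewrite CE// -ge0_integralZl_EFin ?ltW//; last 2 first.
- by move=> t /=; rewrite in_itv/= andbT => t0; rewrite lee_fin mulr_ge0.
- by apply/measurable_EFinP; apply: measurable_funTS; apply: measurable_funM.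
under eq_integral do rewrite -EFinM.
apply: integral_on_ray => //.
- apply: measurable_funM => //; apply: measurable_funM => //.
  exact: (measurableT_comp (@measurable_powR R _) mBr).
- by move=> t t0 tr; rewrite /g pos_powR_gt0 ?subr_gt0//; ring.
- by move=> t rt; rewrite /g pos_powR_le0 ?subr_le0// !mulr0.
Qed.

Lemma integral_sqr_norm2_density (s : R) : exists2 C : R, 0 < C &
  forall (B : set R) K r, measurable B -> 0 < K ->
  iter_integral 2 (fun l => (\1_B (\sum_(y <- l) y ^+ 2) * K *
    pos_powR s (r - \sum_(y <- l) y ^+ 2))%:E) =
  (\int[leb]_(t in `[0%R, r] `&` B) (C * K * (r - t) `^ s)%:E)%E.
Proof.
have [C C0 CE] := @integral_sqr_norm2 R; exists C => // B K r mB K0.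
pose g t := \1_B t * K * pos_powR s (r - t).
have mBr : measurable_fun setT (fun t : R => r - t) by exact: measurable_funB.
have mg : measurable_fun setT g.
  apply: measurable_funM; last exact: (measurableT_comp (measurable_pos_powR s) mBr).
  by apply: measurable_funM => //; exact: measurable_indic.
have g0 t : 0 <= g t by rewrite !mulr_ge0 ?pos_powR_ge0// ltW.
transitivity (\int[leb]_x \int[leb]_y (g (x ^+ 2 + y ^+ 2)%R)%:E)%E.
  rewrite /=; do 2! apply: eq_integral => ? _.
  by rewrite /g !big_cons big_nil addr0.
rewrite (CE (EFin \o g)); last 2 first.
- exact/measurable_EFinP.
- by move=> t; rewrite lee_fin.
rewrite -ge0_integralZl_EFin ?ltW//; last 2 first.
- by move=> t _; rewrite lee_fin.
- by apply/measurable_EFinP; exact: measurable_funTS.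
under eq_integral do rewrite -EFinM.
apply: integral_on_ray => //.
- apply: measurable_funM => //.
  exact: (measurableT_comp (@measurable_powR R _) mBr).
- by move=> t t0 tr; rewrite /g pos_powR_gt0 ?subr_gt0//; ring.
- by move=> t rt; rewrite /g pos_powR_le0 ?subr_le0// !mulr0.
Qed.

End densities.

(** * The Hopf map in coordinates and preimages of edge events *)

Section hopf.
Context {R : realType}.

Lemma Hopf1E (q : quat R) : Hopf1 q = mkquat 0
  (q 0 0 ^+ 2 + q 0 1 ^+ 2 - q 0 2 ^+ 2 - q 0 3 ^+ 2)
  (2 * (q 0 1 * q 0 2 - q 0 0 * q 0 3)) (2 * (q 0 0 * q 0 2 + q 0 1 * q 0 3)).
Proof.
apply/rowP => c; rewrite /Hopf1 /mulq /conjq /quat_i /mkquat !mxE /=.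
by case: c => [[|[|[|[|//]]]] cc] /=; ring.
Qed.

Lemma HopfE n (q : quatn R n) m :
  [/\ Hopf q m 0 = 0,
      Hopf q m 1 = q m 0 ^+ 2 + q m 1 ^+ 2 - q m 2 ^+ 2 - q m 3 ^+ 2,
      Hopf q m 2 = 2 * (q m 1 * q m 2 - q m 0 * q m 3) &
      Hopf q m 3 = 2 * (q m 0 * q m 2 + q m 1 * q m 3)].
Proof. by split; rewrite /Hopf mxE Hopf1E !mxE. Qed.

Lemma row_sqnormE n (q : quatn R n) m :
  row_sqnorm q m = q m 0 ^+ 2 + q m 1 ^+ 2 + q m 2 ^+ 2 + q m 3 ^+ 2.
Proof.
rewrite /row_sqnorm !big_ord_recl big_ord0 addr0 !addrA.
by congr (q m _ ^+ 2 + q m _ ^+ 2 + q m _ ^+ 2 + q m _ ^+ 2); apply: val_inj.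
Qed.

Lemma dotq_row_sqnorm n (q : quatn R n) : dotq q q = \sum_m row_sqnorm q m.
Proof. by apply: eq_bigr => m _; apply: eq_bigr => c _; rewrite expr2. Qed.

(** The modulus is multiplicative, so conj(q) i q has modulus |q|^2; in coordinates this is a
    polynomial identity between squares. *)
Lemma row_sqnorm_Hopf n (q : quatn R n) m :
  Num.sqrt (Hopf q m 1 ^+ 2 + Hopf q m 2 ^+ 2 + Hopf q m 3 ^+ 2) = row_sqnorm q m.
Proof.
have [_ -> -> ->] := HopfE q m; rewrite row_sqnormE.
set s := (X in _ = X).
have s0 : 0 <= s by rewrite !addr_ge0 ?sqr_ge0.
rewrite -[RHS]ger0_norm// -sqrtr_sqr; congr Num.sqrt; rewrite /s; ring.
Qed.

End hopf.

Section assembly.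
Context {R : realType} {n d dim : nat}.
Local Notation leb := (@lebesgue_measure R).
Local Notation Q := (borel (quatn R n)).

(** The preimage W B has to agree with the event on the squared norm only inside M, since the
    complement of M is null. As f has integral 1, the unknown constant K is the total mass, which
    normalization divides out. *)
Lemma has_density_of_volume (M : set (quatn R n)) (embed : 'M[R]_(n, d) -> quatn R n)
    (P : set 'M[R]_(n, d) -> \bar R) (S : set 'M[R]_(n, d)) (X : 'M[R]_(n, d) -> R)
    (r : R) (f : R -> R) (W : set R -> set (quatn R n)) (i : 'I_n) :
  is_symmetric_measure dim M embed P ->
  measurable (M : set Q) ->
  (forall B, @Hopf R n @^-1` (embed @` (S `&` X @^-1` B)) = W B) ->
  (forall B, measurable B -> measurable (W B : set Q)) ->
  (forall B q, M q -> (W B q <-> B (row_sqnorm q i))) ->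
  measurable_fun setT f ->
  (forall y, 0 <= y -> y <= r -> 0 <= f y) ->
  (\int[leb]_(y in `[0%R, r]) (f y)%:E = 1)%E ->
  (forall mu, is_riemannian_volume dim M mu -> exists2 K : R, 0 < K &
    forall B, measurable B -> mu (M `&` [set q | B (row_sqnorm q i)]) =
      (K%:E * \int[leb]_(y in `[0%R, r] `&` B) (f y)%:E)%E) ->
  has_density P S X `[0, r] f.
Proof.
move=> [mu vol PE] mM WE mW WM mf f0 f1 volE.
have [K K0 muE] := volE mu vol.
have [mu0 _] := vol.
have muM (A : set Q) : measurable A -> mu A = mu (A `&` M).
  move=> mA; rewrite -[in LHS](setUIDK A M) measureU0//; first exact: measurableI.
    exact: measurableD.
  apply: (subset_measure0 _ _ _ mu0); [exact: measurableD|exact: measurableC|].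
  by move=> q [].
have muT : mu setT = K%:E.
  rewrite muM// setTI -[M]setIT -[setT](_ : [set q | setT (row_sqnorm q i)] = setT)//.
  by rewrite muE// setIT f1 mule1.
split.
- exact: measurable_funTS.
- by move=> y /=; rewrite in_itv/= => /andP[]; exact: f0.
move=> B mB; rewrite PE /pushforward.
(* The mass K is neither 0 nor infinite, so [mnormalize] does not fall back to its Dirac default. *)
transitivity (mu (W B) * (fine (mu setT))^-1%:E)%E.
  rewrite -WE /mnormalize muT /= ifF//.
  by rewrite eqe gt_eqF.
rewrite muM; last exact: mW.
have -> : W B `&` M = M `&` [set q | B (row_sqnorm q i)].
  by apply/seteqP; split => q [] qx qy; split => //; apply/(WM B).
rewrite muE// muT /= muleC muleA -EFinM mulVf ?mul1e//.
by rewrite gt_eqF.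
Qed.

End assembly.

Section edge_lists.
Context {R : realType} {n : nat}.
Implicit Types (q : quatn R n) (i : 'I_n).
Local Notation Q := (borel (quatn R n)).

Lemma embed3E (e : 'M[R]_(n, 3)) m :
  [/\ embed3 e m 0 = 0, embed3 e m 1 = e m 0, embed3 e m 2 = e m 1 & embed3 e m 3 = e m 2].
Proof. by split; rewrite [LHS]mxE /mkquat [LHS]mxE. Qed.

Lemma embed2E (e : 'M[R]_(n, 2)) m :
  [/\ embed2 e m 0 = 0, embed2 e m 1 = e m 0, embed2 e m 2 = 0 & embed2 e m 3 = e m 1].
Proof. by split; rewrite [LHS]mxE /mkquat [LHS]mxE. Qed.

Lemma forall_I4 (P : 'I_4 -> Prop) : P 0 -> P 1 -> P 2 -> P 3 -> forall c, P c.
Proof.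
move=> P0 P1 P2 P3 [[|[|[|[|//]]]] c4].
- by rewrite (_ : Ordinal c4 = 0)//; apply: val_inj.
- by rewrite (_ : Ordinal c4 = 1)//; apply: val_inj.
- by rewrite (_ : Ordinal c4 = 2)//; apply: val_inj.
- by rewrite (_ : Ordinal c4 = 3)//; apply: val_inj.
Qed.

Lemma edge_length_Hopf3 q (e : 'M[R]_(n, 3)) m : embed3 e = Hopf q ->
  edge_length e m = row_sqnorm q m.
Proof.
move=> eq_e; rewrite /edge_length -row_sqnorm_Hopf -eq_e.
have [_ -> -> ->] := embed3E e m; rewrite !big_ord_recl big_ord0 addr0 addrA.
by congr (Num.sqrt (e m _ ^+ 2 + e m _ ^+ 2 + e m _ ^+ 2)); apply: val_inj.
Qed.

Lemma edge_length_Hopf2 q (e : 'M[R]_(n, 2)) m : embed2 e = Hopf q ->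
  edge_length e m = row_sqnorm q m.
Proof.
move=> eq_e; rewrite /edge_length -row_sqnorm_Hopf -eq_e.
have [_ -> -> ->] := embed2E e m; rewrite !big_ord_recl big_ord0 addr0 expr0n addr0.
by congr (Num.sqrt (e m _ ^+ 2 + e m _ ^+ 2)); apply: val_inj.
Qed.

Definition edges3 q : 'M[R]_(n, 3) :=
  \matrix_(m, c) [:: Hopf q m 1; Hopf q m 2; Hopf q m 3]`_c.

Lemma embed3_edges q : embed3 (edges3 q) = Hopf q.
Proof.
apply/matrixP => m; have [H0 _ _ _] := HopfE q m.
have [e0 e1 e2 e3] := embed3E (edges3 q) m.
by apply: forall_I4; rewrite ?e0 ?e1 ?e2 ?e3 ?H0// [LHS]mxE.
Qed.

Definition edges2 q : 'M[R]_(n, 2) := \matrix_(m, c) [:: Hopf q m 1; Hopf q m 3]`_c.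

Lemma embed2_edges q : (forall m, Hopf q m 2 = 0) -> embed2 (edges2 q) = Hopf q.
Proof.
move=> H2; apply/matrixP => m; have [H0 _ _ _] := HopfE q m.
have [e0 e1 e2 e3] := embed2E (edges2 q) m.
by apply: forall_I4; rewrite ?e0 ?e1 ?e2 ?e3 ?H0 ?H2// [LHS]mxE.
Qed.

Lemma Hopf_preimage_Arm3 i B :
  @Hopf R n @^-1` (@embed3 R n @` (@Arm R 3 n `&` (fun e => edge_length e i) @^-1` B)) =
  [set q | dotq q q = 2] `&` [set q | B (row_sqnorm q i)].
Proof.
apply/seteqP; split => q.
  move=> [e [eA eB] eq_e]; rewrite /= in eB *; rewrite -(edge_length_Hopf3 _ eq_e).
  split => //; rewrite dotq_row_sqnorm -eA.
  by apply: eq_bigr => m _; rewrite (edge_length_Hopf3 _ eq_e).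
move=> [q2 qB]; exists (edges3 q); last exact: embed3_edges.
split; last by rewrite /= (edge_length_Hopf3 _ (embed3_edges q)).
rewrite /Arm /= -q2 dotq_row_sqnorm.
by apply: eq_bigr => m _; rewrite (edge_length_Hopf3 _ (embed3_edges q)).
Qed.

(** This preimage is larger than the model space: each row may carry its own complex phase. The
    excess is harmless because the volume is carried by the model. *)
Lemma Hopf_preimage_Arm2 i B :
  @Hopf R n @^-1` (@embed2 R n @` (@Arm R 2 n `&` (fun e => edge_length e i) @^-1` B)) =
  [set q | dotq q q = 2] `&` [set q | forall m, Hopf q m 2 = 0] `&`
    [set q | B (row_sqnorm q i)].
Proof.
apply/seteqP; split => q.
  move=> [e [eA eB] eq_e]; rewrite /= in eB *; rewrite -(edge_length_Hopf2 _ eq_e).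
  split => //; split; last by move=> m; rewrite -eq_e; have [_ _ -> _] := embed2E e m.
  by rewrite dotq_row_sqnorm -eA; apply: eq_bigr => m _; rewrite (edge_length_Hopf2 _ eq_e).
move=> [[q2 H2] qB]; exists (edges2 q); last exact: embed2_edges.
split; last by rewrite /= (edge_length_Hopf2 _ (embed2_edges H2)).
rewrite /Arm /= -q2 dotq_row_sqnorm.
by apply: eq_bigr => m _; rewrite (edge_length_Hopf2 _ (embed2_edges H2)).
Qed.

Definition Hopf_closed : set (quatn R n) := [set q | forall c, \sum_m Hopf q m c = 0].

Lemma Hopf_preimage_Pol3 i B :
  @Hopf R n @^-1` (@embed3 R n @` (@Pol R 3 n `&` (fun e => edge_length e i) @^-1` B)) =
  [set q | dotq q q = 2] `&` Hopf_closed `&` [set q | B (row_sqnorm q i)].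
Proof.
apply/seteqP; split => q.
  move=> [e [[eA e0] eB] eq_e].
  have : ([set q | dotq q q = 2] `&` [set q | B (row_sqnorm q i)]) q.
    by rewrite -Hopf_preimage_Arm3; exists e.
  move=> [q2 qB]; split => //; split => // c.
  have e0' c' : \sum_m e m c' = 0.
    transitivity ((\sum_m row m e) 0 c'); last by rewrite e0 mxE.
    by rewrite summxE; apply: eq_bigr => m _; rewrite [RHS]mxE.
  rewrite -eq_e; move: c; apply: forall_I4.
  - by rewrite big1// => m _; have [-> _ _ _] := embed3E e m.
  - by rewrite -[RHS](e0' 0); apply: eq_bigr => m _; have [_ -> _ _] := embed3E e m.
  - by rewrite -[RHS](e0' 1); apply: eq_bigr => m _; have [_ _ -> _] := embed3E e m.
  - by rewrite -[RHS](e0' 2); apply: eq_bigr => m _; have [_ _ _ ->] := embed3E e m.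
move=> [[q2 qc] qB].
have [e [eA eB] eq_e] : (@Hopf R n @^-1` (@embed3 R n @` (@Arm R 3 n `&`
    (fun e => edge_length e i) @^-1` B))) q by rewrite Hopf_preimage_Arm3.
exists e => //; split => //; split => //; apply/rowP => c; rewrite summxE [RHS]mxE.
rewrite -[RHS](qc (lift 0 c)) -eq_e; apply: eq_bigr => m _; rewrite [LHS]mxE.
have [_ e1 e2 e3] := embed3E e m; case: c => [[|[|[|//]]] c3].
- by rewrite (_ : lift 0 _ = 1) ?e1; [congr (e m _)|]; apply: val_inj.
- by rewrite (_ : lift 0 _ = 2) ?e2; [congr (e m _)|]; apply: val_inj.
- by rewrite (_ : lift 0 _ = 3) ?e3; [congr (e m _)|]; apply: val_inj.
Qed.

Lemma Hopf_preimage_Pol2 i B :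
  @Hopf R n @^-1` (@embed2 R n @` (@Pol R 2 n `&` (fun e => edge_length e i) @^-1` B)) =
  [set q | dotq q q = 2] `&` [set q | forall m, Hopf q m 2 = 0] `&` Hopf_closed `&`
    [set q | B (row_sqnorm q i)].
Proof.
apply/seteqP; split => q.
  move=> [e [[eA e0] eB] eq_e].
  have : ([set q | dotq q q = 2] `&` [set q | forall m, Hopf q m 2 = 0] `&`
      [set q | B (row_sqnorm q i)]) q.
    by rewrite -Hopf_preimage_Arm2; exists e.
  move=> [[q2 H2] qB]; split => //; split => // c.
  have e0' c' : \sum_m e m c' = 0.
    transitivity ((\sum_m row m e) 0 c'); last by rewrite e0 mxE.
    by rewrite summxE; apply: eq_bigr => m _; rewrite [RHS]mxE.
  rewrite -eq_e; move: c; apply: forall_I4.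
  - by rewrite big1// => m _; have [-> _ _ _] := embed2E e m.
  - by rewrite -[RHS](e0' 0); apply: eq_bigr => m _; have [_ -> _ _] := embed2E e m.
  - by rewrite big1// => m _; have [_ _ -> _] := embed2E e m.
  - by rewrite -[RHS](e0' 1); apply: eq_bigr => m _; have [_ _ _ ->] := embed2E e m.
move=> [[[q2 H2] qc] qB].
have [e [eA eB] eq_e] : (@Hopf R n @^-1` (@embed2 R n @` (@Arm R 2 n `&`
    (fun e => edge_length e i) @^-1` B))) q by rewrite Hopf_preimage_Arm2.
exists e => //; split => //; split => //; apply/rowP => c; rewrite summxE [RHS]mxE.
rewrite -[RHS](qc (if c == 0 then 1 else 3)) -eq_e; apply: eq_bigr => m _; rewrite [LHS]mxE.
have [_ e1 _ e3] := embed2E e m; case: c => [[|[|//]] c2] /=.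
- by rewrite e1; congr (e m _); apply: val_inj.
- by rewrite e3; congr (e m _); apply: val_inj.
Qed.

Lemma continuous_Hopf c m : continuous (fun q : quatn R n => Hopf q m c).
Proof.
have cc c' : continuous (fun q : quatn R n => q m c') by exact: continuous_entry.
have c2 : continuous (fun q : quatn R n => 2 : R) by exact: cst_continuous.
move: c; apply: forall_I4.
- rewrite (_ : (fun q => Hopf q m 0) = fun=> 0); first exact: cst_continuous.
  by apply/funext => q; have [-> _ _ _] := HopfE q m.
- rewrite (_ : (fun q => Hopf q m 1) =
    fun q : quatn R n => q m 0 ^+ 2 + q m 1 ^+ 2 - q m 2 ^+ 2 - q m 3 ^+ 2).
    exact: (continuous_add (continuous_add (continuous_add (continuous_sqr (cc 0))
      (continuous_sqr (cc 1))) (continuous_opp (continuous_sqr (cc 2))))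
      (continuous_opp (continuous_sqr (cc 3)))).
  by apply/funext => q; have [_ -> _ _] := HopfE q m.
- rewrite (_ : (fun q => Hopf q m 2) =
    fun q : quatn R n => 2 * (q m 1 * q m 2 - q m 0 * q m 3)).
    by apply: continuous_mul => //; apply: continuous_add;
      [|apply: continuous_opp]; apply: continuous_mul.
  by apply/funext => q; have [_ _ -> _] := HopfE q m.
- rewrite (_ : (fun q => Hopf q m 3) =
    fun q : quatn R n => 2 * (q m 0 * q m 2 + q m 1 * q m 3)).
    by apply: continuous_mul => //; apply: continuous_add; apply: continuous_mul.
  by apply/funext => q; have [_ _ _ ->] := HopfE q m.
Qed.

Lemma borel_forall_eq0 k (f : 'I_k -> quatn R n -> R) : (forall j, continuous (f j)) ->
  measurable ([set q | forall j, f j q = 0] : set Q).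
Proof.
move=> cf; have -> : [set q | forall j, f j q = 0] = [set q | \sum_j f j q * f j q = 0].
  apply/seteqP; split => q /= f0; first by apply: big1 => j _; rewrite f0 mul0r.
  move=> j; have /eqP := f0; rewrite psumr_eq0 => [|j' _]; last by rewrite -expr2 sqr_ge0.
  by move=> /allP/(_ j); rewrite mem_index_enum mulf_eq0 orbb => /(_ isT)/eqP.
by apply: borel_eq; apply: continuous_sum => j; exact: continuous_mul.
Qed.

Lemma measurable_dotq2 : measurable ([set q | dotq q q = 2] : set Q).
Proof. by apply: borel_eq; exact: continuous_dotq. Qed.

Lemma measurable_row_sqnorm i B : measurable B ->
  measurable ([set q | B (row_sqnorm q i)] : set Q).
Proof. by move=> mB; apply: borel_preimage_real => //; exact: continuous_row_sqnorm. Qed.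

Lemma measurable_planar : measurable ([set q | forall m, Hopf q m 2 = 0] : set Q).
Proof. by apply: borel_forall_eq0 => m; exact: continuous_Hopf. Qed.

Lemma measurable_Hopf_closed : measurable (Hopf_closed : set Q).
Proof.
by apply: borel_forall_eq0 => c; apply: continuous_sum => m; exact: continuous_Hopf.
Qed.

End edge_lists.

(** * Arms *)

Section arm3.
Context {R : realType} {n : nat}.
Local Notation leb := (@lebesgue_measure R).
Local Notation Q := (borel (quatn R n.+2)).

Lemma model_Arm3E m : @model_Arm3 R m = @sphere R m 4 columns4.
Proof. by apply/seteqP; split => q; [split|case]. Qed.

Lemma measure_sphere_row_swap w d (C : columns w) (M : set (quatn R n.+2)) mu (i j : 'I_n.+2) B :
  (0 < w)%N -> (d.+1 = w * n.+2)%N ->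
  is_riemannian_volume d M mu -> measurable (M : set Q) ->
  @sphere R n.+2 w C `<=` M -> covered M M (@half_sphere R w n.+1 d C) ->
  symmetry_of M (row_swap i j) -> measurable B ->
  mu (M `&` [set q | B (row_sqnorm q i)]) = mu (M `&` [set q | B (row_sqnorm q j)]).
Proof.
move=> w0 dE vol mM SM cM sM mB.
have hM : @half_sphere R w n.+1 d C `<=` M by move=> q [/SM].
have imE := image_sphere_chart C w0 dE.
apply: (measure_row_swap vol (sphere_local_param w0 dE hM)) => //.
- by rewrite imE; exact: measurable_half_sphere.
- by rewrite imE; exact: half_lty vol SM.
- by rewrite imE.
Qed.

Lemma row_sqnormN m (q : quatn R m) i : row_sqnorm (- q) i = row_sqnorm q i.
Proof. by apply: eq_bigr => c _; rewrite mxE sqrrN. Qed.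

Lemma symmetry_row_sqnorm m (B : set R) (i : 'I_m) :
  symmetry_of [set q | B (row_sqnorm q i)] (antipode m).
Proof. by move=> q /=; rewrite act_antipode row_sqnormN. Qed.

Lemma symmetry_Arm3 (s : isometry R n.+2) : symmetry_of (@model_Arm3 R n.+2) s.
Proof. by move=> q; rewrite /model_Arm3 /= dotq_act. Qed.

Lemma volume_Arm3 (mu : {measure set Q -> \bar R}) (i : 'I_n.+2) :
  is_riemannian_volume (4 * n.+2 - 1) (@model_Arm3 R n.+2) mu ->
  exists2 K : R, 0 < K & forall B, measurable B ->
    mu (@model_Arm3 R n.+2 `&` [set q | B (row_sqnorm q i)]) =
    (\int[leb]_(t in `[0%R, 2%R] `&` B) (K * (t * (2 - t) ^+ (2 * n.+2 - 3)))%:E)%E.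
Proof.
set d := (4 * n.+2 - 1)%N => vol.
have dE : (d.+1 = 4 * n.+2)%N by rewrite /d; lia.
have mM : measurable (@model_Arm3 R n.+2 : set Q) by exact: measurable_dotq2.
have SM : @sphere R n.+2 4 columns4 `<=` @model_Arm3 R n.+2 by rewrite model_Arm3E.
have MS : covered (@model_Arm3 R n.+2) (@model_Arm3 R n.+2) (@sphere R n.+2 4 columns4).
  apply: (@covered_bool _ _ _ one_isometry); first exact: symmetry_one.
  by move=> q; rewrite {1}model_Arm3E; left.
have rowM A (hA : A *m A^T = 1%:M) := symmetry_Arm3 (row_isometry hA).
have colM c c' (_ : colpos columns4 c != None) (_ : colpos columns4 c' != None) :=
  symmetry_Arm3 (col_swap n.+2 c c').
have reflM (u : 'rV[R]_4) (_ : (u *m u^T) 0 0 != 0)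
  (_ : forall c, colpos columns4 c = None -> u 0 c = 0) := symmetry_Arm3 (col_reflection n.+2 u).
have w0 : (0 < 4)%N by [].
have [K K0 KE] := half_sphere_measure w0 dE vol SM.
have [C C0 CE] := @integral_sqr_norm4_density R (- 2^-1 + (d - 4)%:R / 2).
(* The factor 2 counts the two half spheres. *)
exists (2 * (C * K)); first by rewrite !mulr_gt0.
move=> B mB.
rewrite (@measure_sphere_row_swap 4 d columns4 _ mu i ord0 B w0 dE vol mM SM _ (symmetry_Arm3 _) mB); last first.
  exact: (@covered_half R 4 n d columns4 w0 _ rowM colM MS).
rewrite {1}model_Arm3E (measure_sphere_half w0 dE vol)//; last 2 first.
- exact: measurable_row_sqnorm.
- exact: symmetry_row_sqnorm.
rewrite KE// CE// -ge0_integralZl_EFin//; last 3 first.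
- by apply: measurableI => //; exact: measurable_itv.
- by move=> t [/=]; rewrite in_itv/= => /andP[t0 _] _; rewrite lee_fin !mulr_ge0 ?powR_ge0// ltW.
- apply/measurable_EFinP; apply: measurable_funTS; apply: measurable_funM => //.
  apply: measurable_funM => //.
  have mB2 : measurable_fun setT (fun t : R => 2 - t) by exact: measurable_funB.
  exact: (measurableT_comp (@measurable_powR R _) mB2).
apply: eq_integral => t /set_mem[/= + _]; rewrite in_itv/= => /andP[t0 t2].
rewrite -EFinM -powR_mulrn ?subr_ge0//.
(* For n' = n.+2 edges, d - 4 = 4 n' - 5, and -1/2 + (4 n' - 5) / 2 = 2 n' - 3. *)
have -> : - 2^-1 + (d - 4)%:R / 2 = (2 * n.+2 - 3)%:R :> R.
  have -> : (d - 4 = (2 * n.+2 - 3).*2.+1)%N by rewrite /d; lia.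
  by move: (2 * n.+2 - 3)%N => k; rewrite -[k.*2.+1]addn1 (natrD R k.*2 1) -mul2n (natrM R 2 k); lra.
by rewrite !mulrA.
Qed.

Lemma Arm3_density (P : set 'M[R]_(n.+2, 3) -> \bar R) (i : 'I_n.+2) : symmetric_Arm3 P ->
  has_density P (@Arm R 3 n.+2) (fun e => edge_length e i) `[0, 2]
    (fun y => (2 * n.+2%:R - 2) * (2 * n.+2%:R - 1) / 2 ^+ (2 * n.+2 - 1)
              * y * (2 - y) ^+ (2 * n.+2 - 3)).
Proof.
move=> symP.
have -> : (2 * n.+2 - 1 = (2 * n).+3)%N by lia.
have -> : (2 * n.+2 - 3 = (2 * n).+1)%N by lia.
have e2 : 2 * n.+2%:R - 2 = (2 * n).+2%:R :> R.
  by rewrite -[(2 * n).+2%N]addn2 -[n.+2]addn2 (natrD R (2 * n) 2) (natrD R n 2) (natrM R 2 n); ring.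
have e1 : 2 * n.+2%:R - 1 = (2 * n).+3%:R :> R.
  by rewrite -[(2 * n).+3%N]addn3 -[n.+2]addn2 (natrD R (2 * n) 3) (natrD R n 2) (natrM R 2 n); ring.
rewrite e1 e2; set k := (2 * n)%N.
have kap : 0 < k.+2%:R * k.+3%:R / 2 ^+ k.+3 :> R by apply: divr_gt0; [apply: mulr_gt0; rewrite ltr0n|apply: exprn_gt0; rewrite ltr0n].
have kE : (2 * n.+2%N - 3 = k.+1)%N by rewrite /k; lia.
have mf : measurable_fun setT (fun y : R => k.+2%:R * k.+3%:R / 2 ^+ k.+3 * y * (2 - y) ^+ k.+1).
  apply: measurable_funM; first exact: measurable_funM.
  by apply: measurable_funX; exact: measurable_funB.
have f0 (y : R) : 0 <= y -> y <= 2 -> 0 <= k.+2%:R * k.+3%:R / 2 ^+ k.+3 * y * (2 - y) ^+ k.+1.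
  by move=> y0 y2; rewrite mulr_ge0 ?exprn_ge0 ?subr_ge0// mulr_ge0// ltW.
apply: (has_density_of_volume (i := i) symP _ (Hopf_preimage_Arm3 i)) => //.
- exact: measurable_dotq2.
- by move=> B mB; apply: measurableI; [exact: measurable_dotq2|exact: measurable_row_sqnorm].
- by move=> B q Mq; split; [case|split].
- exact: integral_density_y.
move=> mu vol; have [K K0 KE] := volume_Arm3 i vol.
exists (K / (k.+2%:R * k.+3%:R / 2 ^+ k.+3)); first exact: divr_gt0.
move=> B mB; rewrite KE// -ge0_integralZl_EFin//; last 4 first.
- by apply: measurableI => //; exact: measurable_itv.
- by move=> t [/=]; rewrite in_itv/= => /andP[t0 t2] _; rewrite lee_fin f0.
- by apply/measurable_EFinP; exact: measurable_funTS mf.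
- by rewrite ltW// divr_gt0.
apply: eq_integral => t _; rewrite -EFinM; congr (_%:E).
rewrite kE.
by move: (_ / _) kap ((2 - t) ^+ _) => ka ka0 s; field; rewrite gt_eqF.
Qed.

End arm3.

Section flip.
Context {R : realType} {n : nat}.
Implicit Types q : quatn R n.

(* (q0, q1, q2, q3) |-> (q1, q0, q3, q2), which up to signs is left multiplication by i. *)
Definition flip : isometry R n := comp_isometry (col_swap n 0 1) (col_swap n 2 3).

Lemma flipE q m : [/\ act flip q m 0 = q m 1, act flip q m 1 = q m 0,
  act flip q m 2 = q m 3 & act flip q m 3 = q m 2].
Proof.
split; rewrite act_comp !act_col_swap.
- by rewrite tpermL tpermD.
- by rewrite tpermR tpermD.
- by rewrite (@tpermD _ 0 1 2)// tpermL.
- by rewrite (@tpermD _ 0 1 3)// tpermR.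
Qed.

Lemma flipK q : act flip (act flip q) = q.
Proof.
apply/matrixP => m; have [e0 e1 e2 e3] := flipE (act flip q) m.
have [f0 f1 f2 f3] := flipE q m.
by apply: forall_I4; rewrite ?e0 ?e1 ?e2 ?e3.
Qed.

Lemma act_flipV q : act (inv_isometry flip) q = act flip q.
Proof. by rewrite -{1}(flipK q) actK. Qed.

Lemma row_sqnorm_flip q m : row_sqnorm (act flip q) m = row_sqnorm q m.
Proof. by rewrite !row_sqnormE; have [-> -> -> ->] := flipE q m; ring. Qed.

Lemma symmetry_id (A : set (quatn R n)) s : (forall q, A q -> act s q = q) -> symmetry_of A s.
Proof.
move=> sA q; split=> [Aq|Asq]; first by rewrite sA.
by have /(can_inj (actK s)) <- := sA _ Asq.
Qed.

Lemma symmetryU (A B : set (quatn R n)) s : symmetry_of A s -> symmetry_of B s ->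
  symmetry_of (A `|` B) s.
Proof. by move=> sA sB q; rewrite /setU/= -sA -sB. Qed.

Lemma symmetry_involution (A : set (quatn R n)) s :
  (forall q, act s (act s q) = q) -> (forall q, A q -> A (act s q)) -> symmetry_of A s.
Proof. by move=> ss sA q; split => [/sA//|/sA]; rewrite ss. Qed.

End flip.

Section arm2.
Context {R : realType} {n : nat}.
Local Notation leb := (@lebesgue_measure R).
Local Notation Q := (borel (quatn R n.+2)).
Local Notation M := (@model_Arm2 R n.+2).
Local Notation S := (@sphere R n.+2 2 columns2).
Let S' : set (quatn R n.+2) :=
  [set q | dotq q q = 2 /\ forall m c, colpos columns2 c != None -> q m c = 0].

Let MSS' : M = S `|` S'.
Proof.
apply/seteqP; split => q [[q2 q0]|[q2 q0]]; [left|right|left|right]; split => //.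
- by move=> m; have [q1 q3] := q0 m; apply: forall_I4.
- by move=> m; have [q1 q3] := q0 m; apply: forall_I4.
- by move=> m; rewrite !q0.
- by move=> m; rewrite !q0.
Qed.

Let S_flip q : S q -> S' (act (flip (n := n.+2)) q).
Proof.
move=> [q2 q0]; split; first by rewrite dotq_act.
move=> m; have [e0 e1 e2 e3] := flipE q m.
by apply: forall_I4 => //; rewrite ?e0 ?e2 q0.
Qed.

Let S'_flip q : S' q -> S (act (flip (n := n.+2)) q).
Proof.
move=> [q2 q0]; split; first by rewrite /= dotq_act.
move=> m; have [e0 e1 e2 e3] := flipE q m.
by apply: forall_I4 => //; rewrite ?e1 ?e3 q0.
Qed.

Let M_flip : symmetry_of M flip.
Proof.
rewrite MSS'; apply: symmetry_involution; first exact: flipK.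
by move=> q [/S_flip|/S'_flip]; [right|left].
Qed.

Let S'_row A (hA : A *m A^T = 1%:M) : symmetry_of S' (row_isometry hA).
Proof.
have sub B (hB : B *m B^T = 1%:M) q : S' q -> S' (act (row_isometry hB) q).
  move=> [q2 q0]; split; first by rewrite /= dotq_act.
  move=> m c mc; rewrite act_row mxE big1// => k _.
  by rewrite q0// mulr0.
move=> q; split; first exact: sub.
have hB : A^T *m A^T^T = 1%:M by rewrite trmxK; exact: mulmx1C.
by move=> /(sub _ hB); rewrite !act_row mulmxA (mulmx1C hA) mul1mx.
Qed.

Let M_row A (hA : A *m A^T = 1%:M) : symmetry_of M (row_isometry hA).
Proof. by rewrite MSS'; apply: symmetryU; [exact: symmetry_sphere_row|exact: S'_row]. Qed.

Let M_col c c' : colpos columns2 c != None -> colpos columns2 c' != None ->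
  symmetry_of M (col_swap n.+2 c c').
Proof.
move=> cC c'C; rewrite MSS'; apply: symmetryU.
  apply: symmetry_involution.
    by move=> q; apply/matrixP => m d; rewrite !act_col_swap tpermK.
  move=> q [q2 q0]; split; first by rewrite /= dotq_act.
  move=> m d dN; rewrite act_col_swap; apply: q0; rewrite tpermD//.
    by apply: contraNneq cC => ->; apply/eqP.
  by apply: contraNneq c'C => ->; apply/eqP.
apply: symmetry_id => q [_ q0]; apply/matrixP => m d; rewrite act_col_swap.
by case: tpermP => [->|->|//]; rewrite !q0.
Qed.

(** A reflection along a vector supported in the columns of 1 and j preserves the first sphere, and
    fixes every point of the second, whose rows are orthogonal to that vector. *)
Let M_refl (u : 'rV[R]_4) : (u *m u^T) 0 0 != 0 ->
  (forall c, colpos columns2 c = None -> u 0 c = 0) ->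
  symmetry_of M (col_reflection n.+2 u).
Proof.
move=> hu u0; rewrite MSS'; apply: symmetryU; first exact: symmetry_sphere_refl.
apply: symmetry_id => q [_ q0].
rewrite act_col_reflection// /reflection_mx mulmxBr mulmx1 -scalemxAr mulmxA.
have -> : q *m u^T = 0.
  apply/matrixP => m j; rewrite !mxE big1// => c _; rewrite !mxE ord1.
  case: (eqVneq (colpos columns2 c) None) => [/u0 ->|/q0 ->]; last by rewrite mul0r.
  by rewrite mulr0.
by rewrite mul0mx scaler0 subr0.
Qed.

Lemma volume_Arm2 (mu : {measure set Q -> \bar R}) (i : 'I_n.+2) :
  is_riemannian_volume (2 * n.+2 - 1) M mu ->
  exists2 K : R, 0 < K & forall B, measurable B ->
    mu (M `&` [set q | B (row_sqnorm q i)]) =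
    (\int[leb]_(t in `[0%R, 2%R] `&` B) (K * (2 - t) ^+ n)%:E)%E.
Proof.
set d := (2 * n.+2 - 1)%N => vol.
have dE : (d.+1 = 2 * n.+2)%N by rewrite /d; lia.
have w0 : (0 < 2)%N by [].
have SM : S `<=` M by rewrite MSS' => q; left.
have MS : covered M M S.
  apply: (covered_bool M_flip) => q; rewrite MSS' => -[Sq|S'q]; [by left|right].
  by rewrite /moves /= act_flipV; exact: S'_flip.
have mS : measurable (S : set Q) by exact: measurable_sphere.
have S'E : moves flip S = S'.
  apply/seteqP; split => q; rewrite /moves /= act_flipV; last exact: S'_flip.
  by move=> /S_flip; rewrite flipK.
have mM : measurable (M : set Q).
  by rewrite MSS' -S'E; apply: measurableU => //; exact: measurable_moves.
have cM := @covered_half R 2 n d columns2 w0 _ M_row M_col MS.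
have mu_inv := sphere_measure_moves w0 dE vol SM M_row M_col MS.
have [K K0 KE] := half_sphere_measure w0 dE vol SM.
have [C C0 CE] := @integral_sqr_norm2_density R (- 2^-1 + (d - 2)%:R / 2).
(* Two spheres, exchanged by [flip], with two half spheres each. *)
exists (2 * (2 * (C * K))); first by rewrite !mulr_gt0.
move=> B mB.
rewrite (@measure_sphere_row_swap _ _ 2 d columns2 _ mu i ord0 B w0 dE vol mM SM cM (M_row _) mB).
have mE : measurable ([set q | B (row_sqnorm q ord0)] : set Q) by exact: measurable_row_sqnorm.
rewrite (measure_halves mu_inv (s := flip) (A := S))//; last 4 first.
- by move=> q /=; rewrite row_sqnorm_flip.
- by rewrite S'E MSS' => q; right.
- rewrite S'E -subset0 => q [[q2 q0] [_ q0']]; move: q2; rewrite /= /dotq big1.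
    by move=> /esym/eqP; rewrite pnatr_eq0.
  move=> m _; apply: big1 => c _.
  by case: (eqVneq (colpos columns2 c) None) => [/q0 ->|/q0' ->]; rewrite mul0r.
- by rewrite S'E -MSS' setDv measure0.
rewrite (measure_sphere_half w0 dE vol)//; last first.
  exact: symmetry_row_sqnorm.
rewrite KE// CE// muleA -EFinM -ge0_integralZl_EFin//; last 3 first.
- by apply: measurableI => //; exact: measurable_itv.
- by move=> t _; rewrite lee_fin !mulr_ge0 ?powR_ge0// ltW.
- apply/measurable_EFinP; apply: measurable_funTS; apply: measurable_funM => //.
  have mB2 : measurable_fun setT (fun t : R => 2 - t) by exact: measurable_funB.
  exact: (measurableT_comp (@measurable_powR R _) mB2).
apply: eq_integral => t /set_mem[/= + _]; rewrite in_itv/= => /andP[t0 t2].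
rewrite -EFinM -powR_mulrn ?subr_ge0//.
have -> : - 2^-1 + (d - 2)%:R / 2 = n%:R :> R.
  have -> : (d - 2 = 2 * n + 1)%N by rewrite /d; lia.
  by rewrite (natrD R (2 * n) 1) (natrM R 2 n); lra.
by rewrite !mulrA.
Qed.

Lemma Arm2_density (P : set 'M[R]_(n.+2, 2) -> \bar R) (i : 'I_n.+2) : symmetric_Arm2 P ->
  has_density P (@Arm R 2 n.+2) (fun e => edge_length e i) `[0, 2]
    (fun y => (n.+2%:R - 1) / 2 ^+ (n.+2 - 1) * (2 - y) ^+ (n.+2 - 2)).
Proof.
move=> symP.
have -> : (n.+2 - 1 = n.+1)%N by lia.
have -> : (n.+2 - 2 = n)%N by lia.
have -> : n.+2%:R - 1 = n.+1%:R :> R by rewrite -[n.+2]addn1 (natrD R n.+1 1) addrK.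
have kap : 0 < n.+1%:R / 2 ^+ n.+1 :> R.
  by apply: divr_gt0; [rewrite ltr0n|apply: exprn_gt0; rewrite ltr0n].
have mf : measurable_fun setT (fun y : R => n.+1%:R / 2 ^+ n.+1 * (2 - y) ^+ n).
  by apply: measurable_funM => //; apply: measurable_funX; exact: measurable_funB.
have f0 (y : R) : 0 <= y -> y <= 2 -> 0 <= n.+1%:R / 2 ^+ n.+1 * (2 - y) ^+ n.
  by move=> y0 y2; rewrite mulr_ge0 ?exprn_ge0 ?subr_ge0// ltW.
have mS : measurable (S : set Q) by exact: measurable_sphere.
have mM : measurable (M : set Q).
  have -> : M = S `|` moves flip S.
    rewrite MSS'; congr (_ `|` _).
    apply/seteqP; split => q; rewrite /moves /= act_flipV; first exact: S'_flip.
    by move=> /S_flip; rewrite flipK.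
  by apply: measurableU => //; exact: measurable_moves.
apply: (has_density_of_volume (i := i) symP _ (Hopf_preimage_Arm2 i)) => //.
- move=> B mB; apply: measurableI; last exact: measurable_row_sqnorm.
  by apply: measurableI; [exact: measurable_dotq2|exact: measurable_planar].
- move=> B q Mq; split=> [[]//|Bq]; split=> //; case: Mq => -[q2 q0]; split=> // m /=.
    by have [_ _ -> _] := HopfE q m; have [-> ->] := q0 m; ring.
  by have [_ _ -> _] := HopfE q m; have [-> ->] := q0 m; ring.
- exact: integral_density_1.
move=> mu vol; have [K K0 KE] := volume_Arm2 i vol.
exists (K / (n.+1%:R / 2 ^+ n.+1)); first exact: divr_gt0.
move=> B mB; rewrite KE// -ge0_integralZl_EFin//; last 4 first.
- by apply: measurableI => //; exact: measurable_itv.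
- by move=> t [/=]; rewrite in_itv/= => /andP[t0 t2] _; rewrite lee_fin f0.
- by apply/measurable_EFinP; exact: measurable_funTS mf.
- by rewrite ltW// divr_gt0.
apply: eq_integral => t _; rewrite -EFinM; congr (_%:E).
by move: (_ / _) kap ((2 - t) ^+ _) => ka ka0 s; field; rewrite gt_eqF.
Qed.

End arm2.

(** * Stiefel manifolds *)

Section frames.
Context {R : realType} {n : nat}.
Local Notation Q := (borel (quatn R n)).
Implicit Types (q : quatn R n) (p m : 'I_n).

Definition norm_a q m : R := q m 0 ^+ 2 + q m 1 ^+ 2.
Definition norm_b q m : R := q m 2 ^+ 2 + q m 3 ^+ 2.
(** With q = a + b j, [re_ab] and [im_ab] are the real and imaginary parts of a_m conj(b_m), the
    summands of the Hermitian product. *)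
Definition re_ab q m : R := q m 0 * q m 2 + q m 1 * q m 3.
Definition im_ab q m : R := q m 1 * q m 2 - q m 0 * q m 3.

Definition frame : set (quatn R n) := [set q |
  [/\ \sum_m norm_a q m = 1, \sum_m norm_b q m = 1,
      \sum_m re_ab q m = 0 & \sum_m im_ab q m = 0]].

(* Real and imaginary parts of conj(a_p) (a_p b_m - a_m b_p). *)
Definition minor_re q p m : R :=
  norm_a q p * q m 2 - (q m 0 * re_ab q p + q m 1 * im_ab q p).
Definition minor_im q p m : R :=
  norm_a q p * q m 3 - (q m 1 * re_ab q p - q m 0 * im_ab q p).

Lemma minor_diag q p : minor_re q p p = 0.
Proof. by rewrite /minor_re /norm_a /re_ab /im_ab; ring. Qed.

Lemma minor_im_diag q p : minor_im q p p = 0.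
Proof. by rewrite /minor_im /norm_a /re_ab /im_ab; ring. Qed.

(* If all the minors vanish then b is proportional to a, hence orthogonal to itself. *)
Lemma frame_minor q p : frame q -> (forall m, minor_re q p m = 0 /\ minor_im q p m = 0) ->
  norm_a q p = 0.
Proof.
move=> [_ b1 re0 im0] q0.
transitivity (norm_a q p * \sum_m norm_b q m); first by rewrite b1 mulr1.
transitivity (re_ab q p * (\sum_m re_ab q m) + im_ab q p * (\sum_m im_ab q m)); last first.
  by rewrite re0 im0 !mulr0 addr0.
rewrite !mulr_sumr -big_split/=; apply: eq_bigr => m _.
have [/eqP + /eqP] := q0 m; rewrite /minor_re /minor_im !subr_eq0 => /eqP e1 /eqP e2.
transitivity (norm_a q p * q m 2 * q m 2 + norm_a q p * q m 3 * q m 3).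
  by rewrite /norm_b; ring.
by rewrite e1 e2 [re_ab q m]/re_ab [im_ab q m]/im_ab; ring.
Qed.

Lemma norm_a_eq0 q p : (norm_a q p == 0) = (q p 0 == 0) && (q p 1 == 0).
Proof. by rewrite /norm_a paddr_eq0 ?sqr_ge0// !sqrf_eq0. Qed.

Lemma frame_neq0 q : frame q -> exists p, norm_a q p != 0.
Proof.
move=> [a1 _ _ _]; apply/existsP; apply: contraT; rewrite negb_exists => /forallP q0.
move: a1; rewrite big1 => [/esym/eqP|m _]; first by rewrite oner_eq0.
by have := q0 m; rewrite negbK => /eqP.
Qed.

Lemma gram_row A (hA : A *m A^T = 1%:M) q c c' :
  \sum_m act (row_isometry hA) q m c * act (row_isometry hA) q m c' =
  \sum_m q m c * q m c'.
Proof.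
have gramE q' : \sum_m q' m c * q' m c' = (q'^T *m q') c c'.
  by rewrite mxE; apply: eq_bigr => m _; rewrite mxE.
by rewrite !gramE act_row trmx_mul -mulmxA (mulmxA _ A) (mulmx1C hA) mul1mx.
Qed.

Lemma frame_row A (hA : A *m A^T = 1%:M) : symmetry_of frame (row_isometry hA).
Proof.
move=> q; rewrite /frame /= /norm_a /norm_b /re_ab /im_ab.
rewrite !sumrB !big_split/=.
have sq c (q' : quatn R n) : \sum_m q' m c ^+ 2 = \sum_m q' m c * q' m c.
  by apply: eq_bigr => m _; rewrite expr2.
by rewrite !(sq 0) !(sq 1) !(sq 2) !(sq 3) !gram_row.
Qed.

Let c_e c m : continuous (fun q => q m c) := @continuous_entry R n 4 m c.

Lemma continuous_norm_a m : continuous (fun q => norm_a q m).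
Proof.
exact: (continuous_add (continuous_sqr (@c_e 0 m)) (continuous_sqr (@c_e 1 m))).
Qed.

Lemma continuous_norm_b m : continuous (fun q => norm_b q m).
Proof.
exact: (continuous_add (continuous_sqr (@c_e 2 m)) (continuous_sqr (@c_e 3 m))).
Qed.

Lemma continuous_re_ab m : continuous (fun q => re_ab q m).
Proof.
exact: (continuous_add (continuous_mul (@c_e 0 m) (@c_e 2 m)) (continuous_mul (@c_e 1 m) (@c_e 3 m))).
Qed.

Lemma continuous_im_ab m : continuous (fun q => im_ab q m).
Proof.
exact: (continuous_add (continuous_mul (@c_e 1 m) (@c_e 2 m))
  (continuous_opp (continuous_mul (@c_e 0 m) (@c_e 3 m)))).
Qed.

Lemma continuous_minor_re p m : continuous (fun q => minor_re q p m).
Proof.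
exact: (continuous_add (continuous_mul (@continuous_norm_a p) (@c_e 2 m))
  (continuous_opp (continuous_add (continuous_mul (@c_e 0 m) (@continuous_re_ab p))
    (continuous_mul (@c_e 1 m) (@continuous_im_ab p))))).
Qed.

Lemma continuous_minor_im p m : continuous (fun q => minor_im q p m).
Proof.
exact: (continuous_add (continuous_mul (@continuous_norm_a p) (@c_e 3 m))
  (continuous_opp (continuous_add (continuous_mul (@c_e 1 m) (@continuous_re_ab p))
    (continuous_opp (continuous_mul (@c_e 0 m) (@continuous_im_ab p)))))).
Qed.

Lemma measurable_frame : measurable (frame : set Q).
Proof.
have -> : frame = [set q | \sum_m norm_a q m = 1] `&` [set q | \sum_m norm_b q m = 1] `&`
    [set q | \sum_m re_ab q m = 0] `&` [set q | \sum_m im_ab q m = 0].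
  by apply/seteqP; split => q [] => [|[[]]].
have mE (f : quatn R n -> 'I_n -> R) v : (forall m, continuous (f^~ m)) ->
    measurable ([set q | \sum_m f q m = v] : set Q).
  by move=> cf; apply: borel_eq; exact: continuous_sum.
apply: measurableI; [apply: measurableI; [apply: measurableI|]|]; apply: mE => m.
- exact: continuous_norm_a.
- exact: continuous_norm_b.
- exact: continuous_re_ab.
- exact: continuous_im_ab.
Qed.

(** For a fixed row p the minor is linear in the other row. So a row operation fixing row p acts on
    the column of minors as it acts on the rows, which is the equivariance that [null_chain] asks
    for. *)
Lemma minor_re_rows A q p m : (forall c, (A *m q) p c = q p c) ->
  minor_re (A *m q) p m = \sum_j A m j * minor_re q p j.
Proof.
move=> qp; have ra : norm_a (A *m q) p = norm_a q p by rewrite /norm_a !qp.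
have rr : re_ab (A *m q) p = re_ab q p by rewrite /re_ab !qp.
have ri : im_ab (A *m q) p = im_ab q p by rewrite /im_ab !qp.
rewrite /minor_re ra rr ri; move: (norm_a q p) (re_ab q p) (im_ab q p) => x y z.
rewrite !mxE.
rewrite mulr_sumr !mulr_suml -big_split/= -sumrB.
by apply: eq_bigr => j _; ring.
Qed.

End frames.

Section stiefel_covering.
Context {R : realType} {n : nat} (p r : 'I_n).
Hypothesis pr : p != r.
Local Notation Q := (borel (quatn R n)).
Variables M Y : set (quatn R n).
Hypothesis rowM : forall A (hA : A *m A^T = 1%:M), symmetry_of M (row_isometry hA).
Hypothesis rowY : forall A (hA : A *m A^T = 1%:M), symmetry_of Y (row_isometry hA).
Hypothesis Yframe : Y `<=` @frame R n.

(** The two inequalities select the positive square roots when a frame is recovered from its free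
    coordinates. *)
Definition stiefel_chart : set (quatn R n) :=
  Y `&` [set q | 0 < q p 0] `&` [set q | 0 < minor_re q p r].

Lemma flip_mxP (i : 'I_n) :
  (1%:M - 2%:R *: delta_mx i i : 'M[R]_n) *m (1%:M - 2%:R *: delta_mx i i)^T = 1%:M.
Proof.
have -> : (1%:M - 2%:R *: delta_mx i i : 'M[R]_n)^T = 1%:M - 2%:R *: delta_mx i i.
  by apply/matrixP => j k; rewrite !mxE andbC [j == k]eq_sym.
rewrite mulmxBl mul1mx mulmxBr mulmx1.
rewrite -scalemxAl -scalemxAr scalerA mul_delta_mx.
have -> : 2 * 2 = 2 + 2 :> R by ring.
by rewrite (scalerDl _ 2 2) -[X in _ - X]opprB addrK opprK subrK.
Qed.

Definition row_flip i : isometry R n := row_isometry (flip_mxP i).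

Lemma act_row_flip i q m c : act (row_flip i) q m c = if m == i then - q m c else q m c.
Proof.
rewrite act_row mulmxBl mul1mx -scalemxAl mxE [X in _ + X]mxE [X in - X]mxE.
have -> : (delta_mx i i *m q) m c = if m == i then q m c else 0.
  rewrite mxE (bigD1 i)//= big1 => [|j ji]; last by rewrite mxE (negPf ji) andbF mul0r.
  by rewrite mxE eqxx andbT addr0; case: eqP => [->|_]; rewrite ?mul1r ?mul0r.
by case: eqP => _; ring.
Qed.

Lemma row_flipK i q : act (row_flip i) (act (row_flip i) q) = q.
Proof.
by apply/matrixP => m c; rewrite !act_row_flip; case: eqP => // _; rewrite opprK.
Qed.

Lemma act_row_flipV i q : act (inv_isometry (row_flip i)) q = act (row_flip i) q.
Proof. by rewrite -{1}(row_flipK i q) actK. Qed.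

Lemma minor_flip_p q : minor_re (act (row_flip p) q) p r = minor_re q p r.
Proof.
rewrite /minor_re /norm_a /re_ab /im_ab !act_row_flip eqxx eq_sym (negPf pr).
ring.
Qed.

Lemma minor_flip_r q : minor_re (act (row_flip r) q) p r = - minor_re q p r.
Proof.
rewrite /minor_re /norm_a /re_ab /im_ab !act_row_flip eqxx (negPf pr).
ring.
Qed.

Lemma row_sqnorm_row_flip i q m : row_sqnorm (act (row_flip i) q) m = row_sqnorm q m.
Proof.
by apply: eq_bigr => c _; rewrite act_row_flip; case: eqP => // _; rewrite sqrrN.
Qed.

(** A frame has some nonzero a_p', and by [frame_minor] some nonzero minor of row p' with a row m.
    Two swaps bring p' to p and m to r. *)
Lemma covered_minor : covered M Y (Y `&` [set q | norm_a q p != 0] `&`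
    [set q | (minor_re q p r != 0) || (minor_im q p r != 0)]).
Proof.
apply: (@covered_fin _ _ _ ('I_n * 'I_n)%type
  (fun t => comp_isometry (row_swap t.1 p) (row_swap t.2 r))).
  by move=> t; apply: symmetry_comp; exact: rowM.
move=> q Yq; have fq := Yframe Yq.
have [p' p'0] := frame_neq0 fq.
have [m m0] : exists m, (minor_re q p' m != 0) || (minor_im q p' m != 0).
  apply/existsP; apply: contraT; rewrite negb_exists => /forallP q0.
  move/eqP : p'0; case; apply: frame_minor => // m.
  by have := q0 m; rewrite negb_or !negbK => /andP[/eqP -> /eqP ->].
have mp' : m != p'.
  by apply: contraTneq m0 => ->; rewrite minor_diag minor_im_diag eqxx.
(* The swap of p' and p may have displaced row m; m' is its place afterwards. *)
pose m' := tperm p' p m.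
have m'p : m' != p.
  by apply: contra mp' => /eqP e; rewrite -(tpermK p' p m) -/m' e tpermR.
exists (p', m'); rewrite moves_comp /moves /=.
set q2 := act _ _.
have q2p c : q2 p c = q p' c.
  by rewrite /q2 !act_row_swapV (@tpermD _ m' r p)// ?tpermR// eq_sym.
have q2r c : q2 r c = q m c.
  by rewrite /q2 !act_row_swapV tpermR /m' tpermK.
have e1 : norm_a q2 p = norm_a q p' by rewrite /norm_a !q2p.
have e2 : minor_re q2 p r = minor_re q p' m.
  by rewrite /minor_re /re_ab /im_ab e1 !q2p !q2r.
have e3 : minor_im q2 p r = minor_im q p' m.
  by rewrite /minor_im /re_ab /im_ab e1 !q2p !q2r.
split; last by rewrite /= e2 e3.
split; last by rewrite /= e1.
apply: (proj1 (symmetry_inv (rowY (tperm_mxP m' r)) _)).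
exact: (proj1 (symmetry_inv (rowY (tperm_mxP p' p)) _)).
Qed.

(** The minor is quadratic in row p and linear in row r. Changing the sign of row p corrects a_p
    without touching the minor, and changing the sign of row r then corrects the minor. *)
Lemma covered_signs : covered M (Y `&` [set q | q p 0 != 0] `&` [set q | minor_re q p r != 0])
  stiefel_chart.
Proof.
pose N := Y `&` [set q | 0 < q p 0] `&` [set q | minor_re q p r != 0].
apply: (@covered_trans _ _ _ _ N).
  apply: (covered_bool (rowM (flip_mxP p))) => q [[Yq q0] zq].
  move: q0; rewrite /= neq_lt => /orP[q0|q0]; [right|by left].
  rewrite /moves /= act_row_flipV; split; last by rewrite /= minor_flip_p.
  split; last by rewrite /= act_row_flip eqxx oppr_gt0.
  exact: (proj1 (rowY (flip_mxP p) _)).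
apply: (covered_bool (rowM (flip_mxP r))) => q [[Yq q0] /=].
rewrite neq_lt => /orP[zq|zq]; [right|by left].
rewrite /moves /= act_row_flipV; split; last by rewrite /= minor_flip_r oppr_gt0.
split; last by rewrite /= act_row_flip (negPf pr).
exact: (proj1 (rowY (flip_mxP r) _)).
Qed.

Hypothesis mY : measurable (Y : set Q).
Hypothesis YM : Y `<=` M.

Lemma measurable_stiefel_chart : measurable (stiefel_chart : set Q).
Proof.
apply: measurableI; last by apply: borel_gt0; exact: continuous_minor_re.
by apply: measurableI => //; apply: borel_gt0; exact: continuous_entry.
Qed.

Variable mu : {measure set Q -> \bar R}.
Hypothesis mM : measurable (M : set Q).
Hypothesis M_lty : (mu M < +oo)%E.
Hypothesis mu_inv : forall s A, symmetry_of M s -> measurable (A : set Q) ->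
  A `<=` M -> mu (moves s A) = mu A.

Lemma row_reflection_symmetry (A : set (quatn R n)) (u : 'rV[R]_n) : (u *m u^T) 0 0 != 0 ->
  (forall B (hB : B *m B^T = 1%:M), symmetry_of A (row_isometry hB)) ->
  symmetry_of A (row_reflection u).
Proof.
move=> u0 rowA q; rewrite act_row_reflection//.
by rewrite (rowA _ (reflection_mxP u0)) act_row.
Qed.

Lemma null_a : mu (Y `&` [set q | forall m, q m 0 = 0]) = 0%E ->
  mu (Y `&` [set q | q p 0 = 0]) = 0%E.
Proof.
move=> null_all.
transitivity (mu (Y `&` [set q | row p (col 0 q) = 0])).
  congr (mu (_ `&` _)); apply/seteqP; split => q /= => [q0|/rowP/(_ 0)]; last by rewrite !mxE.
  by apply/rowP => j; rewrite !mxE.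
apply: (@null_chain R n M mu mM M_lty mu_inv n 1 (fun q => col 0 q)
  (fun u => row_reflection u) xpredT Y mY YM) => //.
- by move=> i j; under eq_fun do rewrite mxE; exact: continuous_entry.
- move=> r1 r2 t _ _ rr' u.
  have u0 : (u *m u^T) 0 0 != 0 by exact: norm_delta2.
  split; [exact: row_reflection_symmetry|exact: row_reflection_symmetry|].
  by move=> q; rewrite act_row_reflectionV// !colE mulmxA.
- rewrite -null_all; congr (mu (_ `&` _)); apply/seteqP; split => q /= qz m.
    by have /rowP/(_ 0) := qz m isT; rewrite !mxE.
  by move=> _; apply/rowP => j; rewrite !mxE.
Qed.

(** Only rows other than p are mixed: such reflections fix row p, hence act linearly on the minors.
    The minor of row p with itself is 0, so excluding it does not change the event that all minors
    vanish. *)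
Lemma null_minor : mu (Y `&` [set q | forall m, minor_re q p m = 0]) = 0%E ->
  mu (Y `&` [set q | minor_re q p r = 0]) = 0%E.
Proof.
move=> null_all; pose X (q : quatn R n) : 'M[R]_(n, 1) := \col_m minor_re q p m.
transitivity (mu (Y `&` [set q | row r (X q) = 0])).
  congr (mu (_ `&` _)); apply/seteqP; split => q /= => [q0|/rowP/(_ 0)]; last by rewrite !mxE.
  by apply/rowP => j; rewrite !mxE.
apply: (@null_chain R n M mu mM M_lty mu_inv n 1 X
  (fun u => row_reflection u) (fun m => m != p) Y mY YM) => //; last by rewrite eq_sym.
- by move=> i j; under eq_fun do rewrite mxE; exact: continuous_minor_re.
- move=> r1 r2 t r1p r2p rr' u.
  have u0 : (u *m u^T) 0 0 != 0 by exact: norm_delta2.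
  split; [exact: row_reflection_symmetry|exact: row_reflection_symmetry|].
  move=> q; rewrite act_row_reflectionV//; apply/matrixP => m j; rewrite [LHS]mxE [RHS]mxE.
  rewrite minor_re_rows; first by apply: eq_bigr => k _; rewrite [X q k j]mxE.
  move=> c; rewrite /reflection_mx mulmxBl mul1mx -scalemxAl -mulmxA [LHS]mxE.
  rewrite [X in _ + X]mxE [X in - X]mxE [X in _ * X]mxE big1 ?mulr0 ?subr0// => k _.
  have -> : u^T p k = 0.
    by rewrite mxE ord1 !mxE !eqxx [p == r1]eq_sym [p == r2]eq_sym (negPf r1p) (negPf r2p) /= mulr0 addr0.
  by rewrite mul0r.
- rewrite -null_all; congr (mu (_ `&` _)); apply/seteqP; split => q /= qz m.
    have [->|mp] := eqVneq m p; first exact: minor_diag.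
    by have /rowP/(_ 0) := qz m mp; rewrite !mxE.
  by move=> _; apply/rowP => j; rewrite !mxE.
Qed.

(** Two independent signs, that of the minor and that of Re a_p, each cut the measure in half; the
    sets where they are undefined are null. *)
Lemma measure_stiefel_chart (E : set Q) : measurable E -> 
  (forall i, symmetry_of E (row_flip i)) ->
  mu (Y `&` [set q | forall m, q m 0 = 0]) = 0%E ->
  mu (Y `&` [set q | forall m, minor_re q p m = 0]) = 0%E ->
  (mu (Y `&` E) = 4%:E * mu (stiefel_chart `&` E))%E.
Proof.
move=> mE sE /null_a a0 /null_minor z0.
pose A := Y `&` [set q | 0 < minor_re q p r].
have mA : measurable (A : set Q).
  by apply: measurableI => //; apply: borel_gt0; exact: continuous_minor_re.
have AY : A `<=` Y by move=> q [].
have half1 : (mu (Y `&` E) = 2%:E * mu (A `&` E))%E.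
  apply: (measure_halves mu_inv (s := row_flip r)) => //.
  - exact: rowM.
  - move=> q; rewrite /moves /= act_row_flipV => -[Yq _].
    by rewrite -(row_flipK r q); apply: (proj1 (rowY (flip_mxP r) _)).
  - rewrite -subset0 => q [[_ /= q0]]; rewrite /moves /= act_row_flipV => -[_ /=].
    by rewrite minor_flip_r oppr_gt0 => /(lt_trans q0); rewrite ltxx.
  - apply: (subset_measure0 _ _ _ z0).
    + apply: measurableD => //; apply: measurableU => //.
      by apply: borel_preimage => //; exact: continuous_act.
    + by apply: measurableI => //; apply: borel_eq; exact: continuous_minor_re.
    + move=> q [Yq nq]; split => //=; apply: contrapT => /eqP; rewrite neq_lt => /orP[q0|q0].
        apply: nq; right; rewrite /moves /= act_row_flipV; split; last by rewrite /= minor_flip_r oppr_gt0.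
        exact: (proj1 (rowY (flip_mxP r) _)).
      by apply: nq; left.
have VA : stiefel_chart `<=` A by move=> q [[Yq _] zq].
have AM : A `<=` M by move=> q /AY/YM.
have half2 : (mu (A `&` E) = 2%:E * mu (stiefel_chart `&` E))%E.
  apply: (measure_halves mu_inv (s := row_flip p)) => //.
  - exact: rowM.
  - exact: measurable_stiefel_chart.
  - move=> q; rewrite /moves /= act_row_flipV => -[[Yq _] /=]; rewrite minor_flip_p => zq.
    split => //; rewrite -(row_flipK p q); exact: (proj1 (rowY (flip_mxP p) _)).
  - rewrite -subset0 => q [[[_ /= q0] _]]; rewrite /moves /= act_row_flipV => -[[_ /=]].
    by rewrite act_row_flip eqxx oppr_gt0 => /(lt_trans q0); rewrite ltxx.
  - apply: (subset_measure0 _ _ _ a0).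
    + apply: measurableD => //; apply: measurableU; first exact: measurable_stiefel_chart.
      by apply: borel_preimage; [exact: continuous_act|exact: measurable_stiefel_chart].
    + by apply: measurableI => //; apply: borel_eq; exact: continuous_entry.
    + move=> q [[Yq zq] nq]; split => //=; apply: contrapT => /eqP; rewrite neq_lt => /orP[q0|q0].
        apply: nq; right; rewrite /moves /= act_row_flipV; split; last by rewrite /= minor_flip_p.
        split; last by rewrite /= act_row_flip eqxx oppr_gt0.
        exact: (proj1 (rowY (flip_mxP p) _)).
      by apply: nq; left.
by rewrite half1 half2 muleA -EFinM -natrM.
Qed.

End stiefel_covering.

(** * The quadratic equations of frames and their gradients *)

Section frame_constraints.
Context {R : realType} {n : nat}.
Implicit Types q : quatn R n.

Lemma sum4 (F : 'I_4 -> R) : \sum_c F c = F 0 + F 1 + F 2 + F 3.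
Proof.
rewrite !big_ord_recl big_ord0 addr0 !addrA.
by congr (F _ + F _ + F _ + F _); apply: val_inj.
Qed.

(* The quadratic forms |a|^2, |b|^2, 2 Re <a, b> and 2 Im <a, b> cutting out the frames. *)
Definition frame_form (l : nat) : 'M[R]_4 := \matrix_(c, c')
  (nth [::] (nth [::]
    [:: [:: [:: 1; 0; 0; 0]; [:: 0; 1; 0; 0]; [::]; [::]];
        [:: [::]; [::]; [:: 0; 0; 1; 0]; [:: 0; 0; 0; 1]];
        [:: [:: 0; 0; 1; 0]; [:: 0; 0; 0; 1]; [:: 1; 0; 0; 0]; [:: 0; 1; 0; 0]];
        [:: [:: 0; 0; 0; -1]; [:: 0; 0; 1; 0]; [:: 0; 1; 0; 0]; [:: -1; 0; 0; 0]]] l) c)`_c'.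

Lemma frame_form_sym l : (l < 4)%N -> (frame_form l)^T = frame_form l.
Proof.
move=> l4; apply/matrixP => c c'; rewrite !mxE.
move: l4 c c'; case: l => [|[|[|[|//]]]] _; apply: forall_I4; exact: forall_I4.
Qed.

Let mulE q l m c : (q *m frame_form l) m c =
  q m 0 * frame_form l 0 c + q m 1 * frame_form l 1 c +
  q m 2 * frame_form l 2 c + q m 3 * frame_form l 3 c.
Proof. by rewrite mxE sum4. Qed.

Lemma frame_form0 q m : [/\ (q *m frame_form 0) m 0 = q m 0, (q *m frame_form 0) m 1 = q m 1,
  (q *m frame_form 0) m 2 = 0 & (q *m frame_form 0) m 3 = 0].
Proof. by split; rewrite mulE ![frame_form 0 _ _]mxE /=; ring. Qed.

Lemma frame_form1 q m : [/\ (q *m frame_form 1) m 0 = 0, (q *m frame_form 1) m 1 = 0,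
  (q *m frame_form 1) m 2 = q m 2 & (q *m frame_form 1) m 3 = q m 3].
Proof. by split; rewrite mulE ![frame_form 1 _ _]mxE /=; ring. Qed.

Lemma frame_form2 q m : [/\ (q *m frame_form 2) m 0 = q m 2, (q *m frame_form 2) m 1 = q m 3,
  (q *m frame_form 2) m 2 = q m 0 & (q *m frame_form 2) m 3 = q m 1].
Proof. by split; rewrite mulE ![frame_form 2 _ _]mxE /=; ring. Qed.

Lemma frame_form3 q m : [/\ (q *m frame_form 3) m 0 = - q m 3, (q *m frame_form 3) m 1 = q m 2,
  (q *m frame_form 3) m 2 = q m 1 & (q *m frame_form 3) m 3 = - q m 0].
Proof. by split; rewrite mulE ![frame_form 3 _ _]mxE /=; ring. Qed.

Lemma dotq4 (p q : quatn R n) : dotq p q =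
  \sum_m (p m 0 * q m 0 + p m 1 * q m 1 + p m 2 * q m 2 + p m 3 * q m 3).
Proof. by apply: eq_bigr => m _; rewrite sum4. Qed.

(** Reduces an inner product to a polynomial identity in one row: summed over the rows of a frame,
    the four forms give 1, 1, 0 and 0. *)
Lemma dotq_frame (p q q' : quatn R n) c1 c2 c3 c4 v : frame q ->
  (forall m, p m 0 * q' m 0 + p m 1 * q' m 1 + p m 2 * q' m 2 + p m 3 * q' m 3 =
    c1 * norm_a q m + c2 * norm_b q m + c3 * re_ab q m + c4 * im_ab q m) ->
  v = c1 + c2 -> dotq p q' = v.
Proof.
move=> [a1 b1 re0 im0] pq ->; rewrite dotq4; under eq_bigr do rewrite pq.
by rewrite !big_split/= -!mulr_sumr a1 b1 re0 im0 !mulr1 !mulr0 !addr0.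
Qed.

Lemma frame_constraint l q : (l < 4)%N -> frame q ->
  dotq (q *m frame_form l) q = [:: 1; 1; 0; 0]`_l.
Proof.
case: l => [|[|[|[|//]]]] _ fq /=.
- by apply: (dotq_frame (c1 := 1) (c2 := 0) (c3 := 0) (c4 := 0) fq) => [m|];
    [have [-> -> -> ->] := frame_form0 q m; rewrite /norm_a|]; ring.
- by apply: (dotq_frame (c1 := 0) (c2 := 1) (c3 := 0) (c4 := 0) fq) => [m|];
    [have [-> -> -> ->] := frame_form1 q m; rewrite /norm_b|]; ring.
- by apply: (dotq_frame (c1 := 0) (c2 := 0) (c3 := 2) (c4 := 0) fq) => [m|];
    [have [-> -> -> ->] := frame_form2 q m; rewrite /re_ab|]; ring.
- by apply: (dotq_frame (c1 := 0) (c2 := 0) (c3 := 0) (c4 := 2) fq) => [m|];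
    [have [-> -> -> ->] := frame_form3 q m; rewrite /im_ab|]; ring.
Qed.

Lemma frame_gram l l' q : (l < 4)%N -> (l' < 4)%N -> frame q ->
  dotq (q *m frame_form l) (q *m frame_form l') = if l == l' then [:: 1; 1; 2; 2]`_l else 0.
Proof.
move=> l4 l'4 fq.
(* Entry (l, l') lists the coefficients of [norm_a], [norm_b], [re_ab] and [im_ab] in the product of
   the l-th and l'-th half gradients. Off the diagonal only the last two occur, and these sum to 0
   on a frame. *)
pose tbl : seq (seq (R * R * R * R)) :=
  [:: [:: (1, 0, 0, 0); (0, 0, 0, 0); (0, 0, 1, 0); (0, 0, 0, 1)];
      [:: (0, 0, 0, 0); (0, 1, 0, 0); (0, 0, 1, 0); (0, 0, 0, 1)];
      [:: (0, 0, 1, 0); (0, 0, 1, 0); (1, 1, 0, 0); (0, 0, 0, 0)];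
      [:: (0, 0, 0, 1); (0, 0, 0, 1); (0, 0, 0, 0); (1, 1, 0, 0)]].
pose t := nth (0, 0, 0, 0) (nth [::] tbl l) l'.
apply: (dotq_frame (c1 := t.1.1.1) (c2 := t.1.1.2) (c3 := t.1.2) (c4 := t.2) fq) => [m|].
  have [a0 a1 a2 a3] := frame_form0 q m; have [b0 b1 b2 b3] := frame_form1 q m.
  have [c0 c1 c2 c3] := frame_form2 q m; have [d0 d1 d2 d3] := frame_form3 q m.
  rewrite /t /norm_a /norm_b /re_ab /im_ab.
  move: l4 l'4; case: l {t} => [|[|[|[|//]]]] _; case: l' => [|[|[|[|//]]]] _;
    rewrite ?a0 ?a1 ?a2 ?a3 ?b0 ?b1 ?b2 ?b3 ?c0 ?c1 ?c2 ?c3 ?d0 ?d1 ?d2 ?d3 /=; ring.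
rewrite /t; move: l4 l'4; case: l {t} => [|[|[|[|//]]]] _; case: l' => [|[|[|[|//]]]] _ /=; ring.
Qed.

End frame_constraints.

Section stiefel_chart.
Context {R : realType} {w N d : nat} (C : columns w) (fo dpo : seq nat).
Hypothesis w0 : (0 < w)%N.
Hypothesis fodpo : perm_eq (fo ++ dpo) (iota 0 (2 * w)).
Let b := (w * N.+1)%N.
Hypothesis dE : d = (b + size fo)%N.
Variable tail : 'rV[R]_d -> seq R.
Hypothesis tail_free : forall x i, (i < size fo)%N ->
  (tail x)`_(nth 0%N fo i) = (seq_of_row x)`_(b + i).

(* The coordinates of all rows but the last two are free; among the 2 w
   coordinates of the last two rows those at the positions fo are free and those
   at the positions dpo are determined by the constraints. *)
Definition free_pos (j : nat) : nat := if (j < b)%N then j else (b + nth 0%N fo (j - b))%N.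
Definition free (j : 'I_d) : 'I_N.+3 * 'I_4 := crd N.+2 C (free_pos j).
Definition dep (l : 'I_(size dpo)) : 'I_N.+3 * 'I_4 := crd N.+2 C (b + nth 0%N dpo l).

Definition row_chart (x : 'rV[R]_d) : quatn R N.+3 :=
  of_seq N.+2 C (take b (seq_of_row x) ++ tail x).

Let bw : (w * N.+3 = b + 2 * w)%N.
Proof. by rewrite /b; lia. Qed.

Let fo_lt i : (i < size fo)%N -> (nth 0%N fo i < 2 * w)%N.
Proof.
move=> i_lt; have : nth 0%N fo i \in iota 0 (2 * w).
  by rewrite -(perm_mem fodpo) mem_cat mem_nth.
by rewrite mem_iota.
Qed.

Lemma stiefel_split (F : 'I_N.+3 -> 'I_4 -> R) :
  (forall m c, colpos C c = None -> F m c = 0) ->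
  \sum_m \sum_c F m c = \sum_j F (free j).1 (free j).2 + \sum_l F (dep l).1 (dep l).2.
Proof.
move=> F0; rewrite (sum_crd w0 F0).
pose G j := F (crd N.+2 C j).1 (crd N.+2 C j).2.
rewrite -(big_mkord xpredT G) bw big_mkord (@big_split_ord _ _ _ b (2 * w)%N)/=.
rewrite -[\sum_(j < d) _](big_mkord xpredT (fun j => G (free_pos j))) dE big_mkord (@big_split_ord _ _ _ b (size fo))/=.
rewrite -addrA; congr (_ + _).
  by apply: eq_bigr => j _; rewrite /free_pos ltn_ord.
transitivity (\sum_(i <- fo ++ dpo) G (b + i)%N).
  by rewrite (perm_big _ fodpo) -[in RHS](subn0 (2 * w)%N) -/(index_iota 0 (2 * w)) big_mkord.
rewrite big_cat/=; congr (_ + _).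
  rewrite (big_nth 0%N) big_mkord; apply: eq_bigr => i _.
  by rewrite /free_pos ltnNge leq_addr/= addKn.
by rewrite (big_nth 0%N) big_mkord.
Qed.

Let size_take_b (x : 'rV[R]_d) : size (take b (seq_of_row x)) = b.
Proof. by rewrite size_takel// size_seq_of_row dE leq_addr. Qed.

Lemma row_chart_tail x i : (i < 2 * w)%N ->
  row_chart x (crd N.+2 C (b + i)).1 (crd N.+2 C (b + i)).2 = (tail x)`_i.
Proof.
move=> i_lt; rewrite of_seq_crd//; last by rewrite bw ltn_add2l.
by rewrite nth_cat size_take_b ltnNge leq_addr/= addKn.
Qed.

Lemma row_chart_free x j : row_chart x (free j).1 (free j).2 = x 0 j.
Proof.
rewrite /free /free_pos; case: ifPn => jb.
  rewrite of_seq_crd//; last by rewrite bw ltn_addr.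
  by rewrite nth_cat size_take_b jb nth_take// nth_seq_of_row.
rewrite -leqNgt in jb; have jf : (j - b < size fo)%N.
  by rewrite ltn_subLR// -dE.
rewrite row_chart_tail; last exact: fo_lt.
by rewrite tail_free// subnKC// nth_seq_of_row.
Qed.

Lemma row_chart_null x m c : colpos C c = None -> row_chart x m c = 0.
Proof. exact: of_seq_null. Qed.

Lemma row_chart_C1 (U : set 'rV[R]_d) :
  (forall i, (i < 2 * w)%N -> C1_on U (fun x => (tail x)`_i)) ->
  forall m c, C1_on U (fun x => row_chart x m c).
Proof.
move=> cU m c; under eq_fun do rewrite mxE.
case E : (colpos C c) => [k|]; last exact: C1_cst.
have [kw _] := colposP E.
have jw : (w * m + k < w * N.+3)%N by exact: block_lt.
under eq_fun do rewrite nth_cat size_take_b.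
case: (ltnP (w * m + k) b) => jb; last by apply: cU; rewrite ltn_subLR// -bw.
have jd : (w * m + k < d)%N by rewrite dE ltn_addr.
under eq_fun do rewrite nth_take// (nth_seq_of_row _ (Ordinal jd)).
exact: C1_coord.
Qed.

Lemma row_chartP (q : quatn R N.+3) :
  (forall m c, colpos C c = None -> q m c = 0) ->
  let x := \row_j q (free j).1 (free j).2 in
  (forall i, (i < 2 * w)%N ->
    (tail x)`_i = q (crd N.+2 C (b + i)).1 (crd N.+2 C (b + i)).2) ->
  row_chart x = q.
Proof.
move=> q0 x tx; apply: of_seqP => // j jw; rewrite nth_cat size_take_b.
case: ifPn => jb.
  have jd : (j < d)%N by rewrite dE ltn_addr.
  by rewrite nth_take// (nth_seq_of_row _ (Ordinal jd)) mxE /free /free_pos /= jb.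
by rewrite -leqNgt in jb; rewrite tx ?subnKC// ltn_subLR// -bw.
Qed.

Definition row_r : 'I_N.+3 := inord N.+1.
Definition row_p : 'I_N.+3 := inord N.+2.

Lemma row_pr : row_p != row_r.
Proof. by rewrite -(inj_eq val_inj) /= !inordK// -[N.+2 == _]/(N.+1.+1 == _) eqn_leq ltnn. Qed.

Lemma crd_row m k : (k < w)%N -> crd N.+2 C (w * m + k) = (inord m, cols C k).
Proof. by move=> kw; rewrite /crd mulnC divnMDl// divn_small// addn0 modnMDl modn_small. Qed.

Lemma crd_r k : (k < w)%N -> crd N.+2 C (b + k) = (row_r, cols C k).
Proof. exact: crd_row. Qed.

Lemma crd_p k : (k < w)%N -> crd N.+2 C (b + (w + k)) = (row_p, cols C k).
Proof. by rewrite addnA -[(b + w)%N]/((w * N.+1 + w)%N) addnC -mulnSr addnC; exact: crd_row. Qed.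

Lemma sum_rows (F : 'I_N.+3 -> R) :
  \sum_m F m = \sum_(m < N.+1) F (inord m) + F row_r + F row_p.
Proof.
rewrite (eq_bigr (fun m : 'I_N.+3 => F (inord m))) => [|m _]; last by rewrite inord_val.
by rewrite 2!big_ord_recr.
Qed.

Lemma row_chart_row x m k : (m < N.+1)%N -> (k < w)%N ->
  row_chart x (inord m) (cols C k) = (seq_of_row x)`_(w * m + k).
Proof.
move=> mN kw; have jb : (w * m + k < b)%N.
  apply: (@leq_trans (w * m.+1)); first by rewrite mulnS addnC ltn_add2r.
  by rewrite leq_mul2l mN orbT.
have := @of_seq_crd R w N.+2 C w0 (take b (seq_of_row x) ++ tail x) (w * m + k).
rewrite crd_row//= /row_chart => ->; last by rewrite bw ltn_addr.
by rewrite nth_cat size_take_b jb nth_take.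
Qed.

End stiefel_chart.

(** * Planar polygons *)

Section small_determinants.
Context {R : comNzRingType}.
Implicit Types f : nat -> nat -> R.

Lemma det2 f : \det (\matrix_(i < 2, j < 2) f i j) = f 0 0 * f 1 1 - f 0 1 * f 1 0.
Proof.
rewrite (expand_det_row _ ord0) !big_ord_recl big_ord0 /cofactor !det_mx11 !mxE /= /bump /=.
by rewrite expr0 expr1; ring.
Qed.

Definition skip (i j : nat) f : nat -> nat -> R := fun a b => f (bump i a) (bump j b).

Lemma minor_fun k f (i j : 'I_k.+1) : row' i (col' j (\matrix_(i < k.+1, j < k.+1) f i j)) =
  \matrix_(i' < k, j' < k) skip i j f i' j'.
Proof. by apply/matrixP => i' j'; rewrite !mxE. Qed.

Lemma det3 f : \det (\matrix_(i < 3, j < 3) f i j) =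
  f 0 0 * (f 1 1 * f 2 2 - f 1 2 * f 2 1) - f 0 1 * (f 1 0 * f 2 2 - f 1 2 * f 2 0) +
  f 0 2 * (f 1 0 * f 2 1 - f 1 1 * f 2 0).
Proof.
rewrite (expand_det_row _ ord0) !big_ord_recl big_ord0 /cofactor !minor_fun !det2 !mxE /= /skip /bump /=.
by rewrite expr0 expr1 sqrrN expr1n; ring.
Qed.

(** Shaped for the spatial chart: among the dependent coordinates Re b_r, Re a_p, Re b_p and Im b_p,
    the gradient of |a|^2 meets only the second. *)
Lemma det4 f : f 0 0 = 0 -> f 0 2 = 0 -> f 0 3 = 0 -> \det (\matrix_(i < 4, j < 4) f i j) =
  - f 0 1 * (f 1 0 * (f 2 2 * f 3 3 - f 2 3 * f 3 2) - f 1 2 * (f 2 0 * f 3 3 - f 2 3 * f 3 0) +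
    f 1 3 * (f 2 0 * f 3 2 - f 2 2 * f 3 0)).
Proof.
move=> f00 f02 f03.
rewrite (expand_det_row _ ord0) !big_ord_recl big_ord0 /cofactor !minor_fun !det3 !mxE /= /skip /bump /=.
by rewrite !add1n f00 f02 f03 expr1; ring.
Qed.

End small_determinants.

Lemma C1_nth (R : realType) d (U : set 'rV[R]_d) k : C1_on U (fun x => (seq_of_row x)`_k).
Proof.
have [kd|dk] := ltnP k d.
  by under eq_fun do rewrite (nth_seq_of_row _ (Ordinal kd)); exact: C1_coord.
by under eq_fun do rewrite nth_default ?size_seq_of_row//; exact: C1_cst.
Qed.

Lemma C1_continuousT (R : realType) d (f : 'rV[R]_d -> R) : C1_on setT f -> continuous f.
Proof. by move=> cf x; exact: (C1_continuous cf). Qed.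

Lemma C1_rest_dot (R : realType) d (U : set 'rV[R]_d) k (c : R) (f g : 'I_k -> 'rV[R]_d -> R) :
  open U -> (forall m, C1_on U (f m)) -> (forall m, C1_on U (g m)) ->
  C1_on U (fun x => c - \sum_(m < k) f m x * g m x).
Proof.
move=> oU cf cg; apply: (C1_sub oU); first exact: C1_cst.
by apply: (C1_sum oU) => m; apply: (C1_mul oU (cf m) (cg m)).
Qed.

Section planar_frames.
Context {R : realType} {N : nat}.

Definition planar_frame : set (quatn R N.+3) :=
  @frame R N.+3 `&` [set q | forall m c, colpos columns2 c = None -> q m c = 0].

Implicit Types l : seq R.

(* What the rows before the last two leave of |a|^2, |b|^2 and <a, b>. *)
Definition rest_a l : R := 1 - \sum_(m < N.+1) l`_(2 * m) ^+ 2.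
Definition rest_b l : R := 1 - \sum_(m < N.+1) l`_(2 * m + 1) ^+ 2.
Definition rest_ab l : R := 0 - \sum_(m < N.+1) l`_(2 * m) * l`_(2 * m + 1).
Definition gram_det l : R := rest_a l * rest_b l - rest_ab l ^+ 2.
Definition last_a l : R := rest_a l - l`_(2 * N.+1) ^+ 2.

(** Within the last two rows, a = (x, y) has squared norm [rest_a], and b is recovered from its
    inner product [rest_ab] with a and from z = a_p b_r - a_r b_p. By Lagrange's identity z^2 =
    [gram_det]. *)
Definition planar_tail l : seq R :=
  let x := l`_(2 * N.+1) in let y := Num.sqrt (last_a l) in let z := Num.sqrt (gram_det l) in
  [:: x; (rest_ab l * x + z * y) / rest_a l; y; (rest_ab l * y - z * x) / rest_a l].

Let fo : seq nat := [:: 0].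
Let dpo : seq nat := [:: 1; 2; 3].

Context {d : nat}.
Hypothesis dE : d = (2 * N.+1 + size fo)%N.

Definition planar_dom : set 'rV[R]_d :=
  [set x | 0 < last_a (seq_of_row x)] `&` [set x | 0 < gram_det (seq_of_row x)].

Definition planar_chart (x : 'rV[R]_d) : quatn R N.+3 :=
  row_chart columns2 (fun x => planar_tail (seq_of_row x)) x.

Let w0 : (0 < 2)%N. Proof. by []. Qed.
Let perm : perm_eq (fo ++ dpo) (iota 0 (2 * 2)). Proof. by []. Qed.

Let tail_free (x : 'rV[R]_d) i : (i < size fo)%N ->
  (planar_tail (seq_of_row x))`_(nth 0%N fo i) = (seq_of_row x)`_(2 * N.+1 + i).
Proof. by case: i => [|//] _; rewrite addn0. Qed.

Let cols0 : cols columns2 0 = 0.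
Proof. by apply: val_inj; rewrite /= inordK. Qed.

Let cols1 : cols columns2 1 = 2.
Proof. by apply: val_inj; rewrite /= inordK. Qed.

Let chart_row (x : 'rV[R]_d) m : (m < N.+1)%N ->
  [/\ planar_chart x (inord m) 0 = (seq_of_row x)`_(2 * m),
      planar_chart x (inord m) 2 = (seq_of_row x)`_(2 * m + 1) &
      forall m, planar_chart x m 1 = 0 /\ planar_chart x m 3 = 0].
Proof.
move=> mN; have e k := @row_chart_row R 2 N d columns2 fo dpo w0 perm dE
  (fun x => planar_tail (seq_of_row x)) x m k mN.
split; last by move=> m'; split; exact: row_chart_null.
  by have := e 0 isT; rewrite cols0 addn0.
by have := e 1 isT; rewrite cols1.
Qed.

Let chart_last (x : 'rV[R]_d) : let t := planar_tail (seq_of_row x) in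
  [/\ planar_chart x row_r 0 = t`_0, planar_chart x row_r 2 = t`_1,
      planar_chart x row_p 0 = t`_2 & planar_chart x row_p 2 = t`_3].
Proof.
have e i := @row_chart_tail R 2 N d columns2 fo dpo w0 perm dE
  (fun x => planar_tail (seq_of_row x)) x i.
split.
- by have := e 0 isT; rewrite crd_r// cols0.
- by have := e 1 isT; rewrite crd_r// cols1.
- by have := e 2 isT; rewrite (@crd_p 2 N columns2 w0 0)// cols0.
- by have := e 3 isT; rewrite (@crd_p 2 N columns2 w0 1)// cols1.
Qed.

Let rest_a_gt0 l : 0 < last_a l -> 0 < rest_a l.
Proof. by rewrite subr_gt0; apply: le_lt_trans; exact: sqr_ge0. Qed.

Let tail_eqs l : 0 < last_a l -> 0 < gram_det l -> let t := planar_tail l in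
  [/\ t`_0 ^+ 2 + t`_2 ^+ 2 = rest_a l, t`_1 ^+ 2 + t`_3 ^+ 2 = rest_b l,
      t`_0 * t`_1 + t`_2 * t`_3 = rest_ab l &
      t`_2 * t`_1 - t`_0 * t`_3 = Num.sqrt (gram_det l)].
Proof.
move=> P0 D0 /=; have a0 := rest_a_gt0 P0.
have := sqr_sqrtr (ltW P0); have := sqr_sqrtr (ltW D0).
move: (Num.sqrt (gram_det l)) (Num.sqrt (last_a l)) => z y.
rewrite /gram_det /last_a; move: (l`_ _) a0.
move: (rest_a l) (rest_b l) (rest_ab l) => a b g x a0 z2 y2.
have aN : a != 0 by rewrite gt_eqF.
have xy : x ^+ 2 + y ^+ 2 = a by rewrite y2; ring.
split => //.
- transitivity ((g ^+ 2 + z ^+ 2) * (x ^+ 2 + y ^+ 2) / a ^+ 2); first by field.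
  by rewrite xy z2; field.
- transitivity (g * (x ^+ 2 + y ^+ 2) / a); first by field.
  by rewrite xy; field.
- transitivity (z * (x ^+ 2 + y ^+ 2) / a); first by field.
  by rewrite xy; field.
Qed.

Lemma planar_chart_frame x : planar_dom x -> planar_frame (planar_chart x).
Proof.
move=> [P0 D0]; split; last by move=> m c; exact: row_chart_null.
have [t1 t2 t3 _] := tail_eqs P0 D0; have [r0 r2 p0 p2] := chart_last x.
have [_ _ z] := chart_row x (ltn0Sn N).
have z1 m : planar_chart x m 1 = 0 by have [] := z m.
have z3 m : planar_chart x m 3 = 0 by have [] := z m.
split; rewrite sum_rows.
- rewrite /norm_a !z1 r0 p0 -addrA; move: t1; rewrite /rest_a => t1.
  rewrite (eq_bigr (fun m : 'I_N.+1 => (seq_of_row x)`_(2 * m) ^+ 2)); first lra.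
  by move=> m _; have [-> _ _] := chart_row x (ltn_ord m); rewrite z1; ring.
- rewrite /norm_b !z3 r2 p2 -addrA; move: t2; rewrite /rest_b => t2.
  rewrite (eq_bigr (fun m : 'I_N.+1 => (seq_of_row x)`_(2 * m + 1) ^+ 2)); first lra.
  by move=> m _; have [_ -> _] := chart_row x (ltn_ord m); rewrite z3; ring.
- rewrite /re_ab !z1 !z3 r0 p0 r2 p2 -addrA; move: t3; rewrite /rest_ab => t3.
  rewrite (eq_bigr (fun m : 'I_N.+1 => (seq_of_row x)`_(2 * m) * (seq_of_row x)`_(2 * m + 1))); first lra.
  by move=> m _; have [-> -> _] := chart_row x (ltn_ord m); rewrite z1 z3; ring.
- rewrite /im_ab !z1 !z3 big1 => [|m _]; first by ring.
  by rewrite z1 z3; ring.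
Qed.

Let last_det x : planar_dom x ->
  planar_chart x row_p 0 * planar_chart x row_r 2 - planar_chart x row_r 0 * planar_chart x row_p 2 =
  Num.sqrt (gram_det (seq_of_row x)).
Proof.
by move=> [P0 D0]; have [_ _ _ <-] := tail_eqs P0 D0; have [-> -> -> ->] := chart_last x.
Qed.

Let planar_minor (q : quatn R N.+3) p r : q p 1 = 0 -> minor_re q p r =
  q p 0 * (q p 0 * q r 2 - q r 0 * q p 2) + q p 0 * (q r 1 * q p 3).
Proof. by move=> q1; rewrite /minor_re /norm_a /re_ab /im_ab !q1; ring. Qed.

Lemma image_planar_chart :
  planar_chart @` planar_dom = stiefel_chart row_p row_r planar_frame.
Proof.
apply/seteqP; split => [_ [x Ux <-]|q [[[[a1 b1 ab _] q0] p0] z0]].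
  have p0 : 0 < planar_chart x row_p 0.
    by have [_ _ -> _] := chart_last x; rewrite sqrtr_gt0; case: Ux.
  split; first by split => //; exact: planar_chart_frame.
  have [_ _ z] := chart_row x (ltn0Sn N); have [z1 z3] := z row_p.
  by rewrite /= planar_minor// z3 !mulr0 addr0 pmulr_rgt0// last_det// sqrtr_gt0; case: Ux.
have q1 m : q m 1 = 0 by exact: q0.
have q3 m : q m 3 = 0 by exact: q0.
rewrite /= in p0; move: z0; rewrite /= planar_minor// q3 !mulr0 addr0 pmulr_rgt0// => z0.
pose x : 'rV[R]_d := \row_j q (@free 2 N d columns2 fo j).1 (@free 2 N d columns2 fo j).2.
have xE j (jd : (j < d)%N) : (seq_of_row x)`_j =
    q (crd N.+2 columns2 (@free_pos 2 N fo j)).1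
      (crd N.+2 columns2 (@free_pos 2 N fo j)).2.
  by rewrite (nth_seq_of_row _ (Ordinal jd)) mxE.
have xb : (seq_of_row x)`_(2 * N.+1) = q row_r 0.
  rewrite xE ?dE ?addn1// /free_pos ltnn subnn -[nth 0%N fo 0]/0%N.
  by rewrite (@crd_r 2 N columns2 w0 0)// cols0.
have xrow m k : (m < N.+1)%N -> (k < 2)%N ->
    (seq_of_row x)`_(2 * m + k) = q (inord m) (cols columns2 k).
  move=> mN k2; have jb : (2 * m + k < 2 * N.+1)%N by lia.
  by rewrite xE ?dE ?ltn_addr// /free_pos jb crd_row.
have ra : rest_a (seq_of_row x) = q row_r 0 ^+ 2 + q row_p 0 ^+ 2.
  move: a1; rewrite sum_rows /norm_a !q1 /rest_a => <-.
  rewrite (eq_bigr (fun m : 'I_N.+1 => (seq_of_row x)`_(2 * m) ^+ 2)); first ring.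
  by move=> m _; rewrite -[(2 * m)%N]addn0 xrow// cols0 q1; ring.
have rb : rest_b (seq_of_row x) = q row_r 2 ^+ 2 + q row_p 2 ^+ 2.
  move: b1; rewrite sum_rows /norm_b !q3 /rest_b => <-.
  rewrite (eq_bigr (fun m : 'I_N.+1 => (seq_of_row x)`_(2 * m + 1) ^+ 2)); first ring.
  by move=> m _; rewrite xrow// cols1 q3; ring.
have rab : rest_ab (seq_of_row x) = q row_r 0 * q row_r 2 + q row_p 0 * q row_p 2.
  move: ab; rewrite sum_rows /re_ab !q1 /rest_ab.
  rewrite (eq_bigr (fun m : 'I_N.+1 => (seq_of_row x)`_(2 * m) * (seq_of_row x)`_(2 * m + 1))).
    by move=> e; lra.
  by move=> m _; rewrite -{1}[(2 * m)%N]addn0 !xrow// cols0 cols1 q1; ring.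
have la : last_a (seq_of_row x) = q row_p 0 ^+ 2 by rewrite /last_a ra xb; ring.
have gd : gram_det (seq_of_row x) = (q row_p 0 * q row_r 2 - q row_r 0 * q row_p 2) ^+ 2.
  by rewrite /gram_det ra rb rab; ring.
exists x; first by split; rewrite /= ?la ?gd exprn_gt0.
have aN : q row_r 0 ^+ 2 + q row_p 0 ^+ 2 != 0.
  by rewrite gt_eqF// ltr_wpDl ?sqr_ge0// exprn_gt0.
apply: (row_chartP w0 perm dE) => // i i4.
rewrite -/x /planar_tail xb la gd ra rab !sqrtr_sqr !gtr0_norm//.
case: i i4 => [|[|[|[|//]]]] _.
- by rewrite crd_r// cols0.
- by rewrite crd_r// cols1 /=; field.
- by rewrite (@crd_p 2 N columns2 w0 0)// cols0.
- by rewrite (@crd_p 2 N columns2 w0 1)// cols1 /=; field.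
Qed.

Section smoothness.
Variable U : set 'rV[R]_d.
Hypothesis oU : open U.

Lemma rest_a_C1 : C1_on U (fun x => rest_a (seq_of_row x)).
Proof.
exact: (@C1_rest_dot R d U N.+1 1 (fun m x => (seq_of_row x)`_(2 * m))
  (fun m x => (seq_of_row x)`_(2 * m)) oU (fun m => C1_nth _) (fun m => C1_nth _)).
Qed.

Lemma rest_b_C1 : C1_on U (fun x => rest_b (seq_of_row x)).
Proof.
exact: (@C1_rest_dot R d U N.+1 1 (fun m x => (seq_of_row x)`_(2 * m + 1))
  (fun m x => (seq_of_row x)`_(2 * m + 1)) oU (fun m => C1_nth _) (fun m => C1_nth _)).
Qed.

Lemma rest_ab_C1 : C1_on U (fun x => rest_ab (seq_of_row x)).
Proof.
exact: (@C1_rest_dot R d U N.+1 0 (fun m x => (seq_of_row x)`_(2 * m))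
  (fun m x => (seq_of_row x)`_(2 * m + 1)) oU (fun m => C1_nth _) (fun m => C1_nth _)).
Qed.

Lemma gram_det_C1 : C1_on U (fun x => gram_det (seq_of_row x)).
Proof. exact: (C1_sub oU (C1_mul oU rest_a_C1 rest_b_C1) (C1_sqr oU rest_ab_C1)). Qed.

Lemma last_a_C1 : C1_on U (fun x => last_a (seq_of_row x)).
Proof. exact: (C1_sub oU rest_a_C1 (C1_sqr oU (C1_nth (2 * N.+1)))). Qed.

End smoothness.

Let openU : open planar_dom.
Proof.
apply: openI; apply: open_gt0; apply: C1_continuousT.
- exact: last_a_C1 openT.
- exact: gram_det_C1 openT.
Qed.

Lemma planar_chart_C1 m c : C1_on planar_dom (fun x => planar_chart x m c).
Proof.
apply: (row_chart_C1 columns2 w0 perm dE) => i i4.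
have y0 x : planar_dom x -> 0 < last_a (seq_of_row x) by case.
have z0 x : planar_dom x -> 0 < gram_det (seq_of_row x) by case.
have a0 x : planar_dom x -> rest_a (seq_of_row x) != 0.
  by move=> Ux; rewrite gt_eqF//; exact: rest_a_gt0 (y0 x Ux).
have c_x := @C1_nth R d planar_dom (2 * N.+1).
have c_y := C1_sqrt openU y0 (last_a_C1 openU).
have c_z := C1_sqrt openU z0 (gram_det_C1 openU).
have c_i := C1_inv openU a0 (rest_a_C1 openU).
have c_ab := rest_ab_C1 openU.
case: i i4 => [|[|[|[|i]]]] i4; last by exfalso; move: i4; clear.
- exact: c_x.
- exact: (C1_mul openU (C1_add openU (C1_mul openU c_ab c_x) (C1_mul openU c_z c_y)) c_i).
- exact: c_y.
- exact: (C1_mul openU (C1_sub openU (C1_mul openU c_ab c_y) (C1_mul openU c_z c_x)) c_i).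
Qed.

Lemma planar_local_param M : stiefel_chart row_p row_r planar_frame `<=` M ->
  local_param M planar_dom planar_chart.
Proof.
move=> VM; apply: (@graph_local_param R N.+3 d (@free 2 N d columns2 fo)) => //.
- exact: planar_chart_C1.
- exact: (row_chart_free columns2 w0 perm dE).
- by rewrite image_planar_chart.
Qed.

(** The half gradients of |a|^2, |b|^2 and 2 <a, b> have squared norms 1, 1 and 2. Their minor at
    b_r, a_p and b_p is - a_p z, with a_p^2 = [last_a] and z^2 = [gram_det]. *)
Lemma planar_density x : planar_dom x ->
  Num.sqrt (\det (metric_tensor planar_chart x)) = Num.sqrt 2 *
  (pos_powR (- 2^-1) (last_a (seq_of_row x)) * pos_powR (- 2^-1) (gram_det (seq_of_row x))).
Proof.
move=> Ux; have [P0 D0] := Ux.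
have fr y (Uy : planar_dom y) := (planar_chart_frame Uy).1.
have l4 (l : 'I_3) : (l < 4)%N by apply: (leq_trans (ltn_ord l)).
have nullq y m c : colpos columns2 c = None -> planar_chart y m c = 0 by exact: row_chart_null.
have := @det_metric_tensor R N.+3 d 3 (@free 2 N d columns2 fo) (@dep 2 N columns2 dpo)
  (fun _ c => colpos columns2 c = None) (fun k : 'I_3 => frame_form k) (fun l : 'I_3 => [:: 1; 1; 0; 0]`_l)
  (fun l : 'I_3 => [:: 1; 1; 2; 2]`_l) planar_dom planar_chart.
move=> /(_ (stiefel_split w0 perm dE)) => /(_ (fun k => frame_form_sym (l4 k)) openU planar_chart_C1).
move=> /(_ (row_chart_free columns2 w0 perm dE tail_free) nullq).
have nullS (y : 'rV[R]_d) (l : 'I_3) m c : colpos columns2 c = None ->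
    (planar_chart y *m frame_form l) m c = 0.
  have [f0 f1 f2 f3] := frame_form0 (planar_chart y) m.
  have [g0 g1 g2 g3] := frame_form1 (planar_chart y) m.
  have [h0 h1 h2 h3] := frame_form2 (planar_chart y) m.
  by case: l => [[|[|[|//]]] l3]; move: c; apply: forall_I4 => //= _;
    rewrite ?f1 ?f3 ?g1 ?g3 ?h1 ?h3// nullq.
move=> /(_ nullS (fun k y Uy => frame_constraint (l4 k) (fr y Uy))).
move=> /(_ (fun k k' y Uy => frame_gram (l4 k) (l4 k') (fr y Uy)) x Ux).
rewrite [\prod_l _](_ : _ = 2); last by rewrite !big_ord_recl big_ord0 /= !mul1r mulr1.
have -> : \det (dep_minor (@dep 2 N columns2 dpo) (fun k : 'I_3 => frame_form k) planar_chart x) =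
    - planar_chart x row_p 0 * Num.sqrt (gram_det (seq_of_row x)).
  rewrite -last_det// /dep_minor.
  rewrite (det3 (fun k k' => (planar_chart x *m frame_form k)
    (crd N.+2 columns2 (2 * N.+1 + nth 0%N dpo k')).1
    (crd N.+2 columns2 (2 * N.+1 + nth 0%N dpo k')).2)).
  have c1 : crd N.+2 columns2 (2 * N.+1 + nth 0%N dpo 0) = (row_r, 2).
    by rewrite -cols1; exact: crd_r.
  have c2 : crd N.+2 columns2 (2 * N.+1 + nth 0%N dpo 1) = (row_p, 0).
    by rewrite -cols0; exact: (@crd_p 2 N columns2 w0 0).
  have c3 : crd N.+2 columns2 (2 * N.+1 + nth 0%N dpo 2) = (row_p, 2).
    by rewrite -cols1; exact: (@crd_p 2 N columns2 w0 1).
  rewrite c1 c2 c3 [(_, _).1]/= [(_, _).2]/=.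
  have [f0 f1 f2 f3] := frame_form0 (planar_chart x) row_r.
  have [f0' f1' f2' f3'] := frame_form0 (planar_chart x) row_p.
  have [g0 g1 g2 g3] := frame_form1 (planar_chart x) row_r.
  have [g0' g1' g2' g3'] := frame_form1 (planar_chart x) row_p.
  have [h0 h1 h2 h3] := frame_form2 (planar_chart x) row_r.
  have [h0' h1' h2' h3'] := frame_form2 (planar_chart x) row_p.
  rewrite f2 f0' f2' g2 g0' g2' h2 h0' h2'; ring.
have [_ _ -> _] := chart_last x; rewrite /= exprMn sqrrN !sqr_sqrtr ?ltW// => e.
have p0 : last_a (seq_of_row x) != 0 by rewrite gt_eqF.
have d0 : gram_det (seq_of_row x) != 0 by rewrite gt_eqF.
rewrite !pos_powR_gt0// !powRN !powR12_sqrt ?ltW// -!sqrtrV ?ltW// -!sqrtrM ?invr_ge0 ?ltW//.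
by rewrite -e; congr Num.sqrt; field; apply/andP.
Qed.

Lemma row_sqnorm_planar_chart x : row_sqnorm (planar_chart x) ord0 =
  \sum_(y <- take 2 (seq_of_row x)) y ^+ 2.
Proof.
have -> : ord0 = inord 0 :> 'I_N.+3 by apply: val_inj; rewrite /= inordK.
have [e0 e2 z] := chart_row x (ltn0Sn N); have [z1 z3] := z (inord 0).
rewrite row_sqnormE e0 e2 z1 z3 muln0 add0n.
have : (2 <= size (seq_of_row x))%N by rewrite size_seq_of_row dE; lia.
case: (seq_of_row x) => [//|a [//|b l]] _ /=.
by rewrite !big_cons take0 big_nil; ring.
Qed.

End planar_frames.

Section planar_measure.
Context {R : realType} {N d : nat}.
Local Notation leb := (@lebesgue_measure R).
Local Notation Q := (borel (quatn R N.+3)).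
Local Notation V := (stiefel_chart row_p row_r (@planar_frame R N)).
Hypothesis dE : d = (2 * N.+1 + size [:: 0])%N.

Let rest_cons (x y t : R) l : size l = (2 * N)%N ->
  let L := x :: y :: (l ++ [:: t]) in
  [/\ rest_a (N := N) L = 1 - x ^+ 2 - \sum_(m < N) l`_(2 * m) ^+ 2,
      rest_b (N := N) L = 1 - y ^+ 2 - \sum_(m < N) l`_(2 * m + 1) ^+ 2,
      rest_ab (N := N) L = 0 - x * y - \sum_(m < N) l`_(2 * m) * l`_(2 * m + 1) &
      L`_(2 * N.+1) = t].
Proof.
move=> sl L.
have e (m : 'I_N) : (2 * lift ord0 m = (2 * m).+2)%N by rewrite /= /bump leq0n add1n mulnS.
have e0 (m : 'I_N) : L`_(2 * lift ord0 m) = l`_(2 * m).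
  rewrite e /L /= nth_cat sl ifT//; have := ltn_ord m; lia.
have e1 (m : 'I_N) : L`_(2 * lift ord0 m + 1) = l`_(2 * m + 1).
  rewrite e addSn addSn /L /= nth_cat sl ifT//; have := ltn_ord m; lia.
split.
- rewrite /rest_a big_ord_recl opprD addrA; congr (_ - _ - _).
  by apply: eq_bigr => m _; rewrite e0.
- rewrite /rest_b big_ord_recl opprD addrA; congr (_ - _ - _).
  by apply: eq_bigr => m _; rewrite e1.
- rewrite /rest_ab big_ord_recl opprD addrA; congr (_ - _ - _).
  by apply: eq_bigr => m _; rewrite e0 e1.
- by rewrite mulnS /L /= nth_cat sl ltnn subnn.
Qed.

Let measurable_planar_null :
  measurable ([set q | forall m c, colpos columns2 c = None -> q m c = 0] : set Q).
Proof.
pose Z c : set Q := [set q | forall m, q m c = 0].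
have mZ c : measurable (Z c) by apply: borel_forall_eq0 => m; exact: continuous_entry.
suff e : Z 1 `&` Z 3 = [set q | forall m c, colpos columns2 c = None -> q m c = 0].
  by have := measurableI _ _ (mZ 1) (mZ 3); rewrite e.
apply/seteqP; split => q; last by move=> q0; split => m; exact: q0.
by move=> [q1 q3] m; exact: forall_I4.
Qed.

Lemma measurable_planar_frame : measurable (@planar_frame R N : set Q).
Proof. by apply: measurableI; [exact: measurable_frame|]. Qed.

(** The parameters are the first row, the N middle rows and the free a_r. Integrating a_r turns the
    power -1/2 of [last_a] into the indicator of [rest_a] > 0, which leaves [pos_det2] with exponent
    -1/2; each middle row then adds 1/2. *)
Lemma planar_chart_measure (M : set (quatn R N.+3)) (mu : {measure set Q -> \bar R}) :
  is_riemannian_volume d M mu -> V `<=` M ->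
  exists2 K : R, 0 < K & forall B, measurable B ->
    mu (V `&` [set q | B (row_sqnorm q ord0)]) =
    iter_integral 2 (fun l => (\1_B (\sum_(y <- l) y ^+ 2) * K *
      pos_powR (- 2^-1 + N%:R / 2) (1 - \sum_(y <- l) y ^+ 2))%:E).
Proof.
move=> vol VM.
have [C1 C1_0 C1E] := @iter_integral_ball R 1 (- 2^-1) (lexx _).
have [C2 C2_0 C2E] := @iter_integral_det2 R N (- 2^-1) (lexx _).
have s20 : 0 < Num.sqrt 2 :> R by rewrite sqrtr_gt0.
exists (Num.sqrt 2 * C1 * C2); first by rewrite !mulr_gt0.
move=> B mB; pose E : set Q := [set q | B (row_sqnorm q ord0)].
pose F (l : seq R) := \1_B (\sum_(y <- take 2 l) y ^+ 2) * (Num.sqrt 2 *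
  (pos_powR (- 2^-1) (last_a (N := N) l) * pos_powR (- 2^-1) (gram_det (N := N) l))).
have imE := @image_planar_chart R N d dE.
have mV : measurable (V : set Q) by exact: measurable_stiefel_chart measurable_planar_frame.
have mE : measurable (@planar_chart R N d @` @planar_dom R N d `&` E : set Q).
  by rewrite imE; apply: measurableI => //; exact: measurable_row_sqnorm.
have FE (x : 'rV[R]_d) : planar_dom (N := N) x -> \1_E (planar_chart (N := N) x) *
    Num.sqrt (\det (metric_tensor (planar_chart (N := N)) x)) = F (seq_of_row x).
  move=> Ux; rewrite (planar_density dE Ux); congr (_ * _).
  by rewrite /E -(row_sqnorm_planar_chart dE) !indicE.
have F0 (x : 'rV[R]_d) : ~ planar_dom (N := N) x -> F (seq_of_row x) = 0.
  move=> nU; rewrite /F; have [P0|P0] := ltP 0 (last_a (N := N) (seq_of_row x)); last first.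
    by rewrite (pos_powR_le0 _ P0) mul0r !mulr0.
  have [D0|D0] := ltP 0 (gram_det (N := N) (seq_of_row x)); first by case: nU.
  by rewrite (pos_powR_le0 _ D0) !mulr0.
have := volume_of_chart vol (planar_local_param dE VM) mE FE F0; rewrite imE => ->.
have -> : d = (2 + (2 * N + 1))%N by rewrite dE mulnS addnA.
rewrite iter_integral_cat; apply: eq_iter_integral => l1.
case: l1 => [|x [|y [|//]]]// _.
have -> : \sum_(z <- [:: x; y]) z ^+ 2 = x ^+ 2 + y ^+ 2 by rewrite !big_cons big_nil addr0.
set S := x ^+ 2 + y ^+ 2; have B0 : 0 <= \1_B S :> R by [].
transitivity (iter_integral (2 * N) (fun l => (\1_B S * Num.sqrt 2 * C1 *
   pos_det2 (- 2^-1) (1 - x ^+ 2 - \sum_(m < N) l`_(2 * m) ^+ 2)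
     (1 - y ^+ 2 - \sum_(m < N) l`_(2 * m + 1) ^+ 2)
     (0 - x * y - \sum_(m < N) l`_(2 * m) * l`_(2 * m + 1)))%:E)).
  rewrite iter_integral_cat; apply: eq_iter_integral => l sl.
  set a := 1 - x ^+ 2 - _; set b := 1 - y ^+ 2 - _; set g := 0 - x * y - _.
  transitivity (iter_integral 1 (fun l' => (\1_B S * Num.sqrt 2 * pos_powR (- 2^-1) (a * b - g ^+ 2) *
      pos_powR (- 2^-1) (a - \sum_(z <- l') z ^+ 2))%:E)).
    apply: eq_iter_integral => -[//|t [|//]] _.
    rewrite big_cons big_nil addr0 -[[:: x; y] ++ _]/(x :: y :: (l ++ [:: t])).
    have [ra rb rab rt] := rest_cons x y t sl.
    rewrite /F /last_a /gram_det ra rb rab rt -/a -/b -/g /= take0 !big_cons big_nil addr0 -/S.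
    by congr (_%:E); ring.
  rewrite C1E; last by rewrite !mulr_ge0 ?pos_powR_ge0// ltW.
  congr (_%:E); rewrite /pos_det2 mul1r addNr.
  case: ifPn => a0; first by rewrite (pos_powR_gt0 _ a0) powRr0; ring.
  by rewrite (@pos_powR_le0 _ 0 a) ?mulr0// leNgt.
rewrite C2E; last by rewrite !mulr_ge0// ltW.
congr (_%:E).
(* After the middle rows the Gram matrix is 1 - v^T v for the first row v, and its determinant is 1
   - |v|^2. *)
have -> : pos_det2 (- 2^-1 + N%:R / 2) (1 - x ^+ 2) (1 - y ^+ 2) (0 - x * y) =
    pos_powR (- 2^-1 + N%:R / 2) (1 - S).
  rewrite /pos_det2 (_ : (1 - x ^+ 2) * _ - _ = 1 - S); last by rewrite /S; ring.
  case: ifPn => // x0; rewrite pos_powR_le0//.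
  by move: x0; rewrite -leNgt /S; have := sqr_ge0 y; lra.
by ring.
Qed.

End planar_measure.

Section stiefel_density.
Context {R : realType} {N d : nat}.
Local Notation Q := (borel (quatn R N.+3)).
Variables (M Y : set (quatn R N.+3)) (mu : {measure set Q -> \bar R}).
Local Notation V := (stiefel_chart row_p row_r Y).
Hypothesis vol : is_riemannian_volume d M mu.
Variables (U : set 'rV[R]_d) (phi : 'rV[R]_d -> quatn R N.+3).
Hypothesis phi_param : local_param M U phi.
Hypothesis imE : phi @` U = V.
Hypothesis V_lty : (mu V < +oo)%E.
Hypothesis mM : measurable (M : set Q).
Hypothesis mY : measurable (Y : set Q).
Hypothesis YM : Y `<=` M.
Hypothesis Yframe : Y `<=` @frame R N.+3.
Hypothesis rowM : forall A (hA : A *m A^T = 1%:M), symmetry_of M (row_isometry hA).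
Hypothesis rowY : forall A (hA : A *m A^T = 1%:M), symmetry_of Y (row_isometry hA).
Hypothesis coverM : covered M M Y.
Hypothesis coverY : covered M (Y `&` [set q | norm_a q row_p != 0] `&`
    [set q | (minor_re q row_p row_r != 0) || (minor_im q row_p row_r != 0)])
  (Y `&` [set q | q row_p 0 != 0] `&` [set q | minor_re q row_p row_r != 0]).

(** Four stages: into Y, to nonzero a_p and complex minor, to nonzero real parts of both, and
    finally to positive ones. *)
Lemma covered_stiefel_chart : covered M M V.
Proof.
apply: covered_trans coverM _.
apply: covered_trans (covered_minor row_pr rowM rowY Yframe) _.
apply: covered_trans coverY _.
exact: (covered_signs row_pr rowM rowY).
Qed.

Let mV : measurable (V : set Q).
Proof. exact: measurable_stiefel_chart. Qed.

Lemma stiefel_moves s A : symmetry_of M s -> measurable (A : set Q) ->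
  A `<=` M -> mu (moves s A) = mu A.
Proof.
apply: (covered_measure_moves vol phi_param); rewrite imE//.
exact: covered_stiefel_chart.
Qed.

Lemma stiefel_lty : (mu M < +oo)%E.
Proof.
apply: (covered_measure_lty vol phi_param); rewrite ?imE//.
exact: covered_stiefel_chart.
Qed.

Lemma stiefel_row_swap (i : 'I_N.+3) B : measurable B ->
  mu (M `&` [set q | B (row_sqnorm q i)]) = mu (M `&` [set q | B (row_sqnorm q ord0)]).
Proof.
move=> mB; apply: (measure_row_swap vol phi_param); rewrite ?imE//.
  exact: covered_stiefel_chart.
exact: rowM.
Qed.

End stiefel_density.

Lemma quatn_of_pairE (R : realType) n (a b : 'rV[R[i]]_n) m :
  [/\ quatn_of_pair a b m 0 = complex.Re (a 0 m), quatn_of_pair a b m 1 = complex.Im (a 0 m),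
      quatn_of_pair a b m 2 = complex.Re (b 0 m) & quatn_of_pair a b m 3 = complex.Im (b 0 m)].
Proof. by split; rewrite [LHS]mxE /mkquat [LHS]mxE. Qed.

Lemma dotq_frame2 (R : realType) n (q : quatn R n) : frame q -> dotq q q = 2.
Proof.
move=> fq; apply: (dotq_frame (c1 := 1) (c2 := 1) (c3 := 0) (c4 := 0) fq) => [m|]; last by ring.
by rewrite /norm_a /norm_b; ring.
Qed.

Lemma Hopf_closed_frame (R : realType) n (q : quatn R n) : frame q -> Hopf_closed q.
Proof.
move=> [a1 b1 re0 im0]; rewrite /Hopf_closed /=; apply: forall_I4.
- by apply: big1 => m _; have [-> _ _ _] := HopfE q m.
- transitivity (\sum_m norm_a q m - \sum_m norm_b q m); last by rewrite a1 b1 subrr.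
  rewrite -sumrB; apply: eq_bigr => m _; have [_ -> _ _] := HopfE q m.
  by rewrite /norm_a /norm_b; ring.
- transitivity (2 * \sum_m im_ab q m); last by rewrite im0 mulr0.
  by rewrite mulr_sumr; apply: eq_bigr => m _; have [_ _ -> _] := HopfE q m.
- transitivity (2 * \sum_m re_ab q m); last by rewrite re0 mulr0.
  by rewrite mulr_sumr; apply: eq_bigr => m _; have [_ _ _ ->] := HopfE q m.
Qed.

Section pol2.
Context {R : realType} {N : nat}.
Local Notation leb := (@lebesgue_measure R).
Local Notation Q := (borel (quatn R N.+3)).
Local Notation M := (@model_Pol2 R N.+3).
Local Notation Y := (@planar_frame R N).
Local Notation V := (stiefel_chart row_p row_r Y).

Lemma planar_frame_null (q : quatn R N.+3) : Y q -> forall m, q m 1 = 0 /\ q m 3 = 0.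
Proof. by move=> [_ q0] m; split; exact: q0. Qed.

Lemma V2R_quatnE : @V2R_quatn R N.+3 = Y.
Proof.
apply/seteqP; split => [_ [[a b] [/= a1 b1 ab0] <-]|q Yq].
  have e m := quatn_of_pairE (map_mx (real_complex R) a) (map_mx (real_complex R) b) m.
  split; last by move=> m; have [_ e1 _ e3] := e m; apply: forall_I4 => // _; rewrite ?e1 ?e3 mxE.
  rewrite /frame /= -[in X in [/\ X, _, _ & _]]a1 -[in X in [/\ _, X, _ & _]]b1.
  split; [| |rewrite -[RHS]ab0|apply: big1 => m _; rewrite /im_ab];
    [apply: eq_bigr => m _; rewrite /norm_a|apply: eq_bigr => m _; rewrite /norm_b|
     apply: eq_bigr => m _; rewrite /re_ab|]; have [e0 e1 e2 e3] := e m; rewrite ?e0 ?e1 ?e2 ?e3 !mxE /=; ring.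
have [[a1 b1 re0 im0] _] := Yq; have q13 := planar_frame_null Yq.
exists (\row_m q m 0, \row_m q m 2); rewrite /V2R /=.
  rewrite -[in X in [/\ X, _ & _]]a1 -[in X in [/\ _, X & _]]b1.
  split; [| |rewrite -[RHS]re0]; apply: eq_bigr => m _; rewrite ?/norm_a ?/norm_b ?/re_ab !mxE;
    have [q1 q3] := q13 m; rewrite ?q1 ?q3; ring.
apply/matrixP => m.
have [e0 e1 e2 e3] := quatn_of_pairE (map_mx (real_complex R) (\row_m q m 0))
  (map_mx (real_complex R) (\row_m q m 2)) m.
have [q1 q3] := q13 m.
by apply: forall_I4; rewrite ?e0 ?e1 ?e2 ?e3 !mxE.
Qed.

(** On Y, left multiplication by i is exactly [flip]: the signs by which they differ in general fall
    on the columns i and k, which are zero there. *)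
Lemma model_Pol2E : M = Y `|` moves flip Y.
Proof.
rewrite /model_Pol2 V2R_quatnE; congr (_ `|` _).
have mulE (q : quatn R N.+3) : Y q ->
    \matrix_(m < N.+3) mulq (quat_i R) (row m q) = act flip q.
  move=> Yq; apply/matrixP => m; have [q1 q3] := planar_frame_null Yq m.
  have [f0 f1 f2 f3] := flipE q m.
  by apply: forall_I4; rewrite ?f0 ?f1 ?f2 ?f3 !mxE /= ?mxE /= ?q1 ?q3; ring.
apply/seteqP; split => [_ [q Yq <-]|q]; rewrite /moves /= ?act_flipV.
  by rewrite mulE// flipK.
by move=> Yq; exists (act flip q) => //; rewrite mulE// flipK.
Qed.

Lemma planar_frame_row A (hA : A *m A^T = 1%:M) : symmetry_of Y (row_isometry hA).
Proof.
have sub B (hB : B *m B^T = 1%:M) q : Y q -> Y (act (row_isometry hB) q).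
  move=> [fq q0]; split; first exact: (proj1 (frame_row hB q)).
  move=> m c mc; rewrite act_row mxE big1// => k _.
  by rewrite q0// mulr0.
move=> q; split; first exact: sub.
have hB : A^T *m A^T^T = 1%:M by rewrite trmxK; exact: mulmx1C.
by move=> /(sub _ hB); rewrite !act_row mulmxA (mulmx1C hA) mul1mx.
Qed.

Lemma model_Pol2_row A (hA : A *m A^T = 1%:M) : symmetry_of M (row_isometry hA).
Proof.
rewrite model_Pol2E; apply: symmetryU; first exact: planar_frame_row.
move=> q; rewrite /moves /= !act_flipV.
have -> : act flip (act (row_isometry hA) q) = act (row_isometry hA) (act flip q).
  by rewrite /act /= !mulmx1 !mul1mx !mulmxA.
exact: planar_frame_row.
Qed.

Lemma model_Pol2_flip : symmetry_of M flip.
Proof.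
rewrite model_Pol2E; apply: symmetry_involution; first exact: flipK.
by move=> q [Yq|]; [right; rewrite /moves /= actK|rewrite /moves /= act_flipV; left].
Qed.

Lemma measurable_model_Pol2 : measurable (M : set Q).
Proof.
rewrite model_Pol2E; apply: measurableU; first exact: measurable_planar_frame.
by apply: measurable_moves; exact: measurable_planar_frame.
Qed.

Lemma planar_minor_im q p m : Y q -> minor_im q p m = 0.
Proof.
move=> Yq; have [p1 p3] := planar_frame_null Yq p; have [m1 m3] := planar_frame_null Yq m.
by rewrite /minor_im /re_ab /im_ab p1 p3 m1 m3; ring.
Qed.

Lemma volume_Pol2 (mu : {measure set Q -> \bar R}) (i : 'I_N.+3) :
  is_riemannian_volume (2 * N.+3 - 3) M mu ->
  exists2 K : R, 0 < K & forall B, measurable B ->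
    mu (M `&` [set q | B (row_sqnorm q i)]) =
    (\int[leb]_(t in `[0%R, 1%R] `&` B) (K * (1 - t) `^ (N.+3%:R / 2 - 2))%:E)%E.
Proof.
set d := (2 * N.+3 - 3)%N => vol.
have dE : d = (2 * N.+1 + size [:: 0])%N by rewrite /d -[size _]/1%N; lia.
have mY : measurable (Y : set Q) by exact: measurable_planar_frame.
have mM : measurable (M : set Q) by exact: measurable_model_Pol2.
have YM : Y `<=` M by rewrite model_Pol2E => q; left.
have VM : V `<=` M by move=> q [[/YM]].
have Yframe : Y `<=` @frame R N.+3 by move=> q [].
have [K K0 KE] := planar_chart_measure dE vol VM.
have s2 : - 2^-1 <= - 2^-1 + N%:R / 2 :> R by rewrite lerDl divr_ge0.
have V_lty : (mu V < +oo)%E.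
  have := KE setT measurableT; rewrite (_ : V `&` _ = V); last first.
    by apply/seteqP; split => q // [].
  move=> ->; have [K' K'0 K'E] := @iter_integral_ball R 2 _ s2.
  rewrite (@eq_iter_integral R 2 _ (fun l => (K * pos_powR (- 2^-1 + N%:R / 2)
    (1 - \sum_(y <- l) y ^+ 2))%:E)) => [|l _]; last by rewrite indicT mul1r.
  by rewrite (K'E 1 K (ltW K0)) ltry.
have coverM : covered M M Y.
  apply: (covered_bool model_Pol2_flip) => q; rewrite model_Pol2E => -[]; by [left|right].
have coverY : covered M (Y `&` [set q | norm_a q row_p != 0] `&`
    [set q | (minor_re q row_p row_r != 0) || (minor_im q row_p row_r != 0)])
  (Y `&` [set q | q row_p 0 != 0] `&` [set q | minor_re q row_p row_r != 0]).
  apply: (covered_bool (symmetry_one M)) => q [[Yq +] +]; rewrite /= norm_a_eq0.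
  have [-> _] := planar_frame_null Yq row_p.
  by rewrite planar_minor_im// eqxx andbT orbF => q0 z0; left.
have param := planar_local_param dE VM.
have imE := @image_planar_chart R N d dE.
have rowM := model_Pol2_row; have rowY := planar_frame_row.
have mu_inv := stiefel_moves vol param imE V_lty mY Yframe rowM rowY coverM coverY.
have M_lty := stiefel_lty vol param imE V_lty mM mY Yframe rowM rowY coverM coverY.
have [C C0 CE] := @integral_sqr_norm2_density R (- 2^-1 + N%:R / 2).
(* Two components exchanged by [flip], times the four sign choices of the chart. *)
exists (8 * (C * K)); first by rewrite !mulr_gt0.
move=> B mB.
rewrite (stiefel_row_swap vol param imE V_lty mM mY Yframe rowM rowY coverM coverY)//.
have mE : measurable ([set q | B (row_sqnorm q ord0)] : set Q) by exact: measurable_row_sqnorm.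
have not_null (q : quatn R N.+3) : Y q -> ~ (forall m, q m 0 = 0).
  move=> Yq q0; have [[a1 _ _ _] _] := Yq.
  move: a1; rewrite big1 => [/esym/eqP|m _]; first by rewrite oner_eq0.
  by rewrite /norm_a q0; have [-> _] := planar_frame_null Yq m; ring.
rewrite (measure_halves mu_inv (s := flip) (A := Y))//; last 5 first.
- exact: model_Pol2_flip.
- by move=> q /=; rewrite row_sqnorm_flip.
- by rewrite model_Pol2E => q; right.
- rewrite -subset0 => q [Yq]; rewrite /moves /= act_flipV => Yq'.
  apply: (not_null q Yq) => m; have [+ _] := planar_frame_null Yq' m.
  by have [_ -> _ _] := flipE q m.
- by rewrite -model_Pol2E setDv measure0.
have null0 : mu (Y `&` [set q | forall m, q m 0 = 0]) = 0%E.
  by rewrite (_ : _ `&` _ = set0) ?measure0// -subset0 => q [/not_null].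
have null_p := null_a row_p rowM rowY mY YM mM M_lty mu_inv null0.
(* Imaginary minors vanish on planar frames, so the vanishing of all real minors already forces a_p
   = 0, which is a null event. *)
have nullz : mu (Y `&` [set q | forall m, minor_re q row_p m = 0]) = 0%E.
  apply: (subset_measure0 _ _ _ null_p).
  - apply: measurableI => //; apply: borel_forall_eq0 => m; exact: continuous_minor_re.
  - by apply: measurableI => //; apply: borel_eq; exact: continuous_entry.
  - move=> q [Yq q0]; split => //=.
    have /eqP : norm_a q row_p = 0.
      by apply: (frame_minor (Yframe _ Yq)) => m; rewrite q0 planar_minor_im.
    by rewrite norm_a_eq0 => /andP[/eqP].
rewrite (measure_stiefel_chart row_pr rowM rowY mY YM mM M_lty mu_inv mE _ null0 nullz); last first.
  by move=> k q /=; rewrite row_sqnorm_row_flip.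
rewrite KE// CE// muleA -EFinM -natrM -ge0_integralZl_EFin//; last 3 first.
- by apply: measurableI => //; exact: measurable_itv.
- by move=> t _; rewrite lee_fin !mulr_ge0 ?powR_ge0// ltW.
- apply/measurable_EFinP; apply: measurable_funTS; apply: measurable_funM => //.
  have mB1 : measurable_fun setT (fun t : R => 1 - t) by exact: measurable_funB.
  exact: (measurableT_comp (@measurable_powR R _) mB1).
apply: eq_integral => t _; rewrite -EFinM.
have -> : - 2^-1 + N%:R / 2 = N.+3%:R / 2 - 2 :> R.
  by rewrite -[N.+3]addn3 (natrD R N 3); lra.
by rewrite !mulrA.
Qed.

Lemma Pol2_density (P : set 'M[R]_(N.+3, 2) -> \bar R) (i : 'I_N.+3) : symmetric_Pol2 P ->
  has_density P (@Pol R 2 N.+3) (fun e => edge_length e i) `[0, 1]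
    (fun y => (N.+3%:R / 2 - 1) * ((1 - y) `^ (N.+3%:R / 2 - 2))).
Proof.
move=> symP; set p : R := N.+3%:R / 2 - 1.
have p0 : 0 < p.
  by rewrite /p -[N.+3]addn3 (natrD R N 3); have := ler0n R N; lra.
have pE : N.+3%:R / 2 - 2 = p - 1 by rewrite /p; lra.
have mf : measurable_fun setT (fun y : R => p * (1 - y) `^ (N.+3%:R / 2 - 2)).
  apply: measurable_funM => //.
  have mB1 : measurable_fun setT (fun t : R => 1 - t) by exact: measurable_funB.
  exact: (measurableT_comp (@measurable_powR R _) mB1).
have f0 (y : R) : 0 <= y -> y <= 1 -> 0 <= p * (1 - y) `^ (N.+3%:R / 2 - 2).
  by move=> _ _; rewrite mulr_ge0 ?powR_ge0// ltW.
apply: (has_density_of_volume (i := i) symP _ (Hopf_preimage_Pol2 i)) => //.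
- exact: measurable_model_Pol2.
- move=> B mB; apply: measurableI; last exact: measurable_row_sqnorm.
  apply: measurableI; last exact: measurable_Hopf_closed.
  by apply: measurableI; [exact: measurable_dotq2|exact: measurable_planar].
- move=> B q Mq; split=> [[]//|Bq]; split=> //.
  have closed q' : Y q' -> ([set q | dotq q q = 2] `&` [set q | forall m, Hopf q m 2 = 0] `&`
      @Hopf_closed R N.+3) q' /\ forall m, Hopf q' m 2 = 0.
    move=> Yq'; have [fq' _] := Yq'.
    have H2 m : Hopf q' m 2 = 0.
      have [_ _ -> _] := HopfE q' m; have [-> ->] := planar_frame_null Yq' m; ring.
    by split => //; split; [split => //; exact: dotq_frame2|exact: Hopf_closed_frame].
  move: Mq; rewrite model_Pol2E => -[/closed[]//|]; rewrite /moves /= act_flipV.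
  move=> /closed[[[/= q2 _] qc] H2]; move: q2; rewrite dotq_act => q2.
  (* [flip] changes the Hopf image only by the sign of its j-component, so closure and planarity
     pass to the second component of the model. *)
  have HE m c : Hopf q m c = if c == 2 then - Hopf (act flip q) m c else Hopf (act flip q) m c.
    have [h0 h1 h2 h3] := HopfE q m; have [k0 k1 k2 k3] := HopfE (act flip q) m.
    have [f0' f1' f2' f3'] := flipE q m.
    by move: c; apply: forall_I4; rewrite /= ?h0 ?h1 ?h2 ?h3 ?k0 ?k1 ?k2 ?k3 ?f0' ?f1' ?f2' ?f3'; ring.
  have H2' m : Hopf q m 2 = 0 by rewrite HE /= H2 oppr0.
  split; first by split.
  move=> c; case: (eqVneq c 2) => [->|c2]; first by apply: big1 => m _.
  by rewrite -[RHS](qc c); apply: eq_bigr => m _; rewrite HE (negPf c2).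
- by rewrite pE; exact: integral_density_powR.
move=> mu vol; have [K K0 KE] := volume_Pol2 i vol.
exists (K / p); first exact: divr_gt0.
move=> B mB; rewrite KE// -ge0_integralZl_EFin//; last 4 first.
- by apply: measurableI => //; exact: measurable_itv.
- by move=> t [/=]; rewrite in_itv/= => /andP[t0 t1] _; rewrite lee_fin f0.
- by apply/measurable_EFinP; exact: measurable_funTS mf.
- by rewrite ltW// divr_gt0.
apply: eq_integral => t _; rewrite -EFinM; congr (_%:E).
by move: (_ `^ _) p p0 {mf f0 pE} => s ka ka0; field; rewrite gt_eqF.
Qed.

End pol2.

(** * Spatial polygons *)

(* Here a_q = u0 + u1 i, a_p = x + v i, b_q = b0 + y i, g = g1 + g2 i, and
   z = z1 + z2 i stands for conj(a_p) (a_p b_q - a_q b_p), so that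
   a b_q = conj(g) a_q + z and conj(a_p) b_p = h. *)
Lemma complex_completion (R : realType) (a b g1 g2 u0 u1 y v x z1 : R) :
  let P := a - u0 ^+ 2 - u1 ^+ 2 in
  let z2 := a * y - (g1 * u1 - g2 * u0) in
  let b0 := (g1 * u0 + g2 * u1 + z1) / a in
  let h1 := g1 - (u0 * b0 + u1 * y) in
  let h2 := - g2 - (u0 * y - u1 * b0) in
  let p0 := (h1 * x - h2 * v) / P in
  let p1 := (h1 * v + h2 * x) / P in
  a != 0 -> P != 0 -> x ^+ 2 = P - v ^+ 2 ->
  z1 ^+ 2 = P * (a * b - g1 ^+ 2 - g2 ^+ 2) - z2 ^+ 2 ->
  [/\ b0 ^+ 2 + y ^+ 2 + (p0 ^+ 2 + p1 ^+ 2) = b,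
      u0 * b0 + u1 * y + (x * p0 + v * p1) = g1,
      u1 * b0 - u0 * y + (v * p0 - x * p1) = g2 &
      P * b0 - (u0 * (x * p0 + v * p1) + u1 * (v * p0 - x * p1)) = z1].
Proof.
move=> P z2 b0 h1 h2 p0 p1 a0 P0 x2 z12.
have xv : x ^+ 2 + v ^+ 2 = P by rewrite x2; ring.
have e1 : x * p0 + v * p1 = h1.
  transitivity (h1 * (x ^+ 2 + v ^+ 2) / P); first by rewrite /p0 /p1; field.
  by rewrite xv; field.
have e2 : v * p0 - x * p1 = - h2.
  transitivity (- h2 * (x ^+ 2 + v ^+ 2) / P); first by rewrite /p0 /p1; field.
  by rewrite xv; field.
have uu : u0 ^+ 2 + u1 ^+ 2 = a - P by rewrite /P; ring.
have ah1 : a * h1 = P * g1 - u0 * z1 - u1 * z2.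
  transitivity (a * g1 - u0 * (a * b0) - u1 * (a * y)); first by rewrite /h1; ring.
  have -> : a * b0 = g1 * u0 + g2 * u1 + z1 by rewrite /b0; field.
  by rewrite /z2 /P; ring.
have ah2 : a * h2 = - (P * g2) - u0 * z2 + u1 * z1.
  transitivity (- (a * g2) - u0 * (a * y) + u1 * (a * b0)); first by rewrite /h2; ring.
  have -> : a * b0 = g1 * u0 + g2 * u1 + z1 by rewrite /b0; field.
  by rewrite /z2 /P; ring.
split.
- have -> : p0 ^+ 2 + p1 ^+ 2 = (h1 ^+ 2 + h2 ^+ 2) / P.
    transitivity ((h1 ^+ 2 + h2 ^+ 2) * (x ^+ 2 + v ^+ 2) / P ^+ 2); last by rewrite xv; field.
    by rewrite /p0 /p1; field.
  apply: (mulfI (mulf_neq0 (mulf_neq0 a0 a0) P0)).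
  transitivity (P * ((a * b0) ^+ 2 + (a * y) ^+ 2) + (a * h1) ^+ 2 + (a * h2) ^+ 2).
    by field.
  have -> : a * b0 = g1 * u0 + g2 * u1 + z1 by rewrite /b0; field.
  have -> : a * y = z2 + (g1 * u1 - g2 * u0) by rewrite /z2; ring.
  rewrite ah1 ah2.
  transitivity ((P + (u0 ^+ 2 + u1 ^+ 2)) * (z1 ^+ 2 + z2 ^+ 2 + P * (g1 ^+ 2 + g2 ^+ 2))).
    by move: P z2 {x2 z12 xv e1 e2 uu ah1 ah2 h1 h2 p0 p1 b0 P0} => P z2; ring.
  by rewrite uu z12; move: P z2 {x2 z12 xv e1 e2 uu ah1 ah2 h1 h2 p0 p1 b0 P0} => P z2; ring.
- by rewrite e1 /h1; ring.
- by rewrite e2 /h2; ring.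
- rewrite e1 e2; apply: (mulfI a0).
  transitivity (P * (a * b0) - (u0 * (a * h1) - u1 * (a * h2))); first by ring.
  have -> : a * b0 = g1 * u0 + g2 * u1 + z1 by rewrite /b0; field.
  by rewrite ah1 ah2 /P; ring.
Qed.

Section spatial_frames.
Context {R : realType} {N : nat}.
Implicit Types l : seq R.

(* What the rows before the last two leave of |a|^2, |b|^2, Re <a, b> and Im <a, b>. *)
Definition crest_a l : R := 1 - \sum_(m < N.+1) (l`_(4 * m) ^+ 2 + l`_(4 * m + 1) ^+ 2).
Definition crest_b l : R := 1 - \sum_(m < N.+1) (l`_(4 * m + 2) ^+ 2 + l`_(4 * m + 3) ^+ 2).
Definition crest_re l : R := 0 -
  \sum_(m < N.+1) (l`_(4 * m) * l`_(4 * m + 2) + l`_(4 * m + 1) * l`_(4 * m + 3)).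
Definition crest_im l : R := 0 -
  \sum_(m < N.+1) (l`_(4 * m + 1) * l`_(4 * m + 2) - l`_(4 * m) * l`_(4 * m + 3)).
Definition cgram_det l : R := crest_a l * crest_b l - crest_re l ^+ 2 - crest_im l ^+ 2.
Let b := (4 * N.+1)%N.
Definition clast_norm l : R := crest_a l - l`_b ^+ 2 - l`_(b + 1) ^+ 2.
Definition clast_a l : R := clast_norm l - l`_(b + 3) ^+ 2.
Definition clast_im l : R :=
  crest_a l * l`_(b + 2) - (crest_re l * l`_(b + 1) - crest_im l * l`_b).
(** The number z = conj(a_p) (a_p b_r - a_r b_p) has squared modulus |a_p|^2 times the Gram
    determinant, by Lagrange's identity, and its imaginary part [clast_im] is known from the free
    coordinates. What remains is the square of its real part, the minor of the chart. *)
Definition clast_z l : R := clast_norm l * cgram_det l - clast_im l ^+ 2.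
Definition clast_b l : R :=
  (crest_re l * l`_b + crest_im l * l`_(b + 1) + Num.sqrt (clast_z l)) / crest_a l.
Definition clast_h1 l : R := crest_re l - (l`_b * clast_b l + l`_(b + 1) * l`_(b + 2)).
Definition clast_h2 l : R := - crest_im l - (l`_b * l`_(b + 2) - l`_(b + 1) * clast_b l).

(** Re a_p comes from |a|^2 and Re b_r from z. Then h = conj(a_p) b_p is what row r leaves of the
    Hermitian product, up to conjugation, and b_p = a_p h / |a_p|^2. *)
Definition spatial_tail l : seq R :=
  let x := Num.sqrt (clast_a l) in let v := l`_(b + 3) in
  [:: l`_b; l`_(b + 1); clast_b l; l`_(b + 2); x; v;
      (clast_h1 l * x - clast_h2 l * v) / clast_norm l;
      (clast_h1 l * v + clast_h2 l * x) / clast_norm l].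

(** Free are a_r, Im b_r and Im a_p; dependent are Re b_r, Re a_p and both parts of b_p, one real
    number for each of the four equations. *)
Let fo : seq nat := [:: 0; 1; 3; 5].
Let dpo : seq nat := [:: 2; 4; 6; 7].

Context {d : nat}.
Hypothesis dE : d = (4 * N.+1 + size fo)%N.

Definition spatial_dom : set 'rV[R]_d :=
  [set x | 0 < clast_a (seq_of_row x)] `&` [set x | 0 < clast_z (seq_of_row x)].

Definition spatial_chart (x : 'rV[R]_d) : quatn R N.+3 :=
  row_chart columns4 (fun x => spatial_tail (seq_of_row x)) x.

Let w0 : (0 < 4)%N. Proof. by []. Qed.
Let perm : perm_eq (fo ++ dpo) (iota 0 (2 * 4)). Proof. by []. Qed.

Let tail_free (x : 'rV[R]_d) i : (i < size fo)%N ->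
  (spatial_tail (seq_of_row x))`_(nth 0%N fo i) = (seq_of_row x)`_(4 * N.+1 + i).
Proof. by case: i => [|[|[|[|//]]]] _; rewrite ?addn0. Qed.

Let cols0 : cols columns4 0 = 0. Proof. by apply: val_inj; rewrite /= inordK. Qed.
Let cols1 : cols columns4 1 = 1. Proof. by apply: val_inj; rewrite /= inordK. Qed.
Let cols2 : cols columns4 2 = 2. Proof. by apply: val_inj; rewrite /= inordK. Qed.
Let cols3 : cols columns4 3 = 3. Proof. by apply: val_inj; rewrite /= inordK. Qed.

Let chart_row (x : 'rV[R]_d) m : (m < N.+1)%N ->
  [/\ spatial_chart x (inord m) 0 = (seq_of_row x)`_(4 * m),
      spatial_chart x (inord m) 1 = (seq_of_row x)`_(4 * m + 1),
      spatial_chart x (inord m) 2 = (seq_of_row x)`_(4 * m + 2) &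
      spatial_chart x (inord m) 3 = (seq_of_row x)`_(4 * m + 3)].
Proof.
move=> mN; have e k := @row_chart_row R 4 N d columns4 fo dpo w0 perm dE
  (fun x => spatial_tail (seq_of_row x)) x m k mN.
split.
- by have := e 0 isT; rewrite cols0 addn0.
- by have := e 1 isT; rewrite cols1.
- by have := e 2 isT; rewrite cols2.
- by have := e 3 isT; rewrite cols3.
Qed.

Let chart_r (x : 'rV[R]_d) : let t := spatial_tail (seq_of_row x) in
  [/\ spatial_chart x row_r 0 = t`_0, spatial_chart x row_r 1 = t`_1,
      spatial_chart x row_r 2 = t`_2 & spatial_chart x row_r 3 = t`_3].
Proof.
have e i := @row_chart_tail R 4 N d columns4 fo dpo w0 perm dE
  (fun x => spatial_tail (seq_of_row x)) x i.
split.
- by have := e 0 isT; rewrite crd_r// cols0.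
- by have := e 1 isT; rewrite crd_r// cols1.
- by have := e 2 isT; rewrite crd_r// cols2.
- by have := e 3 isT; rewrite crd_r// cols3.
Qed.

Let chart_p (x : 'rV[R]_d) : let t := spatial_tail (seq_of_row x) in
  [/\ spatial_chart x row_p 0 = t`_4, spatial_chart x row_p 1 = t`_5,
      spatial_chart x row_p 2 = t`_6 & spatial_chart x row_p 3 = t`_7].
Proof.
have e i := @row_chart_tail R 4 N d columns4 fo dpo w0 perm dE
  (fun x => spatial_tail (seq_of_row x)) x i.
split.
- by have := e 4 isT; rewrite (@crd_p 4 N columns4 w0 0)// cols0.
- by have := e 5 isT; rewrite (@crd_p 4 N columns4 w0 1)// cols1.
- by have := e 6 isT; rewrite (@crd_p 4 N columns4 w0 2)// cols2.
- by have := e 7 isT; rewrite (@crd_p 4 N columns4 w0 3)// cols3.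
Qed.

Let clast_norm_gt0 l : 0 < clast_a l -> 0 < clast_norm l.
Proof. by rewrite subr_gt0; apply: le_lt_trans; exact: sqr_ge0. Qed.

Let crest_a_gt0 l : 0 < clast_a l -> 0 < crest_a l.
Proof.
move=> /clast_norm_gt0; rewrite /clast_norm => n0.
by have := sqr_ge0 l`_b; have := sqr_ge0 l`_(b + 1); lra.
Qed.

Let tail_eqs l : 0 < clast_a l -> 0 < clast_z l -> let t := spatial_tail l in
  [/\ t`_2 ^+ 2 + t`_3 ^+ 2 + (t`_6 ^+ 2 + t`_7 ^+ 2) = crest_b l,
      t`_0 * t`_2 + t`_1 * t`_3 + (t`_4 * t`_6 + t`_5 * t`_7) = crest_re l,
      t`_1 * t`_2 - t`_0 * t`_3 + (t`_5 * t`_6 - t`_4 * t`_7) = crest_im l &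
      clast_norm l * t`_2 - (t`_0 * (t`_4 * t`_6 + t`_5 * t`_7) +
        t`_1 * (t`_5 * t`_6 - t`_4 * t`_7)) = Num.sqrt (clast_z l)].
Proof.
move=> a0 z0.
apply: (complex_completion (b := crest_b l)).
- by rewrite gt_eqF// crest_a_gt0.
- by rewrite gt_eqF// clast_norm_gt0.
- by rewrite sqr_sqrtr// ltW.
- by rewrite sqr_sqrtr// ltW.
Qed.

Let tail_norm_p l : 0 < clast_a l -> let t := spatial_tail l in
  t`_4 ^+ 2 + t`_5 ^+ 2 = clast_norm l.
Proof. by move=> a0 /=; rewrite sqr_sqrtr ?ltW// /clast_a subrK. Qed.

Lemma spatial_chart_frame x : spatial_dom x -> frame (spatial_chart x).
Proof.
move=> [P0 D0].
have [t2 t3 t4 _] := tail_eqs P0 D0; have t1 := tail_norm_p P0.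
have [r0 r1 r2 r3] := chart_r x; have [p0 p1 p2 p3] := chart_p x.
have t1' : (spatial_tail (seq_of_row x))`_0 ^+ 2 + (spatial_tail (seq_of_row x))`_1 ^+ 2 =
  crest_a (seq_of_row x) - clast_norm (seq_of_row x) by rewrite /clast_norm /=; ring.
split; rewrite sum_rows.
- rewrite /norm_a r0 r1 p0 p1 t1 t1' /crest_a.
  rewrite (eq_bigr (fun m : 'I_N.+1 => (seq_of_row x)`_(4 * m) ^+ 2 + (seq_of_row x)`_(4 * m + 1) ^+ 2)); first lra.
  by move=> m _; have [-> -> _ _] := chart_row x (ltn_ord m).
- rewrite /norm_b r2 r3 p2 p3 -addrA t2 /crest_b.
  rewrite (eq_bigr (fun m : 'I_N.+1 => (seq_of_row x)`_(4 * m + 2) ^+ 2 + (seq_of_row x)`_(4 * m + 3) ^+ 2)); first lra.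
  by move=> m _; have [_ _ -> ->] := chart_row x (ltn_ord m).
- rewrite /re_ab r0 r1 r2 r3 p0 p1 p2 p3 -addrA t3 /crest_re.
  rewrite (eq_bigr (fun m : 'I_N.+1 => (seq_of_row x)`_(4 * m) * (seq_of_row x)`_(4 * m + 2) +
    (seq_of_row x)`_(4 * m + 1) * (seq_of_row x)`_(4 * m + 3))); first lra.
  by move=> m _; have [-> -> -> ->] := chart_row x (ltn_ord m).
- rewrite /im_ab r0 r1 r2 r3 p0 p1 p2 p3 -addrA t4 /crest_im.
  rewrite (eq_bigr (fun m : 'I_N.+1 => (seq_of_row x)`_(4 * m + 1) * (seq_of_row x)`_(4 * m + 2) -
    (seq_of_row x)`_(4 * m) * (seq_of_row x)`_(4 * m + 3))); first lra.
  by move=> m _; have [-> -> -> ->] := chart_row x (ltn_ord m).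
Qed.

Let last_minor x : spatial_dom x ->
  minor_re (spatial_chart x) row_p row_r = Num.sqrt (clast_z (seq_of_row x)).
Proof.
move=> [P0 D0]; have [_ _ _ <-] := tail_eqs P0 D0; rewrite /minor_re /norm_a /re_ab /im_ab.
have [-> -> -> _] := chart_r x; have [-> -> -> ->] := chart_p x.
by rewrite (tail_norm_p P0).
Qed.

Lemma image_spatial_chart :
  spatial_chart @` spatial_dom = stiefel_chart row_p row_r (@frame R N.+3).
Proof.
apply/seteqP; split => [_ [x Ux <-]|q [[[a1 b1 re0 im0] p0] z0]].
  have p0 : 0 < spatial_chart x row_p 0.
    by have [-> _ _ _] := chart_p x; rewrite sqrtr_gt0; case: Ux.
  split; first by split => //; exact: spatial_chart_frame.
  by rewrite /= last_minor// sqrtr_gt0; case: Ux.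
rewrite /= in p0 z0.
pose x : 'rV[R]_d := \row_j q (@free 4 N d columns4 fo j).1 (@free 4 N d columns4 fo j).2.
have xE j (jd : (j < d)%N) : (seq_of_row x)`_j =
    q (crd N.+2 columns4 (@free_pos 4 N fo j)).1 (crd N.+2 columns4 (@free_pos 4 N fo j)).2.
  by rewrite (nth_seq_of_row _ (Ordinal jd)) mxE.
have xb i : (i < 4)%N -> (seq_of_row x)`_(b + i) =
    q (crd N.+2 columns4 (b + nth 0%N fo i)).1 (crd N.+2 columns4 (b + nth 0%N fo i)).2.
  move=> i4; rewrite xE ?dE ?ltn_add2l//.
  by rewrite /free_pos ltnNge leq_addr addKn.
have c0 : crd N.+2 columns4 (b + 0) = (row_r, 0) by rewrite -cols0; exact: crd_r.
have c1 : crd N.+2 columns4 (b + 1) = (row_r, 1) by rewrite -cols1; exact: crd_r.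
have c2 : crd N.+2 columns4 (b + 2) = (row_r, 2) by rewrite -cols2; exact: crd_r.
have c3 : crd N.+2 columns4 (b + 3) = (row_r, 3) by rewrite -cols3; exact: crd_r.
have c4 : crd N.+2 columns4 (b + 4) = (row_p, 0) by rewrite -cols0; exact: (@crd_p 4 N columns4 w0 0).
have c5 : crd N.+2 columns4 (b + 5) = (row_p, 1) by rewrite -cols1; exact: (@crd_p 4 N columns4 w0 1).
have c6 : crd N.+2 columns4 (b + 6) = (row_p, 2) by rewrite -cols2; exact: (@crd_p 4 N columns4 w0 2).
have c7 : crd N.+2 columns4 (b + 7) = (row_p, 3) by rewrite -cols3; exact: (@crd_p 4 N columns4 w0 3).
have x0 : (seq_of_row x)`_b = q row_r 0 by have := xb 0 isT; rewrite [nth _ _ _]/= c0 addn0.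
have x1 : (seq_of_row x)`_(b + 1) = q row_r 1 by have := xb 1 isT; rewrite [nth _ fo _]/= c1.
have x2 : (seq_of_row x)`_(b + 2) = q row_r 3 by have := xb 2 isT; rewrite [nth _ fo _]/= c3.
have x3 : (seq_of_row x)`_(b + 3) = q row_p 1 by have := xb 3 isT; rewrite [nth _ fo _]/= c5.
have xrow m k : (m < N.+1)%N -> (k < 4)%N ->
    (seq_of_row x)`_(4 * m + k) = q (inord m) (cols columns4 k).
  move=> mN k4; have jb : (4 * m + k < 4 * N.+1)%N by lia.
  by rewrite xE ?dE ?ltn_addr// /free_pos jb crd_row.
have xrow0 m : (m < N.+1)%N -> (seq_of_row x)`_(4 * m) = q (inord m) 0.
  by move=> mN; rewrite -[(4 * m)%N]addn0 xrow// cols0.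
have ra : crest_a (seq_of_row x) = norm_a q row_r + norm_a q row_p.
  move: a1; rewrite sum_rows /crest_a.
  rewrite (eq_bigr (fun m : 'I_N.+1 => (seq_of_row x)`_(4 * m) ^+ 2 + (seq_of_row x)`_(4 * m + 1) ^+ 2)).
    by move=> e; lra.
  by move=> m _; rewrite /norm_a xrow0// xrow// cols1.
have rb : crest_b (seq_of_row x) = norm_b q row_r + norm_b q row_p.
  move: b1; rewrite sum_rows /crest_b.
  rewrite (eq_bigr (fun m : 'I_N.+1 => (seq_of_row x)`_(4 * m + 2) ^+ 2 + (seq_of_row x)`_(4 * m + 3) ^+ 2)).
    by move=> e; lra.
  by move=> m _; rewrite /norm_b !xrow// cols2 cols3.
have rre : crest_re (seq_of_row x) = re_ab q row_r + re_ab q row_p.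
  move: re0; rewrite sum_rows /crest_re.
  rewrite (eq_bigr (fun m : 'I_N.+1 => (seq_of_row x)`_(4 * m) * (seq_of_row x)`_(4 * m + 2) +
    (seq_of_row x)`_(4 * m + 1) * (seq_of_row x)`_(4 * m + 3))).
    by move=> e; lra.
  by move=> m _; rewrite /re_ab xrow0// !xrow// cols1 cols2 cols3.
have rim : crest_im (seq_of_row x) = im_ab q row_r + im_ab q row_p.
  move: im0; rewrite sum_rows /crest_im.
  rewrite (eq_bigr (fun m : 'I_N.+1 => (seq_of_row x)`_(4 * m + 1) * (seq_of_row x)`_(4 * m + 2) -
    (seq_of_row x)`_(4 * m) * (seq_of_row x)`_(4 * m + 3))).
    by move=> e; lra.
  by move=> m _; rewrite /im_ab xrow0// !xrow// cols1 cols2 cols3.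
have ln : clast_norm (seq_of_row x) = norm_a q row_p.
  by rewrite /clast_norm ra x0 x1 [norm_a q row_r]/norm_a; ring.
have la : clast_a (seq_of_row x) = q row_p 0 ^+ 2 by rewrite /clast_a ln x3 /norm_a; ring.
have lz : clast_z (seq_of_row x) = minor_re q row_p row_r ^+ 2.
  rewrite /clast_z /clast_im /cgram_det ln ra rb rre rim x0 x1 x2.
  by rewrite /minor_re /norm_a /norm_b /re_ab /im_ab; ring.
have aN : norm_a q row_r + norm_a q row_p != 0.
  rewrite gt_eqF// ltr_wpDl ?addr_ge0 ?sqr_ge0// /norm_a.
  by rewrite ltr_wpDr ?sqr_ge0// exprn_gt0.
have pN : norm_a q row_p != 0.
  by rewrite gt_eqF// /norm_a ltr_wpDr ?sqr_ge0// exprn_gt0.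
have lb : clast_b (seq_of_row x) = q row_r 2.
  rewrite /clast_b lz sqrtr_sqr gtr0_norm// ra rre rim x0 x1.
  apply: (mulIf aN); rewrite divfK// /minor_re /norm_a /re_ab /im_ab; ring.
have h1 : clast_h1 (seq_of_row x) = re_ab q row_p.
  by rewrite /clast_h1 rre lb x0 x1 x2 [re_ab q row_r]/re_ab; ring.
have h2 : clast_h2 (seq_of_row x) = - im_ab q row_p.
  by rewrite /clast_h2 rim lb x0 x1 x2 [im_ab q row_r]/im_ab; ring.
exists x; first by split; rewrite /= ?la ?lz exprn_gt0.
apply: (row_chartP w0 perm dE) => // i i4.
rewrite -/x /spatial_tail lb h1 h2 ln la sqrtr_sqr gtr0_norm// x0 x1 x2 x3 -/b.
case: i i4 => [|[|[|[|[|[|[|[|i]]]]]]]] i4; last by exfalso; move: i4; clear.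
- by rewrite c0.
- by rewrite c1.
- by rewrite c2.
- by rewrite c3.
- by rewrite c4.
- by rewrite c5.
- rewrite c6 [LHS]/= [RHS]/=; apply: (mulIf pN); rewrite divfK// /norm_a /re_ab /im_ab; ring.
- rewrite c7 [LHS]/= [RHS]/=; apply: (mulIf pN); rewrite divfK// /norm_a /re_ab /im_ab; ring.
Qed.

Section smoothness.
Variable U : set 'rV[R]_d.
Hypothesis oU : open U.
Let nth_C1 k : C1_on U (fun x => (seq_of_row x)`_k) := @C1_nth R d U k.

Lemma crest_a_C1 : C1_on U (fun x => crest_a (seq_of_row x)).
Proof.
apply: (C1_sub oU); first exact: C1_cst.
apply: (C1_sum oU) => m.
exact: (C1_add oU (C1_sqr oU (nth_C1 _)) (C1_sqr oU (nth_C1 _))).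
Qed.

Lemma crest_b_C1 : C1_on U (fun x => crest_b (seq_of_row x)).
Proof.
apply: (C1_sub oU); first exact: C1_cst.
apply: (C1_sum oU) => m.
exact: (C1_add oU (C1_sqr oU (nth_C1 _)) (C1_sqr oU (nth_C1 _))).
Qed.

Lemma crest_re_C1 : C1_on U (fun x => crest_re (seq_of_row x)).
Proof.
apply: (C1_sub oU); first exact: C1_cst.
apply: (C1_sum oU) => m.
exact: (C1_add oU (C1_mul oU (nth_C1 _) (nth_C1 _)) (C1_mul oU (nth_C1 _) (nth_C1 _))).
Qed.

Lemma crest_im_C1 : C1_on U (fun x => crest_im (seq_of_row x)).
Proof.
apply: (C1_sub oU); first exact: C1_cst.
apply: (C1_sum oU) => m.
exact: (C1_sub oU (C1_mul oU (nth_C1 _) (nth_C1 _)) (C1_mul oU (nth_C1 _) (nth_C1 _))).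
Qed.

Lemma cgram_det_C1 : C1_on U (fun x => cgram_det (seq_of_row x)).
Proof.
exact: (C1_sub oU (C1_sub oU (C1_mul oU crest_a_C1 crest_b_C1) (C1_sqr oU crest_re_C1))
  (C1_sqr oU crest_im_C1)).
Qed.

Lemma clast_norm_C1 : C1_on U (fun x => clast_norm (seq_of_row x)).
Proof.
exact: (C1_sub oU (C1_sub oU crest_a_C1 (C1_sqr oU (nth_C1 b))) (C1_sqr oU (nth_C1 (b + 1)))).
Qed.

Lemma clast_a_C1 : C1_on U (fun x => clast_a (seq_of_row x)).
Proof. exact: (C1_sub oU clast_norm_C1 (C1_sqr oU (nth_C1 (b + 3)))). Qed.

Lemma clast_im_C1 : C1_on U (fun x => clast_im (seq_of_row x)).
Proof.
exact: (C1_sub oU (C1_mul oU crest_a_C1 (nth_C1 (b + 2))) (C1_sub oU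
  (C1_mul oU crest_re_C1 (nth_C1 (b + 1))) (C1_mul oU crest_im_C1 (nth_C1 b)))).
Qed.

Lemma clast_z_C1 : C1_on U (fun x => clast_z (seq_of_row x)).
Proof. exact: (C1_sub oU (C1_mul oU clast_norm_C1 cgram_det_C1) (C1_sqr oU clast_im_C1)). Qed.

End smoothness.

Let openU : open spatial_dom.
Proof.
apply: openI; apply: open_gt0; apply: C1_continuousT.
- exact: clast_a_C1 openT.
- exact: clast_z_C1 openT.
Qed.

Lemma spatial_chart_C1 m c : C1_on spatial_dom (fun x => spatial_chart x m c).
Proof.
apply: (row_chart_C1 columns4 w0 perm dE) => i i4.
have y0 x : spatial_dom x -> 0 < clast_a (seq_of_row x) by case.
have z0 x : spatial_dom x -> 0 < clast_z (seq_of_row x) by case.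
have a0 x : spatial_dom x -> crest_a (seq_of_row x) != 0.
  by move=> Ux; rewrite gt_eqF//; exact: crest_a_gt0 (y0 x Ux).
have n0 x : spatial_dom x -> clast_norm (seq_of_row x) != 0.
  by move=> Ux; rewrite gt_eqF//; exact: clast_norm_gt0 (y0 x Ux).
have nth_C1 k := @C1_nth R d spatial_dom k.
have c_x := C1_sqrt openU y0 (clast_a_C1 openU).
have c_z := C1_sqrt openU z0 (clast_z_C1 openU).
have c_i := C1_inv openU a0 (crest_a_C1 openU).
have c_n := C1_inv openU n0 (clast_norm_C1 openU).
have c_re := crest_re_C1 openU.
have c_im := crest_im_C1 openU.
have c_b : C1_on spatial_dom (fun x => clast_b (seq_of_row x)) :=
  C1_mul openU (C1_add openU (C1_add openU (C1_mul openU c_re (nth_C1 b))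
    (C1_mul openU c_im (nth_C1 (b + 1)%N))) c_z) c_i.
have c_h1 : C1_on spatial_dom (fun x => clast_h1 (seq_of_row x)) :=
  C1_sub openU c_re (C1_add openU (C1_mul openU (nth_C1 b) c_b)
    (C1_mul openU (nth_C1 (b + 1)%N) (nth_C1 (b + 2)%N))).
have c_h2 : C1_on spatial_dom (fun x => clast_h2 (seq_of_row x)) :=
  C1_sub openU (C1_opp openU c_im) (C1_sub openU (C1_mul openU (nth_C1 b) (nth_C1 (b + 2)%N))
    (C1_mul openU (nth_C1 (b + 1)%N) c_b)).
have c_v := nth_C1 (b + 3)%N.
case: i i4 => [|[|[|[|[|[|[|[|i]]]]]]]] i4; last by exfalso; move: i4; clear.
- exact: nth_C1 b.
- exact: nth_C1 (b + 1)%N.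
- exact: c_b.
- exact: nth_C1 (b + 2)%N.
- exact: c_x.
- exact: c_v.
- exact: (C1_mul openU (C1_sub openU (C1_mul openU c_h1 c_x) (C1_mul openU c_h2 c_v)) c_n).
- exact: (C1_mul openU (C1_add openU (C1_mul openU c_h1 c_v) (C1_mul openU c_h2 c_x)) c_n).
Qed.

Lemma spatial_local_param M : stiefel_chart row_p row_r (@frame R N.+3) `<=` M ->
  local_param M spatial_dom spatial_chart.
Proof.
move=> VM; apply: (@graph_local_param R N.+3 d (@free 4 N d columns4 fo)).
- exact: openU.
- exact: spatial_chart_C1.
- exact: (row_chart_free columns4 w0 perm dE).
- by rewrite image_spatial_chart.
Qed.

(** The half gradients have squared norms 1, 1, 2 and 2, with product 4. Their minor is Re a_p times
    the real minor of the chart, and the squares of these two factors are [clast_a] and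
    [clast_z]. *)
Lemma spatial_density x : spatial_dom x ->
  Num.sqrt (\det (metric_tensor spatial_chart x)) = Num.sqrt 4 *
  (pos_powR (- 2^-1) (clast_a (seq_of_row x)) * pos_powR (- 2^-1) (clast_z (seq_of_row x))).
Proof.
move=> Ux; have [P0 D0] := Ux.
have fr y (Uy : spatial_dom y) := spatial_chart_frame Uy.
have nullq y m c : colpos columns4 c = None -> spatial_chart y m c = 0 by [].
have nullS (y : 'rV[R]_d) (k : 'I_4) m c : colpos columns4 c = None ->
    (spatial_chart y *m frame_form k) m c = 0 by [].
have := @det_metric_tensor R N.+3 d 4 (@free 4 N d columns4 fo) (@dep 4 N columns4 dpo)
  (fun _ c => colpos columns4 c = None) (fun k : 'I_4 => frame_form k)
  (fun k : 'I_4 => [:: 1; 1; 0; 0]`_k) (fun k : 'I_4 => [:: 1; 1; 2; 2]`_k) spatial_dom spatial_chart.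
move=> /(_ (stiefel_split w0 perm dE)).
move=> /(_ (fun k => frame_form_sym (ltn_ord k)) openU spatial_chart_C1).
move=> /(_ (row_chart_free columns4 w0 perm dE tail_free) nullq).
move=> /(_ nullS (fun k y Uy => frame_constraint (ltn_ord k) (fr y Uy))).
move=> /(_ (fun k k' y Uy => frame_gram (ltn_ord k) (ltn_ord k') (fr y Uy)) x Ux).
rewrite [\prod_l _](_ : _ = 4); last first.
  by rewrite !big_ord_recl big_ord0 /=; ring.
have -> : \det (dep_minor (@dep 4 N columns4 dpo) (fun k : 'I_4 => frame_form k) spatial_chart x) =
    spatial_chart x row_p 0 * Num.sqrt (clast_z (seq_of_row x)).
  rewrite -last_minor// /dep_minor.
  have c1 : crd N.+2 columns4 (4 * N.+1 + nth 0%N dpo 0) = (row_r, 2).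
    by rewrite -cols2; exact: crd_r.
  have c2 : crd N.+2 columns4 (4 * N.+1 + nth 0%N dpo 1) = (row_p, 0).
    by rewrite -cols0; exact: (@crd_p 4 N columns4 w0 0).
  have c3 : crd N.+2 columns4 (4 * N.+1 + nth 0%N dpo 2) = (row_p, 2).
    by rewrite -cols2; exact: (@crd_p 4 N columns4 w0 2).
  have c4 : crd N.+2 columns4 (4 * N.+1 + nth 0%N dpo 3) = (row_p, 3).
    by rewrite -cols3; exact: (@crd_p 4 N columns4 w0 3).
  have [f0 f1 f2 f3] := frame_form0 (spatial_chart x) row_r.
  have [f0' f1' f2' f3'] := frame_form0 (spatial_chart x) row_p.
  have [g0 g1 g2 g3] := frame_form1 (spatial_chart x) row_r.
  have [g0' g1' g2' g3'] := frame_form1 (spatial_chart x) row_p.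
  have [h0 h1 h2 h3] := frame_form2 (spatial_chart x) row_r.
  have [h0' h1' h2' h3'] := frame_form2 (spatial_chart x) row_p.
  have [k0 k1 k2 k3] := frame_form3 (spatial_chart x) row_r.
  have [k0' k1' k2' k3'] := frame_form3 (spatial_chart x) row_p.
  rewrite (det4 (f := fun k k' => (spatial_chart x *m frame_form k)
    (crd N.+2 columns4 (4 * N.+1 + nth 0%N dpo k')).1
    (crd N.+2 columns4 (4 * N.+1 + nth 0%N dpo k')).2)) ?c1 ?c2 ?c3 ?c4 ?f2 ?f2' ?f3'//.
  rewrite [(_, _).1]/= [(_, _).2]/=.
  rewrite f0' g2 g2' g3' h2 h2' h3' k2 k2' k3' /minor_re /norm_a /re_ab /im_ab; ring.
have [-> _ _ _] := chart_p x; rewrite /= exprMn !sqr_sqrtr ?ltW// => e.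
have p0 : clast_a (seq_of_row x) != 0 by rewrite gt_eqF.
have d0 : clast_z (seq_of_row x) != 0 by rewrite gt_eqF.
rewrite !pos_powR_gt0// !powRN !powR12_sqrt ?ltW// -!sqrtrV ?ltW// -!sqrtrM ?invr_ge0 ?ltW//.
by rewrite -e; congr Num.sqrt; field; apply/andP.
Qed.

Lemma row_sqnorm_spatial_chart x : row_sqnorm (spatial_chart x) ord0 =
  \sum_(y <- take 4 (seq_of_row x)) y ^+ 2.
Proof.
have -> : ord0 = inord 0 :> 'I_N.+3 by apply: val_inj; rewrite /= inordK.
have [e0 e1 e2 e3] := chart_row x (ltn0Sn N).
rewrite row_sqnormE e0 e1 e2 e3 muln0 !add0n.
have : (4 <= size (seq_of_row x))%N by rewrite size_seq_of_row dE; lia.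
case: (seq_of_row x) => [//|a [//|a' [//|a'' [//|a''' l]]]] _ /=.
by rewrite !big_cons take0 big_nil; ring.
Qed.

End spatial_frames.

Section spatial_measure.
Context {R : realType}.
Local Notation leb := (@lebesgue_measure R).

(** Integrates out the free coordinates of the last two rows. Those in Im a_p and Im b_r bring both
    exponents from -1/2 to 0, the second with a Jacobian 1 / a; the remaining a_r ranges over a disc
    of area proportional to a, which cancels it. Only an indicator of positive definiteness is
    left. *)
Lemma complex_completion_integral : exists2 K : R, 0 < K & forall a D g1 g2 c : R, 0 <= c ->
  iter_integral 4 (fun l => (c * (pos_powR (- 2^-1) (a - l`_0 ^+ 2 - l`_1 ^+ 2 - l`_3 ^+ 2) *
    pos_powR (- 2^-1) ((a - l`_0 ^+ 2 - l`_1 ^+ 2) * D -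
      (a * l`_2 - (g1 * l`_1 - g2 * l`_0)) ^+ 2)))%:E) =
  (c * (K * (if 0 < a then pos_powR 0 D else 0)))%:E.
Proof.
pose be := @beta_const R (- 2^-1).
have be0 : 0 < be by rewrite beta_const_gt0.
have [Cb Cb0 CbE] := @iter_integral_ball R 2 0 ltac:(rewrite oppr_le0 invr_ge0//).
exists (be ^+ 2 * Cb); first by rewrite mulr_gt0 ?exprn_gt0.
move=> a D g1 g2 c c0; rewrite (iter_integral_cat 2 2).
have [a0|a0] := ltP 0 a; last first.
  rewrite mulr0 mulr0 -[RHS](iter_integral0 (R := R) 2); apply: eq_iter_integral => -[|u0 [|u1 [|//]]]// _.
  rewrite -[RHS](iter_integral0 (R := R) 2); apply: eq_iter_integral => -[|y [|v [|//]]]// _ /=.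
  rewrite pos_powR_le0 ?mul0r ?mulr0//.
  by have := sqr_ge0 u0; have := sqr_ge0 u1; have := sqr_ge0 v; lra.
transitivity (iter_integral 2 (fun l => (c * (be ^+ 2 / a * pos_powR 0 D) *
    pos_powR 0 (a - \sum_(y <- l) y ^+ 2))%:E)).
  apply: eq_iter_integral => -[|u0 [|u1 [|//]]]// _.
  rewrite !big_cons big_nil addr0 opprD addrA /=.
  set P := a - u0 ^+ 2 - u1 ^+ 2; set k := g1 * u1 - g2 * u0.
  have half0 : - 2^-1 + 2^-1 = 0 :> R by rewrite addNr.
  transitivity (\int[leb]_y (c * be * pos_powR 0 P *
      pos_powR (- 2^-1) (P * D - a ^+ 2 * (y - k / a) ^+ 2))%:E)%E.
    apply: eq_integral => y _.
    transitivity (\int[leb]_v (c * pos_powR (- 2^-1) (P * D - (a * y - k) ^+ 2) *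
        pos_powR (- 2^-1) (P - 1 * (v - 0) ^+ 2))%:E)%E.
      by apply: eq_integral => v _; rewrite subr0 mul1r; congr (_%:E); ring.
    rewrite integral_cpos_powR_quad//; last by rewrite mulr_ge0// pos_powR_ge0.
    rewrite half0 sqrtr1 divr1 -/be.
    have -> : (a * y - k) ^+ 2 = a ^+ 2 * (y - k / a) ^+ 2 by field; rewrite gt_eqF.
    by congr (_%:E); ring.
  rewrite integral_cpos_powR_quad ?exprn_gt0//; last first.
    by rewrite !mulr_ge0 ?pos_powR_ge0// ltW.
  rewrite half0 sqrtr_sqr gtr0_norm// -/be; congr (_%:E).
  have [P0|P0] := ltP 0 P; last by rewrite (pos_powR_le0 _ P0) !mulr0 mul0r.
  by rewrite (pos_powRM _ _ P0) powRr0 mul1r (pos_powR_gt0 _ P0) powRr0; field; rewrite gt_eqF.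
rewrite CbE; last first.
  by rewrite mulr_ge0// mulr_ge0 ?pos_powR_ge0// divr_ge0 ?exprn_ge0// ltW.
rewrite add0r divff// (pos_powR_gt0 _ a0) powRr1 ?ltW//.
by congr (_%:E); field; rewrite gt_eqF.
Qed.

Context {N d : nat}.
Local Notation Q := (borel (quatn R N.+3)).
Local Notation Y := (@frame R N.+3).
Local Notation V := (stiefel_chart row_p row_r Y).
Hypothesis dE : d = (4 * N.+1 + size [:: 0; 1; 3; 5])%N.

Let crest_cons (x0 x1 x2 x3 : R) l l' : size l = (4 * N)%N -> size l' = 4%N ->
  let L := x0 :: x1 :: x2 :: x3 :: (l ++ l') in
  [/\ crest_a (N := N) L = 1 - (x0 ^+ 2 + x1 ^+ 2) - \sum_(m < N) (l`_(4 * m) ^+ 2 + l`_(4 * m + 1) ^+ 2),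
      crest_b (N := N) L = 1 - (x2 ^+ 2 + x3 ^+ 2) - \sum_(m < N) (l`_(4 * m + 2) ^+ 2 + l`_(4 * m + 3) ^+ 2),
      crest_re (N := N) L = 0 - (x0 * x2 + x1 * x3) -
        \sum_(m < N) (l`_(4 * m) * l`_(4 * m + 2) + l`_(4 * m + 1) * l`_(4 * m + 3)),
      crest_im (N := N) L = 0 - (x1 * x2 - x0 * x3) -
        \sum_(m < N) (l`_(4 * m + 1) * l`_(4 * m + 2) - l`_(4 * m) * l`_(4 * m + 3)) &
      forall i, L`_(4 * N.+1 + i) = l'`_i].
Proof.
move=> sl sl' L.
have e (m : 'I_N) : (4 * lift ord0 m = (4 * m).+4)%N by rewrite /= /bump leq0n add1n mulnS.
have e0 (m : 'I_N) : L`_(4 * lift ord0 m) = l`_(4 * m).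
  rewrite e /L /= nth_cat sl ifT//; have := ltn_ord m; lia.
have ei (m : 'I_N) i : (i < 4)%N -> L`_(4 * lift ord0 m + i) = l`_(4 * m + i).
  move=> i4; rewrite e !addSn /L /= nth_cat sl ifT//; have := ltn_ord m; lia.
split.
- rewrite /crest_a big_ord_recl opprD addrA; congr (_ - _ - _).
  by apply: eq_bigr => m _; rewrite e0 ei.
- rewrite /crest_b big_ord_recl opprD addrA; congr (_ - _ - _).
  by apply: eq_bigr => m _; rewrite !ei.
- rewrite /crest_re big_ord_recl opprD addrA; congr (_ - _ - _).
  by apply: eq_bigr => m _; rewrite e0 !ei.
- rewrite /crest_im big_ord_recl opprD addrA; congr (_ - _ - _).
  by apply: eq_bigr => m _; rewrite e0 !ei.
- by move=> i; rewrite mulnS !addSn add0n /L /= nth_cat sl ltnNge leq_addr /= addKn.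
Qed.

(** Once the last two rows are integrated out the exponent is 0, and each of the N middle rows adds
    1 by [iter_integral_det2C]. *)
Lemma spatial_chart_measure (M : set (quatn R N.+3)) (mu : {measure set Q -> \bar R}) :
  is_riemannian_volume d M mu -> V `<=` M ->
  exists2 K : R, 0 < K & forall B, measurable B ->
    mu (V `&` [set q | B (row_sqnorm q ord0)]) =
    iter_integral 4 (fun l => (\1_B (\sum_(y <- l) y ^+ 2) * K *
      pos_powR N%:R (1 - \sum_(y <- l) y ^+ 2))%:E).
Proof.
move=> vol VM.
have [C1 C1_0 C1E] := complex_completion_integral.
have [C2 C2_0 C2E] := @iter_integral_det2C R N 0 ltac:(rewrite oppr_le0 invr_ge0//).
have s40 : 0 < Num.sqrt 4 :> R by rewrite sqrtr_gt0.
exists (Num.sqrt 4 * C1 * C2); first by rewrite !mulr_gt0.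
move=> B mB; pose E : set Q := [set q | B (row_sqnorm q ord0)].
pose F (l : seq R) := \1_B (\sum_(y <- take 4 l) y ^+ 2) * (Num.sqrt 4 *
  (pos_powR (- 2^-1) (clast_a (N := N) l) * pos_powR (- 2^-1) (clast_z (N := N) l))).
have imE := @image_spatial_chart R N d dE.
have mV : measurable (V : set Q) by exact: measurable_stiefel_chart (@measurable_frame R N.+3).
have mE : measurable (@spatial_chart R N d @` @spatial_dom R N d `&` E : set Q).
  by rewrite imE; apply: measurableI => //; exact: measurable_row_sqnorm.
have FE (x : 'rV[R]_d) : spatial_dom (N := N) x -> \1_E (spatial_chart (N := N) x) *
    Num.sqrt (\det (metric_tensor (spatial_chart (N := N)) x)) = F (seq_of_row x).
  move=> Ux; rewrite (spatial_density dE Ux); congr (_ * _).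
  by rewrite /E -(row_sqnorm_spatial_chart dE) !indicE.
have F0 (x : 'rV[R]_d) : ~ spatial_dom (N := N) x -> F (seq_of_row x) = 0.
  move=> nU; rewrite /F; have [P0|P0] := ltP 0 (clast_a (N := N) (seq_of_row x)); last first.
    by rewrite (pos_powR_le0 _ P0) mul0r !mulr0.
  have [D0|D0] := ltP 0 (clast_z (N := N) (seq_of_row x)); first by case: nU.
  by rewrite (pos_powR_le0 _ D0) !mulr0.
have := volume_of_chart vol (spatial_local_param dE VM) mE FE F0; rewrite imE => ->.
have -> : d = (4 + (4 * N + 4))%N by rewrite dE mulnS addnA.
rewrite iter_integral_cat; apply: eq_iter_integral => l1.
case: l1 => [|x0 [|x1 [|x2 [|x3 [|//]]]]]// _.
have -> : \sum_(z <- [:: x0; x1; x2; x3]) z ^+ 2 = x0 ^+ 2 + x1 ^+ 2 + x2 ^+ 2 + x3 ^+ 2.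
  by rewrite !big_cons big_nil addr0 !addrA.
set S := x0 ^+ 2 + x1 ^+ 2 + x2 ^+ 2 + x3 ^+ 2; have B0 : 0 <= \1_B S :> R by [].
transitivity (iter_integral (4 * N) (fun l => (\1_B S * Num.sqrt 4 * C1 *
   pos_det2C 0 (1 - (x0 ^+ 2 + x1 ^+ 2) - \sum_(m < N) (l`_(4 * m) ^+ 2 + l`_(4 * m + 1) ^+ 2))
     (1 - (x2 ^+ 2 + x3 ^+ 2) - \sum_(m < N) (l`_(4 * m + 2) ^+ 2 + l`_(4 * m + 3) ^+ 2))
     (0 - (x0 * x2 + x1 * x3) -
        \sum_(m < N) (l`_(4 * m) * l`_(4 * m + 2) + l`_(4 * m + 1) * l`_(4 * m + 3)))
     (0 - (x1 * x2 - x0 * x3) -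
        \sum_(m < N) (l`_(4 * m + 1) * l`_(4 * m + 2) - l`_(4 * m) * l`_(4 * m + 3))))%:E)).
  rewrite iter_integral_cat; apply: eq_iter_integral => l sl.
  set a := 1 - (x0 ^+ 2 + x1 ^+ 2) - _; set b := 1 - (x2 ^+ 2 + x3 ^+ 2) - _.
  set g1 := 0 - (x0 * x2 + x1 * x3) - _; set g2 := 0 - (x1 * x2 - x0 * x3) - _.
  transitivity (iter_integral 4 (fun l' => (\1_B S * Num.sqrt 4 *
    (pos_powR (- 2^-1) (a - l'`_0 ^+ 2 - l'`_1 ^+ 2 - l'`_3 ^+ 2) *
    pos_powR (- 2^-1) ((a - l'`_0 ^+ 2 - l'`_1 ^+ 2) * (a * b - g1 ^+ 2 - g2 ^+ 2) -
      (a * l'`_2 - (g1 * l'`_1 - g2 * l'`_0)) ^+ 2)))%:E)).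
    apply: eq_iter_integral => l' sl'.
    rewrite -[[:: x0; x1; x2; x3] ++ _]/(x0 :: x1 :: x2 :: x3 :: (l ++ l')).
    have [ra rb re im rt] := crest_cons x0 x1 x2 x3 sl sl'.
    have rt0 := rt 0%N; rewrite addn0 in rt0.
    rewrite /F /clast_z /clast_im /cgram_det /clast_a /clast_norm ra rb re im !rt rt0.
    rewrite -/a -/b -/g1 -/g2 /= take0 !big_cons big_nil addr0 !addrA -/S.
    by rewrite mulrA.
  rewrite C1E; last by rewrite !mulr_ge0// ltW.
  by congr (_%:E); rewrite /pos_det2C !mulrA.
rewrite C2E; last by rewrite !mulr_ge0// ltW.
congr (_%:E); rewrite add0r.
(* The Gram matrix left by the first row is a rank-one update of the identity, with determinant 1 -
   S. *)
have -> : pos_det2C N%:R (1 - (x0 ^+ 2 + x1 ^+ 2)) (1 - (x2 ^+ 2 + x3 ^+ 2))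
    (0 - (x0 * x2 + x1 * x3)) (0 - (x1 * x2 - x0 * x3)) = pos_powR N%:R (1 - S).
  rewrite /pos_det2C (_ : (1 - (x0 ^+ 2 + x1 ^+ 2)) * _ - _ - _ = 1 - S); last by rewrite /S; ring.
  case: ifPn => // x00; rewrite pos_powR_le0//.
  by move: x00; rewrite -leNgt /S; have := sqr_ge0 x2; have := sqr_ge0 x3; lra.
by ring.
Qed.

End spatial_measure.

Lemma model_Pol3E (R : realType) n : @model_Pol3 R n = @frame R n.
Proof.
have sumE k (F : 'I_k -> R[i]) : \sum_m F m =
    Complex (\sum_m complex.Re (F m)) (\sum_m complex.Im (F m)).
  elim: k F => [|k IH] F; first by rewrite !big_ord0.
  by rewrite !big_ord_recl IH; case: (F ord0).
have hermE (a b : 'rV[R[i]]_n) : herm a b = Complex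
    (\sum_m (complex.Re (a 0 m) * complex.Re (b 0 m) + complex.Im (a 0 m) * complex.Im (b 0 m)))
    (\sum_m (complex.Im (a 0 m) * complex.Re (b 0 m) - complex.Re (a 0 m) * complex.Im (b 0 m))).
  rewrite /herm sumE; congr Complex; apply: eq_bigr => m _;
    by case: (a 0 m) (b 0 m) => [x y] [z t] /=; ring.
have complexE (x y : R) (z : R[i]) : Complex x y = z <-> x = complex.Re z /\ y = complex.Im z.
  by case: z => z t /=; split => [[-> ->]|[-> ->]].
have V2CE (a b : 'rV[R[i]]_n) : V2C (a, b) <-> frame (quatn_of_pair a b).
  have e m := quatn_of_pairE a b m.
  have na : \sum_m norm_a (quatn_of_pair a b) m = \sum_m (complex.Re (a 0 m) * complex.Re (a 0 m) +
      complex.Im (a 0 m) * complex.Im (a 0 m)).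
    by apply: eq_bigr => m _; have [e0 e1 e2 e3] := e m; rewrite /norm_a e0 e1; ring.
  have nb : \sum_m norm_b (quatn_of_pair a b) m = \sum_m (complex.Re (b 0 m) * complex.Re (b 0 m) +
      complex.Im (b 0 m) * complex.Im (b 0 m)).
    by apply: eq_bigr => m _; have [e0 e1 e2 e3] := e m; rewrite /norm_b e2 e3; ring.
  have nre : \sum_m re_ab (quatn_of_pair a b) m = \sum_m (complex.Re (a 0 m) * complex.Re (b 0 m) +
      complex.Im (a 0 m) * complex.Im (b 0 m)).
    by apply: eq_bigr => m _; have [e0 e1 e2 e3] := e m; rewrite /re_ab e0 e1 e2 e3.
  have nim : \sum_m im_ab (quatn_of_pair a b) m = \sum_m (complex.Im (a 0 m) * complex.Re (b 0 m) -
      complex.Re (a 0 m) * complex.Im (b 0 m)).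
    by apply: eq_bigr => m _; have [e0 e1 e2 e3] := e m; rewrite /im_ab e0 e1 e2 e3.
  have im0 (c : 'rV[R[i]]_n) : \sum_m (complex.Im (c 0 m) * complex.Re (c 0 m) -
      complex.Re (c 0 m) * complex.Im (c 0 m)) = 0.
    by apply: big1 => m _; ring.
  rewrite /V2C /frame /= na nb nre nim !hermE !im0; split.
    by move=> [/complexE/=[-> _] /complexE/=[-> _] /complexE/=[-> ->]].
  by move=> [-> -> -> ->].
apply/seteqP; split => [_ [[a b] /V2CE ab <-]//|q fq].
pose a : 'rV[R[i]]_n := \row_m Complex (q m 0) (q m 1).
pose b : 'rV[R[i]]_n := \row_m Complex (q m 2) (q m 3).
have qE : quatn_of_pair a b = q.
  apply/matrixP => m; have [e0 e1 e2 e3] := quatn_of_pairE a b m.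
  by apply: forall_I4; rewrite ?e0 ?e1 ?e2 ?e3 !mxE.
by exists (a, b) => //; apply/V2CE; rewrite qE.
Qed.

(** * Conjugations with a phase as symmetries of complex frames *)

Section conjugations.
Context {R : realType} {n : nat}.
Implicit Types q : quatn R n.

(* z |-> e^(i t) conj(z) on both a and b, where e^(i t) = h + k i. *)
Definition conj_mx (h k : R) : 'M[R]_4 := \matrix_(c, c')
  (nth [::] [:: [:: h; k; 0; 0]; [:: k; - h; 0; 0]; [:: 0; 0; h; k]; [:: 0; 0; k; - h]] c)`_c'.

Lemma conj_mxP h k : h ^+ 2 + k ^+ 2 = 1 -> conj_mx h k *m (conj_mx h k)^T = 1%:M.
Proof.
move=> hk; apply/matrixP => c c'; rewrite mxE sum4 !mxE.
move: c c'; apply: forall_I4; apply: forall_I4; rewrite /= ?mulr0n ?mulr1n -?hk; ring.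
Qed.

Definition conjugation (h k : R) : isometry R n :=
  match pselect (h ^+ 2 + k ^+ 2 = 1) with
  | left hk => col_isometry (conj_mxP hk)
  | right _ => one_isometry
  end.

Lemma conjugationE h k q m : h ^+ 2 + k ^+ 2 = 1 ->
  [/\ act (conjugation h k) q m 0 = h * q m 0 + k * q m 1,
      act (conjugation h k) q m 1 = k * q m 0 - h * q m 1,
      act (conjugation h k) q m 2 = h * q m 2 + k * q m 3 &
      act (conjugation h k) q m 3 = k * q m 2 - h * q m 3].
Proof.
move=> hk; rewrite /conjugation; case: pselect => // hk'.
have mulE c : act (col_isometry (conj_mxP hk')) q m c = q m 0 * conj_mx h k 0 c +
    q m 1 * conj_mx h k 1 c + q m 2 * conj_mx h k 2 c + q m 3 * conj_mx h k 3 c.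
  by rewrite act_col mxE sum4.
by split; rewrite mulE ![conj_mx _ _ _ _]mxE /=; ring.
Qed.

Lemma conjugationK h k q : h ^+ 2 + k ^+ 2 = 1 ->
  act (conjugation h k) (act (conjugation h k) q) = q.
Proof.
move=> hk; apply/matrixP => m.
have [e0 e1 e2 e3] := conjugationE (act (conjugation h k) q) m hk.
have [f0 f1 f2 f3] := conjugationE q m hk.
have e (x y : R) : h * (h * x + k * y) + k * (k * x - h * y) = x.
  by rewrite -[RHS]mul1r -hk; ring.
have e' (x y : R) : k * (h * x + k * y) - h * (k * x - h * y) = y.
  by rewrite -[RHS]mul1r -hk; ring.
by apply: forall_I4; rewrite ?e0 ?e1 ?e2 ?e3 ?f0 ?f1 ?f2 ?f3.
Qed.

Lemma act_conjugationV h k q : h ^+ 2 + k ^+ 2 = 1 ->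
  act (inv_isometry (conjugation h k)) q = act (conjugation h k) q.
Proof. by move=> hk; rewrite -{1}(conjugationK q hk) actK. Qed.

Lemma conjugation_forms h k q m : h ^+ 2 + k ^+ 2 = 1 ->
  [/\ norm_a (act (conjugation h k) q) m = norm_a q m,
      norm_b (act (conjugation h k) q) m = norm_b q m,
      re_ab (act (conjugation h k) q) m = re_ab q m &
      im_ab (act (conjugation h k) q) m = - im_ab q m].
Proof.
move=> hk; have [e0 e1 e2 e3] := conjugationE q m hk.
rewrite /norm_a /norm_b /re_ab /im_ab e0 e1 e2 e3; split.
- by rewrite -[RHS]mul1r -hk; ring.
- by rewrite -[RHS]mul1r -hk; ring.
- by rewrite -[RHS]mul1r -hk; ring.
- by rewrite -[RHS]mul1r -hk; ring.
Qed.

Lemma conjugation_minor h k q p m : h ^+ 2 + k ^+ 2 = 1 ->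
  minor_re (act (conjugation h k) q) p m = h * minor_re q p m + k * minor_im q p m /\
  minor_im (act (conjugation h k) q) p m = k * minor_re q p m - h * minor_im q p m.
Proof.
move=> hk; have [e0 e1 e2 e3] := conjugationE q m hk.
have [na _ re im] := conjugation_forms q p hk.
by rewrite /minor_re /minor_im na re im e0 e1 e2 e3; split; ring.
Qed.

Lemma frame_conjugation h k : h ^+ 2 + k ^+ 2 = 1 -> symmetry_of (@frame R n) (conjugation h k).
Proof.
move=> hk; apply: symmetry_involution => [q|q [a1 b1 re0 im0]]; first exact: conjugationK.
have e m := conjugation_forms q m hk.
split.
- by rewrite -[RHS]a1; apply: eq_bigr => m _; have [] := e m.
- by rewrite -[RHS]b1; apply: eq_bigr => m _; have [] := e m.
- by rewrite -[RHS]re0; apply: eq_bigr => m _; have [] := e m.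
- transitivity (- \sum_m im_ab q m); last by rewrite im0 oppr0.
  by rewrite -sumrN; apply: eq_bigr => m _; have [] := e m.
Qed.

(** A reflection of the plane is z -> e^(i t) conj(z) in real coordinates, so it can be realized by
    [conjugation]. *)
Lemma reflection_mx2 (u : 'rV[R]_2) : (u *m u^T) 0 0 != 0 ->
  let H := reflection_mx u in
  [/\ H 0 0 ^+ 2 + H 0 1 ^+ 2 = 1, H 1 0 = H 0 1 & H 1 1 = - H 0 0].
Proof.
move=> hu H.
have sE : (u *m u^T) 0 0 = u 0 0 ^+ 2 + u 0 1 ^+ 2.
  rewrite mxE !big_ord_recl big_ord0 addr0 !mxE -!expr2.
  by congr (u _ _ ^+ 2 + u _ _ ^+ 2); apply: val_inj.
have HE i j : H i j = (i == j)%:R - 2 / (u 0 0 ^+ 2 + u 0 1 ^+ 2) * (u 0 i * u 0 j).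
  by rewrite /H /reflection_mx sE !mxE big_ord_recl big_ord0 addr0 !mxE.
rewrite sE in hu; move: hu; rewrite !HE /=.
by move: (u 0 0) (u 0 1) => x y xy; split; field.
Qed.

End conjugations.

Section pol3.
Context {R : realType} {N : nat}.
Local Notation leb := (@lebesgue_measure R).
Local Notation Q := (borel (quatn R N.+3)).
Local Notation Y := (@frame R N.+3).
Local Notation V := (stiefel_chart row_p row_r Y).

(** f0 and f1 are the real and imaginary parts of a complex vector on which conjugations act as
    reflections of the plane. [null_chain] is applied to the matrix with these two rows: if their
    common vanishing is null, so is that of the real part. *)
Lemma conj_null (mu : {measure set Q -> \bar R}) (f0 f1 : quatn R N.+3 -> 'I_N.+3 -> R) :
  (mu Y < +oo)%E ->
  (forall s A, symmetry_of Y s -> measurable (A : set Q) -> A `<=` Y -> mu (moves s A) = mu A) ->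
  (forall m, continuous (f0^~ m)) -> (forall m, continuous (f1^~ m)) ->
  (forall h k q m, h ^+ 2 + k ^+ 2 = 1 ->
    f0 (act (conjugation h k) q) m = h * f0 q m + k * f1 q m /\
    f1 (act (conjugation h k) q) m = k * f0 q m - h * f1 q m) ->
  mu (Y `&` [set q | forall m, f0 q m = 0 /\ f1 q m = 0]) = 0%E ->
  mu (Y `&` [set q | forall m, f0 q m = 0]) = 0%E.
Proof.
move=> Y_lty mu_inv c0 c1 fE null_all.
have mY : measurable (Y : set Q) by exact: measurable_frame.
pose X q : 'M[R]_(2, N.+3) := \matrix_(i, m) (if i == 0 then f0 q m else f1 q m).
have X0 q m : X q 0 m = f0 q m by rewrite mxE.
have X1 q m : X q 1 m = f1 q m by rewrite mxE.
transitivity (mu (Y `&` [set q | row 0 (X q) = 0])).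
  congr (mu (_ `&` _)); apply/seteqP; split => q /= q0.
    by apply/rowP => m; rewrite !mxE eqxx q0.
  by move=> m; have /rowP/(_ m) := q0; rewrite !mxE.
pose g (u : 'rV[R]_2) : isometry R N.+3 := conjugation (reflection_mx u 0 0) (reflection_mx u 0 1).
apply: (@null_chain R N.+3 Y mu mY Y_lty mu_inv 2 N.+3 X g xpredT Y mY) => //.
- move=> i m; under eq_fun do rewrite mxE.
  by case: (i == 0); [exact: c0|exact: c1].
- move=> p r t _ _ pr u.
  have u0 : (u *m u^T) 0 0 != 0 by exact: norm_delta2.
  have [hk H10 H11] := reflection_mx2 u0.
  split; [exact: frame_conjugation|exact: frame_conjugation|].
  move=> q; rewrite act_conjugationV//; apply/matrixP => i m.
  have [g0 g1] := fE _ _ q m hk.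
  rewrite [RHS]mxE big_ord_recl big_ord_recl big_ord0 addr0.
  have -> : ord0 = 0 :> 'I_2 by [].
  have -> : lift 0 ord0 = 1 :> 'I_2 by apply: val_inj.
  rewrite X0 X1; case: i => [[|[|//]] i2].
    rewrite (_ : Ordinal i2 = 0); last exact: val_inj.
    by rewrite X0 g0.
  rewrite (_ : Ordinal i2 = 1); last exact: val_inj.
  by rewrite X1 g1 H10 H11 mulNr.
- rewrite -null_all; congr (mu (_ `&` _)); apply/seteqP; split => q /= q0.
    move=> m; have /rowP/(_ m) := q0 0 isT; have /rowP/(_ m) := q0 1 isT.
    by rewrite !mxE.
  move=> i _; apply/rowP => m; rewrite !mxE; have [z0 z1] := q0 m.
  by case: (i == 0).
Qed.

(** A nonzero complex number has zero component along at most one of three pairwise nonparallel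
    directions, so two nonzero numbers, a_p and the minor, exclude at most two. The third direction
    is a rational point of the unit circle, which keeps the arithmetic linear. *)
Lemma covered_conjugation p r :
  covered Y (Y `&` [set q | norm_a q p != 0] `&`
    [set q | (minor_re q p r != 0) || (minor_im q p r != 0)])
  (Y `&` [set q | q p 0 != 0] `&` [set q | minor_re q p r != 0]).
Proof.
pose h (t : 'I_3) : R := [:: 1; 0; 3 / 5]`_t.
pose k (t : 'I_3) : R := [:: 0; 1; 4 / 5]`_t.
have hk t : h t ^+ 2 + k t ^+ 2 = 1.
  by rewrite /h /k; case: t => [[|[|[|//]]] i] /=; field.
apply: (@covered_fin _ _ _ 'I_3 (fun t => conjugation (h t) (k t))).
  by move=> t; exact: frame_conjugation.
move=> q [[Yq a0] z0].
suff [t [at0 zt0]] : exists t : 'I_3, h t * q p 0 + k t * q p 1 != 0 /\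
    h t * minor_re q p r + k t * minor_im q p r != 0.
  exists t; rewrite /moves /= act_conjugationV//.
  have [e0 _ _ _] := conjugationE q p (hk t).
  have [z0' _] := conjugation_minor q p r (hk t).
  split; last by rewrite /= z0'.
  by split; [exact: (proj1 (frame_conjugation (hk t) q))|rewrite /= e0].
move: a0 z0; rewrite /= norm_a_eq0 negb_and.
move: (q p 0) (q p 1) (minor_re q p r) (minor_im q p r) => x y z w xy zw.
pose good t := (h t * x + k t * y != 0) && (h t * z + k t * w != 0).
suff [t /andP[]] : exists t, good t by exists t.
apply/existsP; apply: contraT; rewrite negb_exists => /forallP bad; exfalso.
have := bad (Ordinal (isT : (0 < 3)%N)); have := bad (Ordinal (isT : (1 < 3)%N)).
have := bad (Ordinal (isT : (2 < 3)%N)); rewrite /good /h /k /= !negb_and !negbK.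
rewrite !mul1r !mul0r !addr0 !add0r.
have e (u v : R) : (3 / 5 * u + 4 / 5 * v == 0) = (3 * u + 4 * v == 0) :> bool.
  by apply/eqP/eqP => uv; lra.
rewrite !e => /orP[]/eqP e3 /orP[]/eqP e2 /orP[]/eqP e1.
all: move: xy zw; case: (eqVneq x 0) => [x0|x0]; case: (eqVneq y 0) => [y0|y0];
  case: (eqVneq z 0) => [zz|zz]; case: (eqVneq w 0) => [w0|w0] //= _ _.
all: try (by move/eqP : x0; apply; lra).
all: try (by move/eqP : y0; apply; lra).
all: try (by move/eqP : zz; apply; lra).
all: try (by move/eqP : w0; apply; lra).
Qed.

Lemma volume_Pol3 (mu : {measure set Q -> \bar R}) (i : 'I_N.+3) :
  is_riemannian_volume (4 * N.+3 - 4) Y mu ->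
  exists2 K : R, 0 < K & forall B, measurable B ->
    mu (Y `&` [set q | B (row_sqnorm q i)]) =
    (\int[leb]_(t in `[0%R, 1%R] `&` B) (K * (t * (1 - t) ^+ N))%:E)%E.
Proof.
set d := (4 * N.+3 - 4)%N => vol.
have dE : d = (4 * N.+1 + size [:: 0; 1; 3; 5])%N by rewrite /d -[size _]/4%N; lia.
have mY : measurable (Y : set Q) by exact: measurable_frame.
have YY : Y `<=` Y by [].
have VM : V `<=` Y by move=> q [[]].
have [K K0 KE] := spatial_chart_measure dE vol VM.
have V_lty : (mu V < +oo)%E.
  have := KE setT measurableT; rewrite (_ : V `&` _ = V); last first.
    by apply/seteqP; split => q // [].
  have s2 : - 2^-1 <= N%:R :> R by rewrite (le_trans _ (ler0n _ _))// oppr_le0 invr_ge0.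
  move=> ->; have [K' K'0 K'E] := @iter_integral_ball R 4 _ s2.
  rewrite (@eq_iter_integral R 4 _ (fun l => (K * pos_powR N%:R
    (1 - \sum_(y <- l) y ^+ 2))%:E)) => [|l _]; last by rewrite indicT mul1r.
  by rewrite (K'E 1 K (ltW K0)) ltry.
have coverM : covered Y Y Y.
  by apply: (covered_bool (symmetry_one Y)) => q; left.
have coverY := @covered_conjugation row_p row_r.
have param := spatial_local_param dE VM.
have imE := @image_spatial_chart R N d dE.
have rowY := @frame_row R N.+3.
have mu_inv := stiefel_moves vol param imE V_lty mY YY rowY rowY coverM coverY.
have Y_lty := stiefel_lty vol param imE V_lty mY mY YY rowY rowY coverM coverY.
have [C C0 CE] := @integral_sqr_norm4_density R N%:R.
(* The factor 4 counts the sign choices of Re a_p and of the real minor. *)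
exists (4 * (C * K)); first by rewrite !mulr_gt0.
move=> B mB.
rewrite (stiefel_row_swap vol param imE V_lty mY mY YY rowY rowY coverM coverY)//.
have mE : measurable ([set q | B (row_sqnorm q ord0)] : set Q) by exact: measurable_row_sqnorm.
(* Re a and Im a never both vanish identically on a frame, so [conj_null] starts from the empty
   set. *)
have null0 : mu (Y `&` [set q | forall m, q m 0 = 0]) = 0%E.
  apply: (@conj_null mu (fun q m => q m 0) (fun q m => q m 1)) => //.
  - by move=> m; exact: continuous_entry.
  - by move=> m; exact: continuous_entry.
  - by move=> h k q m hk; have [-> -> _ _] := conjugationE q m hk.
  - rewrite (_ : _ `&` _ = set0) ?measure0// -subset0 => q [[a1 _ _ _] /= q0].
    move: a1; rewrite big1 => [/esym/eqP|m _]; first by rewrite oner_eq0.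
    by apply/eqP; rewrite norm_a_eq0; have [-> ->] := q0 m; rewrite eqxx.
have null_p := null_a row_p rowY rowY mY YY mY Y_lty mu_inv null0.
(* If all complex minors at p vanish then a_p = 0 by [frame_minor], which is null by [null_p];
   [conj_null] passes from the complex minors to their real parts. *)
have nullz : mu (Y `&` [set q | forall m, minor_re q row_p m = 0]) = 0%E.
  apply: (@conj_null mu (fun q m => minor_re q row_p m) (fun q m => minor_im q row_p m)) => //.
  - by move=> m; exact: continuous_minor_re.
  - by move=> m; exact: continuous_minor_im.
  - by move=> h k q m hk; exact: conjugation_minor.
  - apply: (subset_measure0 _ _ _ null_p).
    + have -> : [set q | forall m, minor_re q row_p m = 0 /\ minor_im q row_p m = 0] =
          [set q : quatn R N.+3 | forall m, minor_re q row_p m = 0] `&`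
          [set q | forall m, minor_im q row_p m = 0].
        by apply/seteqP; split => q /= => [q0|[q0 q1] m]; [split => m; have [] := q0 m|].
      apply: measurableI => //; apply: measurableI; apply: borel_forall_eq0 => m.
        exact: continuous_minor_re.
      exact: continuous_minor_im.
    + by apply: measurableI => //; apply: borel_eq; exact: continuous_entry.
    + move=> q [Yq q0]; split => //=.
      by have /eqP := frame_minor Yq q0; rewrite norm_a_eq0 => /andP[/eqP].
rewrite (measure_stiefel_chart row_pr rowY rowY mY YY mY Y_lty mu_inv mE _ null0 nullz); last first.
  by move=> k q /=; rewrite row_sqnorm_row_flip.
rewrite KE// CE// -ge0_integralZl_EFin//; last 3 first.
- by apply: measurableI => //; exact: measurable_itv.
- by move=> t [/=]; rewrite in_itv/= => /andP[t0 _] _; rewrite lee_fin !mulr_ge0 ?powR_ge0// ltW.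
- apply/measurable_EFinP; apply: measurable_funTS; apply: measurable_funM => //.
  apply: measurable_funM => //.
  have mB1 : measurable_fun setT (fun t : R => 1 - t) by exact: measurable_funB.
  exact: (measurableT_comp (@measurable_powR R _) mB1).
apply: eq_integral => t /set_mem[/= + _]; rewrite in_itv/= => /andP[t0 t1].
by rewrite -EFinM powR_mulrn ?subr_ge0// !mulrA.
Qed.

Lemma Pol3_density (P : set 'M[R]_(N.+3, 3) -> \bar R) (i : 'I_N.+3) : symmetric_Pol3 P ->
  has_density P (@Pol R 3 N.+3) (fun e => edge_length e i) `[0, 1]
    (fun y => (N.+3%:R - 2) * (N.+3%:R - 1) * y * (1 - y) ^+ (N.+3 - 3)).
Proof.
rewrite /symmetric_Pol3 model_Pol3E => symP.
have -> : (N.+3 - 3 = N)%N by lia.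
have -> : N.+3%:R - 2 = N.+1%:R :> R by rewrite -[N.+3]addn2 (natrD R N.+1 2) addrK.
have -> : N.+3%:R - 1 = N.+2%:R :> R by rewrite -[N.+3]addn1 (natrD R N.+2 1) addrK.
have kap : 0 < N.+1%:R * N.+2%:R :> R by apply: mulr_gt0; rewrite ltr0n.
have mf : measurable_fun setT (fun y : R => N.+1%:R * N.+2%:R * y * (1 - y) ^+ N).
  apply: measurable_funM; first exact: measurable_funM.
  by apply: measurable_funX; exact: measurable_funB.
have f0 (y : R) : 0 <= y -> y <= 1 -> 0 <= N.+1%:R * N.+2%:R * y * (1 - y) ^+ N.
  by move=> y0 y1; rewrite mulr_ge0 ?exprn_ge0 ?subr_ge0// mulr_ge0// ltW.
apply: (has_density_of_volume (i := i) symP _ (Hopf_preimage_Pol3 i)) => //.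
- exact: measurable_frame.
- move=> B mB; apply: measurableI; last exact: measurable_row_sqnorm.
  by apply: measurableI; [exact: measurable_dotq2|exact: measurable_Hopf_closed].
- move=> B q fq; split=> [[]//|Bq]; split=> //.
  by split; [exact: dotq_frame2|exact: Hopf_closed_frame].
- have := @integral_density_y R 1 N ltr01; under eq_integral do rewrite expr1n divr1.
  by [].
move=> mu vol; have [K K0 KE] := volume_Pol3 i vol.
exists (K / (N.+1%:R * N.+2%:R)); first exact: divr_gt0.
move=> B mB; rewrite KE// -ge0_integralZl_EFin//; last 4 first.
- by apply: measurableI => //; exact: measurable_itv.
- by move=> t [/=]; rewrite in_itv/= => /andP[t0 t1] _; rewrite lee_fin f0.
- by apply/measurable_EFinP; exact: measurable_funTS mf.
- by rewrite ltW// divr_gt0.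
apply: eq_integral => t _; rewrite -EFinM; congr (_%:E).
by move: (_ * _) kap ((1 - t) ^+ _) => ka ka0 s; field; rewrite gt_eqF.
Qed.

End pol3.

Theorem proposition24 (R : realType) (n : nat) (i : 'I_n) :
  ((2 <= n)%N ->
    (forall P : set 'M[R]_(n, 3) -> \bar R, symmetric_Arm3 P ->
      has_density P (@Arm R 3 n) (fun e => edge_length e i) `[0, 2]
        (fun y => (2 * n%:R - 2) * (2 * n%:R - 1) / 2 ^+ (2 * n - 1)
                  * y * (2 - y) ^+ (2 * n - 3))) /\
    (forall P : set 'M[R]_(n, 2) -> \bar R, symmetric_Arm2 P ->
      has_density P (@Arm R 2 n) (fun e => edge_length e i) `[0, 2]
        (fun y => (n%:R - 1) / 2 ^+ (n - 1) * (2 - y) ^+ (n - 2)))) /\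
  ((3 <= n)%N ->
    (forall P : set 'M[R]_(n, 3) -> \bar R, symmetric_Pol3 P ->
      has_density P (@Pol R 3 n) (fun e => edge_length e i) `[0, 1]
        (fun y => (n%:R - 2) * (n%:R - 1) * y * (1 - y) ^+ (n - 3))) /\
    (forall P : set 'M[R]_(n, 2) -> \bar R, symmetric_Pol2 P ->
      has_density P (@Pol R 2 n) (fun e => edge_length e i) `[0, 1]
        (fun y => (n%:R / 2 - 1) * ((1 - y) `^ (n%:R / 2 - 2))))).
Proof.
split => n2.
  case: n i n2 => [|[|n]]// i _; split => P symP.
    exact: Arm3_density.
  exact: Arm2_density.
case: n i n2 => [|[|[|n]]]// i _; split => P symP.
  exact: Pol3_density.
exact: Pol2_density.
Qed.
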